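(* For $D\ge 3$, the Interface Algorithm (described in full in the context) provides a $\frac{2}{D+1}$-factor approximation for the Max Morse Matching Problem for $D$-dimensional simplicial manifolds without boundary. That is, on every such manifold $\mathcal{K}$ the Morse matching it outputs has at least $\frac{2}{D+1}\cdot\mathrm{OPT}(\mathcal{K})$ regular simplices.
   Context: For simplices $\tau,\sigma$ of a (finite) simplicial complex $\mathcal{K}$ write $\tau\prec\sigma$ ($\tau$ is a facet of $\sigma$, $\sigma$ a cofacet of $\tau$) if $\tau\subset\sigma$ and $\dim\tau=\dim\sigma-1$. The Hasse graph $H$ of $\mathcal{K}$ is the undirected graph whose vertices are the simplices of $\mathcal{K}$, with an edge between $\tau$ and $\sigma$ exactly when $\tau\prec\sigma$. The $d$-interface is the subgraph on the $d$-simplices and $(d-1)$-simplices with all edges between them. In an orientation, an edge $\tau\to\sigma$ with $\tau\prec\sigma$ is an up-edge and $\sigma\to\tau$ is a down-edge. The orientation induced by a matching $M$ makes the edges of $M$ up-edges and all others down-edges. $M$ is a Morse (acyclic) matching if this directed graph has no directed cycle. Simplices covered by $M$ are regular. The Max Morse Matching Problem asks for a Morse matching with the maximum number of regular simplices; this maximum is $\mathrm{OPT}(\mathcal{K})$. Frontier procedure on a subgraph $W$ of an interface. Compute a maximum-cardinality matching of $W$ and let $\overline{W}$ be the induced orientation. An up-edge from $\alpha$ to $\beta$ is written $\chi(\alpha,\beta)$. A leading up-edge of $\chi_1(\alpha_1,\beta_1)$ is an up-edge $\chi_3(\alpha_2,\beta_2)$ such that $\beta_1\to\alpha_2$ is a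 down-edge. The facet-edges of $\beta$ are the edges between $\beta$ and its facets, with current orientations. While $\overline{W}$ contains an up-edge $\chi$, compute an edge set $C$ as follows, then move $C$ from $\overline{W}$ to the output. Start with $C=\emptyset$ and queue $\{\chi\}$. While the queue is nonempty, dequeue $\chi_0(\alpha_0,\beta_0)$ and add the facet-edges of $\beta_0$ to $C$; for every leading up-edge $\chi_i(\alpha_i,\beta_i)$ of $\chi_0$, if $C$ together with the facet-edges of $\beta_i$ has a cycle, reverse $\chi_i$ and add the facet-edges of $\beta_i$ to $C$, otherwise enqueue $\chi_i$. Finally add the remaining edges to the output. The up-edges of the output are the resulting matching. Procedure intermediateApx$(W,d)$. (1) Apply the frontier procedure to $W$. (2) For every unmatched $(d-1)$-simplex $\tau$ of $W$ all of whose cofacets in $W$ are also unmatched, match $\tau$ with one of these cofacets. (3) Make the matched pairs up-edges in the output orientation, and delete from the Hasse graph all simplices matched in this step and all critical (unmatched) $(d-1)$-simplices of $W$. Procedure DFSoptimal on a connected graph: choose an arbitrary start vertex, leave it critical, run a depth-first search, and whenever an unvisited vertex $w$ is reached from $v$ along an edge, match $w$ with that edge. Interface Algorithm. Start with all edges of the output orientation being down-edges. Process the interfaces in the order $d=1,\dots,D$, each time extracting the $d$-interface $G^d$ of the current Hasse graph (after all deletions so far). - $d=1$: apply DFSoptimal to the graph whose vertices and edges are the $0$- and $1$-simplices; record the matched pairs as up-edges and delete from the Hasse graph the matched simplices and the critical $0$-simplices. - $1<d<D$: apply intermediateApx$(G^d,d)$. - $d=D$: apply DFSoptimal to the dual graph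 of the current $D$-interface (vertices are the $D$-simplices; edges are the remaining $(D-1)$-simplices, each joining the two $D$-simplices that have it as a common facet), and record the matched pairs as up-edges. The up-edges of the final orientation are the output Morse matching. *)

(* Defs.v *)
From HB Require Import structures.
From mathcomp Require Import all_boot all_order all_algebra.
From mathcomp Require Import boolp.

Set Implicit Arguments.
Unset Strict Implicit.
Unset Printing Implicit Defensive.

(* [foreach body l s s']: a loop "for every x in l do body", where one run of
   the (possibly non-deterministic) body on x may turn state s into s'.  *)
Inductive foreach (X S : Type) (body : X -> S -> S -> Prop) :
    seq X -> S -> S -> Prop :=
| foreach_nil s : foreach body [::] s s
| foreach_cons x l s s1 s2 :
    body x s s1 -> foreach body l s1 s2 -> foreach body (x :: l) s s2.

Definition foreach_in (X : finType) (S : Type) (body : X -> S -> S -> Prop)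
    (A : {set X}) (s s' : S) : Prop :=
  exists2 l : seq X, perm_eq l (enum A) & foreach body l s s'.

Section Complexes.

Variable T : finType.

Definition simplex := {set T}.

(* An undirected edge {t, s} of a Hasse graph with t a facet of s is stored as
   the pair (t, s). *)
Definition edge := (simplex * simplex)%type.

Definition simplicial_complex (K : {set simplex}) : Prop :=
  (set0 \notin K) /\
  (forall s t : simplex, s \in K -> t \subset s -> t != set0 -> t \in K).

(* Only used on non-empty simplices ([dim set0 = 0] is a dummy value). *)
Definition dim (s : simplex) : nat := #|s|.-1.

Definition complex_dim (K : {set simplex}) : nat := \max_(s in K) dim s.

Definition facet (t s : simplex) : bool :=
  (t \subset s) && (dim s == (dim t).+1).

Definition hasse (H : {set simplex}) : {set edge} :=
  [set e : edge | [&& e.1 \in H, e.2 \in H & facet e.1 e.2]].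

Definition interface (H : {set simplex}) (d : nat) : {set simplex} :=
  [set s in H | (dim s == d) || ((dim s).+1 == d)].

Definition cofacets (H : {set simplex}) (t : simplex) : {set simplex} :=
  [set s in H | facet t s].

(* Orientation of the edge set E whose up-edges are those in M. *)
Definition arc (E M : {set edge}) : rel simplex :=
  fun x y => ((x, y) \in E :&: M) || ((y, x) \in E :\: M).

Definition has_directed_cycle (r : rel simplex) : Prop :=
  exists2 c : seq simplex, c != [::] & cycle r c.

Definition matching (E M : {set edge}) : bool :=
  (M \subset E) &&
  [forall e in M, forall f in M,
     (e != f) ==> [disjoint [set e.1; e.2] & [set f.1; f.2]]].

Definition maximum_matching (E M : {set edge}) : Prop :=
  matching E M /\ (forall M' : {set edge}, matching E M' -> #|M'| <= #|M|).

Definition morse_matching (K : {set simplex}) (M : {set edge}) : Prop :=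
  matching (hasse K) M /\ ~ has_directed_cycle (arc (hasse K) M).

Definition regular (M : {set edge}) : {set simplex} :=
  \bigcup_(e in M) [set e.1; e.2].

Definition OPT (K : {set simplex}) : nat :=
  \max_(M : {set edge} | `[< morse_matching K M >]) #|regular M|.

(* Below, R is the edge set of the current graph (the edges not yet moved to
   the output) and U is the set of edges that are currently up-edges. *)

Definition facet_edges (R : {set edge}) (b : simplex) : {set edge} :=
  [set e in R | e.2 == b].

Definition leading (R U : {set edge}) (x : edge) : {set edge} :=
  [set y in R :&: U | (y.1, x.2) \in R :\: U].

(* State (U, C, Q).  C is a set of undirected edges that are always read with
   their current orientation, so reversing an edge of C acts on C as well. *)
Definition search_state :=
  ({set edge} * {set edge} * seq edge)%type.

Inductive inspect (R : {set edge}) (y : edge) :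
    search_state -> search_state -> Prop :=
| inspect_reverse U C Q :
    has_directed_cycle (arc (C :|: facet_edges R y.2) U) ->
    inspect R y (U, C, Q) (U :\ y, C :|: facet_edges R y.2, Q)
| inspect_enqueue U C Q :
    ~ has_directed_cycle (arc (C :|: facet_edges R y.2) U) ->
    inspect R y (U, C, Q) (U, C, rcons Q y).

Inductive search (R : {set edge}) :
    search_state -> {set edge} -> {set edge} -> Prop :=
| search_done U C : search R (U, C, [::]) U C
| search_dequeue U C x Q st U' C' :
    foreach_in (inspect R) (leading R U x)
               (U, C :|: facet_edges R x.2, Q) st ->
    search R st U' C' ->
    search R (U, C, x :: Q) U' C'.

Inductive frontier_loop : {set edge} -> {set edge} -> {set edge} -> Prop :=
| frontier_stop R U : R :&: U = set0 -> frontier_loop R U U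
| frontier_next R U x U1 C U2 :
    x \in R :&: U ->
    search R (U, set0, [:: x]) U1 C ->
    frontier_loop (R :\: C) U1 U2 ->
    frontier_loop R U U2.

(* M is a possible result on the graph with edge set E; at the end all edges
   are in the output, so the up-edges of the output are the final U. *)
Definition frontier (E M : {set edge}) : Prop :=
  exists2 M0 : {set edge}, maximum_matching E M0 & frontier_loop E M0 M.

Definition lower (W : {set simplex}) (d : nat) : {set simplex} :=
  [set t in W | (dim t).+1 == d].

Definition critical_lower (W : {set simplex}) (d : nat) (M : {set edge}) :=
  lower W d :\: regular M.

Definition extendable (W : {set simplex}) (M : {set edge}) (t : simplex) :=
  (t \notin regular M) && [disjoint cofacets W t & regular M].

(* The last case skips t; it covers a t without any cofacet in W. *)
Inductive extend (W : {set simplex}) (t : simplex) :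
    {set edge} -> {set edge} -> Prop :=
| extend_match M s :
    extendable W M t -> s \in cofacets W t -> extend W t M ((t, s) |: M)
| extend_skip M :
    ~~ extendable W M t \/ cofacets W t = set0 -> extend W t M M.

Definition intermediate_apx (W : {set simplex}) (d : nat) (M : {set edge}) :
    Prop :=
  exists2 M1 : {set edge}, frontier (hasse W) M1 &
    foreach_in (extend W) (lower W d) M1 M.

(* Graph with vertex set V; [joins e v w] says that the edge e joins v and w.
   A state is (visited vertices, matched pairs (edge, vertex)). *)
Definition dfs_state := ({set simplex} * {set simplex * simplex})%type.

(* The sequence is the stack of the search, current vertex first. *)
Inductive dfs (V : {set simplex}) (joins : simplex -> rel simplex) :
    seq simplex -> dfs_state -> dfs_state -> Prop :=
| dfs_empty st : dfs V joins [::] st st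
| dfs_push v l (X : {set simplex}) N e w st :
    w \in V -> joins e v w -> w \notin X ->
    dfs V joins (w :: v :: l) (w |: X, (e, w) |: N) st ->
    dfs V joins (v :: l) (X, N) st
| dfs_pop v l (X : {set simplex}) N st :
    (forall e w, w \in V -> joins e v w -> w \in X) ->
    dfs V joins l (X, N) st ->
    dfs V joins (v :: l) (X, N) st.

(* One search per connected component, from an arbitrary start vertex that
   stays critical; a connected graph gets exactly one search. *)
Inductive dfs_forest (V : {set simplex}) (joins : simplex -> rel simplex) :
    dfs_state -> {set simplex * simplex} -> Prop :=
| dfs_forest_done (X : {set simplex}) N : V \subset X -> dfs_forest V joins (X, N) N
| dfs_forest_start r (X : {set simplex}) N st N' :
    r \in V :\: X ->
    dfs V joins [:: r] (r |: X, N) st ->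
    dfs_forest V joins st N' ->
    dfs_forest V joins (X, N) N'.

Definition dfs_optimal (V : {set simplex}) (joins : simplex -> rel simplex)
    (N : {set simplex * simplex}) : Prop :=
  dfs_forest V joins (set0, set0) N.

Definition primal_joins (G : {set simplex}) (e : simplex) : rel simplex :=
  fun v w => [&& e \in G, v != w, facet v e & facet w e].

Definition dual_joins (G : {set simplex}) (e : simplex) : rel simplex :=
  fun v w => [&& e \in G, v != w, facet e v & facet e w].

Definition of_dim (G : {set simplex}) (d : nat) : {set simplex} :=
  [set s in G | dim s == d].

(* H after deleting the simplices matched by M1 in the d-interface and the
   critical (d-1)-simplices of that interface. *)
Definition remaining (H : {set simplex}) (d : nat) (M1 : {set edge}) :=
  H :\: (regular M1 :|: critical_lower (interface H d) d M1).

(* State (H, M): the simplices of the current Hasse graph and the up-edges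
   recorded so far. *)
Definition algo_state := ({set simplex} * {set edge})%type.

(* Up-edges are (facet, cofacet), so the pairs (edge, vertex) found by the
   search are swapped for d = 1 and kept for d = D. *)
Inductive process_interface (D d : nat) : algo_state -> algo_state -> Prop :=
| process_first H M N M1 :
    d = 1 ->
    dfs_optimal (of_dim (interface H d) 0) (primal_joins (interface H d)) N ->
    M1 = [set (p.2, p.1) | p in N] ->
    process_interface D d (H, M) (remaining H d M1, M :|: M1)
| process_middle H M M1 :
    1 < d < D ->
    intermediate_apx (interface H d) d M1 ->
    process_interface D d (H, M) (remaining H d M1, M :|: M1)
| process_last H M N :
    d = D ->
    dfs_optimal (of_dim (interface H d) D) (dual_joins (interface H d)) N ->
    process_interface D d (H, M) (H, M :|: N).

(* M is a possible output on the complex K. *)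
Definition interface_algorithm (D : nat) (K : {set simplex}) (M : {set edge}) :
    Prop :=
  exists H : {set simplex},
    foreach (process_interface D) (iota 1 D) (K, set0) (H, M).

End Complexes.

From mathcomp Require Import classical_sets reals topology normedtype.
Import GRing.Theory Num.Theory.
Import numFieldNormedType.Exports.

Local Open Scope classical_set_scope.
Local Open Scope ring_scope.

Definition homeomorphic (X Y : topologicalType) (A : set X) (B : set Y) :
    Prop :=
  exists (f : X -> Y) (g : Y -> X),
    [/\ {within A, continuous f}, {within B, continuous g},
        (forall x, A x -> B (f x) /\ g (f x) = x) &
        (forall y, B y -> A (g y) /\ f (g y) = y)].

Section Manifolds.

Variables (R : realType) (T : finType).

(* Barycentric coordinates: points of R^T are row vectors indexed through the
   enumeration of T. *)
Definition coord (x : 'rV[R]_#|T|) (v : T) : R := x ord0 (enum_rank v).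

Definition realization (K : {set {set T}}) : set 'rV[R]_#|T| :=
  [set x | [/\ forall v, 0 <= coord x v, \sum_(v : T) coord x v = 1 &
               finset (fun v : T => coord x v != 0) \in K]].

(* Hausdorff and second countable are automatic for subspaces of R^T. *)
Definition locally_euclidean (D n : nat) (X : set 'rV[R]_n) : Prop :=
  forall x, X x -> exists (U : set 'rV[R]_n) (V : set 'rV[R]_D),
    [/\ open U, U x, open V & homeomorphic (X `&` U) V].

Definition simplicial_manifold (D : nat) (K : {set {set T}}) : Prop :=
  [/\ simplicial_complex K, complex_dim K = D &
      locally_euclidean D (realization K)].

End Manifolds.

(* Main.v *)
(** The number of pairs is compared with an upper bound for any Morse matching
    [Ms].  In the 1-skeleton and in the dual graph every component contains a
    simplex that is critical for [Ms], and depth-first search loses exactly one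
    simplex per component.  Step (2) of [intermediate_apx] ensures that every
    critical simplex of dimension between 1 and D - 2 is a facet of a simplex
    matched from below, so there are at most D of them for each such pair,
    whatever matching the frontier procedure returns.  The (D - 1)-simplices
    number at most half of (D + 1) times the D-simplices, which leaves room
    because a component of the dual graph has at least three of the latter.
    That the dual graph stays connected after the deletions follows by going
    around the partner of a deleted (D - 1)-simplex, in the acyclic order.

    The only facts needed about manifolds are that a simplex of dimension less
    than D has at least two cofacets, and at most two if its dimension is D - 1.
    Both follow from invariance of domain, which is obtained from the
    Poincare-Miranda theorem by Kulpa's argument; the combinatorial core of the
    latter theorem is that a cup product of n coboundaries on a grid, mod 2,
    is determined by its values on the boundary. *)

Require Import Defs.
From mathcomp Require Import all_boot all_order all_algebra.
From mathcomp Require Import boolp.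
From mathcomp Require Import zify ring lra.
(* The [arc] of path and the [coord] of vector would shadow those of Defs. *)
Import Defs.
Set Implicit Arguments.
Unset Strict Implicit.
Unset Printing Implicit Defensive.

(** * Directed cycles and depth-first search *)

(** The factor comes from a charging scheme. Regular simplices number twice the pairs, so it
    suffices that any Morse matching has at most [D + 1] regular simplices for each pair of the
    output. Discarding one critical vertex and one critical [D]-simplex per component leaves exactly
    as many vertices and [D]-simplices as the two searches pair. These, the walls (the simplices of
    dimension [D - 1]) and the intermediate simplices are charged to pairs. A pair of the last
    interface pays for one [D]-simplex and [D] walls, a pair in the middle for its larger simplex
    and at most [D] facets. The walls are the tight spot: at most [3 (D + 1) / 4] of them fall on
    each such pair, and this is at most [D] precisely when [D >= 3].

    Two obstacles are separate from the count. The procedures are relations, so an output exists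
    only if they terminate, and the frontier search can enqueue the same edge again. Moreover each
    matching is acyclic only within its own interface; for the union a potential must confine
    directed cycles to one interface. *)

Section Acyclicity.
Variables (S : finType) (r : rel S).

Lemma path_rank_lt (f : S -> nat) x p : (forall x y, r x y -> f y < f x) ->
  path r x p -> p != [::] -> f (last x p) < f x.
Proof.
move=> rf; elim: p x => // y p IH x /= /andP[/rf xy yp] _.
by case: p IH yp => // z p IH yp; apply: ltn_trans xy; apply: IH.
Qed.

(** The rank of [x] is the number of vertices reachable from it. It drops along an arc because [x]
    cannot be reached back from its successor. *)
Lemma exists_rank : (forall c, cycle r c -> c = [::]) ->
  exists f : S -> nat, forall x y, r x y -> f y < f x.
Proof.
move=> acyc; exists (fun x => #|connect r x|) => x y xy.
apply: proper_card; apply/properP; split.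
  by apply/subsetP => z; rewrite !inE; apply: connect_trans; exact: connect1.
exists x; rewrite ?inE ?connect0 //; apply/negP => /connectP[p yp xp].
by have := acyc (y :: p); rewrite /= rcons_path yp -xp xy => /(_ isT).
Qed.

End Acyclicity.

Section DirectedCycles.
Variable T : finType.
Implicit Types (r : rel (simplex T)) (E M U : {set edge T}).

Lemma rank_acyclic r (f : simplex T -> nat) :
  (forall x y, r x y -> f y < f x) -> ~ has_directed_cycle r.
Proof.
move=> rf [[//|x p] _ /= /(path_rank_lt rf)].
by rewrite last_rcons ltnn; case: p => [|y p] /(_ isT).
Qed.

Lemma acyclic_rank r : ~ has_directed_cycle r ->
  exists f : simplex T -> nat, forall x y, r x y -> f y < f x.
Proof.
move=> acyc; apply: exists_rank => c rc; apply/eqP/contraT => c0.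
by case: acyc; exists c.
Qed.

Lemma arc_up E M x y : (x, y) \in E -> (x, y) \in M -> arc E M x y.
Proof. by move=> xyE xyM; rewrite /arc inE xyE xyM. Qed.

Lemma arc_down E M x y : (y, x) \in E -> (y, x) \notin M -> arc E M x y.
Proof. by move=> yxE yxM; rewrite /arc orbC inE yxE yxM. Qed.

Lemma arcP E M x y : arc E M x y ->
  ((x, y) \in E /\ (x, y) \in M) \/ ((y, x) \in E /\ (y, x) \notin M).
Proof.
by rewrite /arc => /orP[]; rewrite inE => /andP[]; [left|right].
Qed.

End DirectedCycles.

(* [inc e v]: the edge [e] of the graph is incident to the vertex [v]. *)
Section DepthFirstSearch.
Variables (T : finType) (V G : {set simplex T}) (inc : rel (simplex T)).

(** Both [primal_joins] and [dual_joins] are instances by conversion, with [facet v e] or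
    [facet e v] for [inc e v], so one analysis serves the first and the last interface. *)
Definition inc_joins (e : simplex T) : rel (simplex T) :=
  fun v w => [&& e \in G, v != w, inc e v & inc e w].

Hypothesis two_ends : forall e u v w, e \in G -> u \in V -> v \in V -> w \in V ->
  inc e u -> inc e v -> inc e w -> u != v -> w = u \/ w = v.

Local Notation joins := inc_joins.

Definition adjacent : rel (simplex T) :=
  fun v w => [&& v \in V, w \in V & [exists e, joins e v w]].

Lemma adjacent_sym : symmetric adjacent.
Proof.
move=> v w; rewrite /adjacent andbCA; congr [&& _, _ & _].
by apply: eq_existsb => e; rewrite /joins eq_sym; congr [&& _, _ & _]; exact: andbC.
Qed.

(** The pairs form an oriented forest: a discovery edge is paired with its later end. The rank is
    the order of discovery, and its clause later yields acyclicity. *)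
Definition searched (st : dfs_state T) : Prop :=
  [/\ st.1 \subset V,
      forall e w, (e, w) \in st.2 -> [/\ e \in G, w \in st.1, inc e w &
        exists2 v, v \in st.1 & v != w /\ inc e v],
      forall e w e' w', (e, w) \in st.2 -> (e', w') \in st.2 ->
        e = e' \/ w = w' -> (e, w) = (e', w') &
      exists rk : simplex T -> nat, forall e w v, (e, w) \in st.2 -> v \in V ->
        v != w -> inc e v -> rk v < rk w].

Definition closed_off (l : seq (simplex T)) (X : {set simplex T}) :=
  forall v, v \in X -> v \notin l -> forall e w, w \in V -> joins e v w -> w \in X.

Lemma searched_push e v w X N : searched (X, N) -> v \in X -> w \in V ->
  joins e v w -> w \notin X -> searched (w |: X, (e, w) |: N).
Proof.
move=> [/= XV N1 N2 [rk N3]] vX wV /and4P[eG vw ev ew] wX.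
have XinV u : u \in X -> u \in V by move/(subsetP XV).
(* Both ends of an edge already paired are visited, and by [two_ends] it has no third end [w]. *)
have old e' w' : (e', w') \in N -> inc e' w -> False.
  move=> eN ew'; have [e'G w'X e'w' [v' v'X [vw' e'v']]] := N1 _ _ eN.
  have := two_ends e'G (XinV _ v'X) (XinV _ w'X) wV e'v' e'w' ew' vw'.
  by case=> ww; move: wX; rewrite ww ?v'X ?w'X.
have oldw e' w' : (e', w') \in N -> w' != w.
  by move=> /N1[_ w'X _ _]; apply: contraNneq wX => <-.
split=> /=.
- by apply/subsetP => u; rewrite !inE => /predU1P[->//|/XinV].
- move=> e' w'; rewrite !inE => /predU1P[[-> ->]|/N1[e'G w'X e'w' [v' v'X v'P]]].
    by split; rewrite ?eqxx //; exists v; rewrite ?inE ?vX ?orbT.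
  by split; rewrite ?w'X ?orbT //; exists v'; rewrite ?inE ?v'X ?orbT.
- move=> e1 w1 e2 w2; rewrite !inE => /predU1P[[-> ->]|N1e] /predU1P[[-> ->]|N2e] // [ee|ww].
  + by subst e2; case: (old _ _ N2e).
  + by have := oldw _ _ N2e; rewrite -ww eqxx.
  + by subst e1; case: (old _ _ N1e).
  + by have := oldw _ _ N1e; rewrite ww eqxx.
  + by apply: N2 => //; left.
  + by apply: N2 => //; right.
- pose B := \max_u rk u.
  have rkB u : rk u <= B by exact: leq_bigmax.
  exists (fun u => if u == w then B.+1 else rk u) => e' w' u.
  rewrite !inE => /predU1P[[-> ->]|eN] uV uw eu.
    by rewrite eqxx (negbTE uw) ltnS.
  rewrite (negbTE (oldw _ _ eN)); case: eqP => [uw'|_]; last exact: N3 eN _ _ _.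
  by case: (old _ _ eN); rewrite -uw'.
Qed.

Lemma dfs_spec l st st' : dfs V joins l st st' -> searched st ->
  {subset l <= st.1} -> closed_off l st.1 ->
  [/\ searched st', closed_off [::] st'.1, st.1 \subset st'.1 &
      #|st'.1| + #|st.2| = #|st.1| + #|st'.2|].
Proof.
elim=> {l st st'} [st sst _ cl|v l X N e w st wV vw wX _ IH sXN lX cl|v l X N st stop _ IH sXN lX cl].
- by split.
- have vX : v \in X by apply: lX; rewrite mem_head.
  have [||/= sst cst Xst cardst] := IH (searched_push sXN vX wV vw wX).
  + move=> u; rewrite !inE => /predU1P[->|]; rewrite ?eqxx // => ul.
    by apply/orP; right; apply: lX; rewrite inE.
  + move=> u /=; rewrite !inE => uwX; rewrite !negb_or => /and3P[uw uv ul] e' w' w'V uw'.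
    move: uwX; rewrite (negbTE uw) /= => uX; rewrite inE; apply/orP; right.
    by apply: (cl u uX _ e' w' w'V uw'); rewrite inE negb_or uv.
  split=> //; first by apply: subset_trans Xst; exact: subsetUr.
  have eN : (e, w) \notin N by apply: contra wX; case: sXN => _ H _ _ /H[].
  by move: cardst; rewrite !cardsU1 wX eN /=; lia.
- apply: IH => // [u ul|u uX ul]; first by apply: lX; rewrite inE ul orbT.
  case: (eqVneq u v) => [-> e w wV|uv]; first exact: stop.
  by apply: cl; rewrite ?inE ?negb_or ?uv.
Qed.

Lemma connect_closed X v w : closed_off [::] X -> v \in X -> connect adjacent v w -> w \in X.
Proof.
move=> cl vX /connectP[p + ->]; elim: p v vX => //= u p IH v vX /andP[/and3P[_ uV /existsP[e vu]]].
by move=> up; apply: IH up; exact: (cl v vX isT e u uV vu).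
Qed.

Definition separated (Rt : {set simplex T}) :=
  forall u v, u \in Rt -> v \in Rt -> connect adjacent u v -> u = v.

(** [Rt] collects the start vertices. A finished search leaves a union of whole components, so the
    next start vertex is connected to no earlier one; every other visited vertex carries exactly one
    pair. *)
Lemma dfs_forest_spec st N (Rt : {set simplex T}) : dfs_forest V joins st N -> searched st ->
  closed_off [::] st.1 -> Rt \subset st.1 -> separated Rt -> #|st.1| = #|st.2| + #|Rt| ->
  exists Rt' : {set simplex T}, [/\ Rt' \subset V, separated Rt',
    #|V| = #|N| + #|Rt'| & searched (V, N)].
Proof.
move=> F; elim: F Rt => {st N} [X N VX|r X N st N' rVX Fr _ IH] Rt sst cl RtX sep cRt.
  have [XV _ _ _] := sst; have XE : X = V by apply/eqP; rewrite eqEsubset XV VX.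
  by exists Rt; rewrite -XE.
move: rVX; rewrite inE => /andP[rX rV].
have [XV N1 N2 N3] := sst.
have [|||sst' cl' Xst' card'] := dfs_spec Fr.
- split=> //=; first by apply/subsetP => u; rewrite !inE => /predU1P[->//|/(subsetP XV)].
  move=> e w /N1[? wX ? [v vX vP]]; split; rewrite ?inE ?wX ?orbT //.
  by exists v; rewrite ?inE ?vX ?orbT.
- by move=> u; rewrite !inE => ->.
- move=> u /=; rewrite !inE => /predU1P[->|uX]; rewrite ?eqxx // => ur e w wV uw.
  by rewrite inE; apply/orP; right; apply: (cl u uX _ e).
apply: (IH (r |: Rt)) => //.
- by apply: subset_trans Xst'; apply: setUS.
- have RtX' u : u \in Rt -> u \in X by move/(subsetP RtX).
  have symc : connect_sym adjacent by exact: (sym_connect_sym adjacent_sym).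
  move=> u v; rewrite !inE => /predU1P[->|uRt] /predU1P[->|vRt] //.
  + rewrite symc => /(connect_closed cl (RtX' _ vRt)) rX'.
    by rewrite rX' in rX.
  + by move=> /(connect_closed cl (RtX' _ uRt)) rX'; rewrite rX' in rX.
  + exact: sep.
- have rRt : r \notin Rt by apply: contra rX; move/(subsetP RtX).
  by move: card' cRt; rewrite /= !cardsU1 rX rRt /=; lia.
Qed.

Lemma dfs_optimal_spec N : dfs_optimal V joins N ->
  [/\ forall e w, (e, w) \in N -> [/\ e \in G, w \in V & inc e w],
      forall e w e' w', (e, w) \in N -> (e', w') \in N ->
        e = e' \/ w = w' -> (e, w) = (e', w'),
      exists rk : simplex T -> nat, forall e w v, (e, w) \in N -> v \in V ->
        v != w -> inc e v -> rk v < rk w &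
      exists Rt : {set simplex T}, [/\ Rt \subset V, separated Rt & #|V| = #|N| + #|Rt|]].
Proof.
move=> F; have [|||||Rt [RtV sep cRt [_ N1 N2 N3]]] := dfs_forest_spec (Rt := set0) F.
- split=> /= [|e w|e w e' w'|]; rewrite ?sub0set ?inE //.
  by exists (fun=> 0) => e w v; rewrite inE.
- by move=> v; rewrite inE.
- exact: sub0set.
- by move=> u v; rewrite inE.
- by rewrite /= !cards0.
by split=> //; [move=> e w /N1[]|exists Rt].
Qed.

Lemma dfs_exists l X N : exists st, dfs V joins l (X, N) st.
Proof.
have [n] := ubnP #|V :\: X|; elim: n X l N => // n IHn X l + /ltnSE cX.
elim: l => [|v l IHl] N; first by exists (X, N); constructor.
case: (pselect (exists e w, [/\ w \in V, joins e v w & w \notin X])) => [[e [w [wV vw wX]]]|no].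
  have [|st dst] := IHn (w |: X) (w :: v :: l) ((e, w) |: N).
    apply: leq_trans cX; apply: proper_card; apply/properP; split.
      by apply: setDS; exact: subsetUr.
    by exists w; rewrite !inE ?wX ?wV ?eqxx.
  by exists st; apply: dfs_push dst.
have [st dst] := IHl N; exists st; apply: dfs_pop dst => e w wV vw.
by apply: contrapT => /negP wX; apply: no; exists e, w.
Qed.

Lemma dfs_mono l st st' : dfs V joins l st st' -> st.1 \subset st'.1.
Proof.
elim=> {l st st'} // v l X N e w st _ _ _ _ /=.
by apply: subset_trans; exact: subsetUr.
Qed.

Lemma dfs_optimal_exists : exists N, dfs_optimal V joins N.
Proof.
rewrite /dfs_optimal; move: (set0 : {set simplex T * simplex T}) => N.
move: (set0 : {set simplex T}) => X; have [n] := ubnP #|V :\: X|.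
elim: n X N => // n IHn X N /ltnSE cX.
case: (boolP (V \subset X)) => [VX|/subsetPn[r rV rX]].
  by exists N; constructor.
have [st dst] := dfs_exists [:: r] (r |: X) N.
have /subsetP rst := dfs_mono dst.
have [|N' FN'] := IHn st.1 st.2; last first.
  exists N'; apply: dfs_forest_start dst _; first by rewrite inE rX.
  by case: (st) FN'.
apply: leq_trans cX; apply: proper_card; apply/properP; split.
  by apply: setDS; apply/subsetP => u uX; apply: rst; rewrite !inE uX orbT.
by exists r; rewrite !inE ?rX ?rV // rst // !inE eqxx.
Qed.

End DepthFirstSearch.

(** * The frontier procedure *)

Lemma foreach_exists (X S : Type) (body : X -> S -> S -> Prop) l s :
  (forall x s, exists s', body x s s') -> exists s', foreach body l s s'.
Proof.
move=> tot; elim: l s => [|x l IH] s; first by exists s; constructor.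
by have [s1 xs] := tot x s; have [s2 ls] := IH s1; exists s2; apply: foreach_cons ls.
Qed.

Lemma foreach_cat (X S : Type) (body : X -> S -> S -> Prop) l1 l2 u u' :
  foreach body (l1 ++ l2) u u' -> exists2 u1, foreach body l1 u u1 & foreach body l2 u1 u'.
Proof.
elim: l1 u => [|x l1 IH] u /= fe; first by exists u => //; constructor.
inversion fe as [|? ? ? u1 ? xu fe']; subst; have [u2 fe1 fe2] := IH _ fe'.
by exists u2 => //; apply: foreach_cons xu fe1.
Qed.

Lemma cycle_all (S : eqType) (r : rel S) (P : pred S) c x : cycle r c ->
  (forall x y, x \in c -> y \in c -> r x y -> P x -> P y) -> x \in c -> P x -> all P c.
Proof.
move=> cyc H xc Px; case: (rot_to xc) => i p rp.
suff /allP allp : all P (x :: p) by apply/allP => y; rewrite -(mem_rot i) rp; exact: allp.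
rewrite /= Px /=.
have {cyc} : path r x (rcons p x) by have := cyc; rewrite -(rot_cycle i) rp.
rewrite rcons_path => /andP[+ _].
have : {subset x :: p <= c} by move=> y; rewrite -rp mem_rot.
elim: p x xc Px {rp} => //= y p IH x xc Px sub /andP[xy yp].
have yc : y \in c by apply: sub; rewrite !inE eqxx orbT.
have Py := H x y xc yc xy Px; rewrite Py; apply: (IH y yc Py _ yp) => z zp.
by apply: sub; rewrite inE zp orbT.
Qed.

Lemma succ_absurd (P : Prop) (n d : nat) : n = d -> n.+1 = d -> P.
Proof. by move=> <- /eqP; rewrite gtn_eqF. Qed.

(** * Directed cycles within one interface *)

Section Cycles.
Variable T : finType.
Implicit Types (E F M U : {set edge T}) (c : seq (simplex T)).

Definition levelled d E := forall t s, (t, s) \in E -> (dim t).+1 = d /\ dim s = d.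

Definition functional_down M := forall t t' s, (t, s) \in M -> (t', s) \in M -> t = t'.
Definition functional_up M := forall t s s', (t, s) \in M -> (t, s') \in M -> s = s'.

(** Facet-edges are always moved together: over each larger simplex, the part moved contains all of
    the available edges or none. *)
Definition saturated E F := forall t t' s, (t, s) \in F -> (t', s) \in E -> (t', s) \in F.

Lemma cycle_prev_up d E U c s : levelled d E -> cycle (arc E U) c -> s \in c ->
  dim s = d -> exists2 t, t \in c & (t, s) \in E /\ (t, s) \in U.
Proof.
move=> Ed cE sc ds; exists (prev c s); first by rewrite mem_prev.
by case/arcP: (prev_cycle cE sc) => // -[/Ed[d1 d2] _]; lia.
Qed.

Lemma cycle_next_down d E U c s : levelled d E -> cycle (arc E U) c -> s \in c ->
  dim s = d -> exists2 t, t \in c & (t, s) \in E /\ (t, s) \notin U.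
Proof.
move=> Ed cE sc ds; exists (next c s); first by rewrite mem_next.
by case/arcP: (next_cycle cE sc) => // -[/Ed[d1 d2] _]; lia.
Qed.

Lemma cycle_next_up d E U c t : levelled d E -> cycle (arc E U) c -> t \in c ->
  (dim t).+1 = d -> exists2 s, s \in c & (t, s) \in E /\ (t, s) \in U.
Proof.
move=> Ed cE sc ds; exists (next c t); first by rewrite mem_next.
by case/arcP: (next_cycle cE sc) => // -[/Ed[d1 d2] _]; lia.
Qed.

(* A simplex on a directed cycle is entered through its matched edge, so
   removing other edges from the matching does not affect the cycle. *)
Lemma cycle_transfer d E E' U U' c : levelled d E' -> functional_down U ->
  U' \subset U -> cycle (arc E' U') c ->
  (forall t s, s \in c -> (t, s) \in E' -> (t, s) \in U' ->
     forall t', (t', s) \in E' -> (t', s) \in E) ->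
  cycle (arc E U) c.
Proof.
move=> E'd fU /subsetP U'U cyc H; apply: (sub_in_cycle (P := mem c)) (cyc); last exact/allP.
move=> x y xc yc /arcP[[xyE xyU]|[yxE yxU]].
  by apply: arc_up; [apply: (H x y)|exact: U'U].
have [_ dx] := E'd _ _ yxE.
have [t tc [txE txU]] := cycle_prev_up E'd cyc xc dx.
apply: arc_down; first exact: H txE txU _ yxE.
by apply: contra yxU => yxU; rewrite -(fU _ _ _ (U'U _ txU) yxU).
Qed.

End Cycles.

Section Frontier.
Variables (T : finType) (d : nat) (E : {set edge T}).
Hypothesis Ed : levelled d E.

Implicit Types (R U C : {set edge T}) (Q : seq (edge T)) (x y : edge T).

Lemma levelledS (F : {set edge T}) : F \subset E -> levelled d F.
Proof. by move=> /subsetP FE t s /FE/Ed. Qed.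

Lemma saturatedU R C b : saturated R C -> saturated R (C :|: facet_edges R b).
Proof.
move=> sC t t' s; rewrite !inE => /orP[/sC H /H->//|/andP[_ sb] t'R].
by rewrite t'R sb orbT.
Qed.

(** * One search of the frontier procedure *)

Section Search.
Variable R : {set edge T}.
Hypothesis RE : R \subset E.

(** The outcome of inspecting the edges in [l]. An up-edge of [C'] that survives was already in [C],
    because the facet-edges of [y.2] are added only when [y], the up-edge into [y.2], is reversed.
    The last clause preserves each acyclicity test that was passed, with [A] and [B] the values of
    [C] and [U] at that moment. *)
Definition inspected (U C : {set edge T}) (Q : seq (edge T)) (l : seq (edge T))
    (st : search_state T) : Prop :=
  let: (U', C', Q') := st in
  [/\ U' \subset U,
      [/\ forall y, y \in U -> y \notin U' -> y \in l,
          {subset Q <= Q'} & forall y, y \in Q' -> y \in Q \/ y \in l],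
      [/\ C \subset C', C' \subset R, saturated R C' &
          forall t s, (t, s) \in C' -> (t, s) \in U' -> (t, s) \in C] &
      forall y, y \in l -> y \notin U' \/ (y \in Q' /\ exists A B : {set edge T},
        [/\ C \subset A, U' \subset B, B \subset U &
            ~ has_directed_cycle (arc (A :|: facet_edges R y.2) B)])].

Lemma inspectP y U C Q st' : inspect R y (U, C, Q) st' ->
  let cyclic := has_directed_cycle (arc (C :|: facet_edges R y.2) U) in
  (cyclic /\ st' = (U :\ y, C :|: facet_edges R y.2, Q)) \/
  (~ cyclic /\ st' = (U, C, rcons Q y)).
Proof. by move=> ins; inversion ins; [left|right]. Qed.

Lemma inspect_spec l st st' : foreach (inspect R) l st st' ->
  let: (U, C, Q) := st in
  functional_down U -> C \subset R -> saturated R C -> uniq l -> {subset l <= U} ->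
  inspected U C Q l st'.
Proof.
elim=> {l st st'} [[[U C] Q]|y l [[U C] Q] [[U1 C1] Q1] [[U2 C2] Q2] ins _ IH] fU CR sC.
  move=> _ _; split=> //; split=> //; first by move=> y ->.
  by move=> y; left.
move=> /andP[yl ul] lU.
have FR : facet_edges R y.2 \subset R by apply/subsetP => e; rewrite inE => /andP[].
have yU : y \in U by apply: lU; rewrite mem_head.
have lU' z : z \in l -> z \in U by move=> zl; apply: lU; rewrite inE zl orbT.
case: (inspectP ins) IH => -[cyc0 [-> -> ->]] IH.
- have fU1 : functional_down (U :\ y).
    by move=> t t' s; rewrite !inE => /andP[_ tU] /andP[_ t'U]; exact: fU tU t'U.
  have [||||/= U2U [Ul QQ Ql] [CC CR2 sC2 CU] L] := IH fU1.
  + by rewrite subUset CR.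
  + exact: saturatedU.
  + exact: ul.
  + by move=> z zl; rewrite !inE lU' // andbT; apply: contraNneq yl => <-.
  have yU2 : y \notin U2 by apply/negP => /(subsetP U2U); rewrite !inE eqxx.
  split.
  + by apply: subset_trans U2U _; exact: subD1set.
  + split=> // [z zU zU2|z /Ql[]]; rewrite ?inE; last by move=> ->; right; rewrite orbT.
      by case: (eqVneq z y) => //= zy; apply: Ul => //; rewrite !inE zy.
    by left.
  + split=> //; first by apply: subset_trans CC; exact: subsetUl.
    move=> t s tC tU2; have := CU t s tC tU2; rewrite !inE => /orP[//|/andP[tR /eqP/= sy]].
    have tU : (t, s) \in U by have := subsetP U2U _ tU2; rewrite !inE => /andP[].
    have ty : t = y.1 by apply: (fU _ _ s) => //; rewrite sy -surjective_pairing.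
    by move: yU2; rewrite (surjective_pairing y) -ty -sy tU2.
  + move=> z; rewrite inE => /predU1P[->|/L[|[zQ [A [B [CA U2B BU acyc]]]]]]; [by left|by left|right].
    split=> //; exists A, B; split=> //; first by apply: subset_trans CA; exact: subsetUl.
    by apply: subset_trans BU _; exact: subD1set.
- have [//|/= U2U [Ul QQ Ql] [CC CR2 sC2 CU] L] := IH fU CR sC ul.
  split=> //.
  + split=> [z zU zU2|z zQ|z /Ql[]]; rewrite ?inE.
    * by rewrite Ul ?orbT.
    * by apply: QQ; rewrite mem_rcons inE zQ orbT.
    * by rewrite mem_rcons inE => /predU1P[->|->]; [right; rewrite eqxx|left].
    * by move=> ->; right; rewrite orbT.
  + move=> z; rewrite inE => /predU1P[->|/L[|[zQ [A [B [CA U2B BU acyc']]]]]]; [|by left|right].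
      right; split; first by apply: QQ; rewrite mem_rcons mem_head.
      by eexists; eexists; split; last exact: cyc0.
    by split=> //; exists A, B.
Qed.

(** Once the queue is empty, the last clause says that the leading up-edges of up-edges in [C] lie
    in [C]; this is what makes the output closed in [loop_inv]. *)
Definition search_inv U (st : search_state T) : Prop :=
  let: (U', C, Q) := st in
  [/\ U' \subset U, U :\: U' \subset R, C \subset R /\ saturated R C,
      ~ has_directed_cycle (arc C U') &
      {subset Q <= R} /\
      forall t s y, (t, s) \in C -> (t, s) \in U' -> y \in leading R U' (t, s) -> y \in C \/ y \in Q].

Lemma search_inv0 U x : x \in R -> search_inv U (U, set0, [:: x]).
Proof.
move=> xR; split; rewrite ?setDv ?sub0set //.
- by split=> [|t t' s]; rewrite ?sub0set // inE.
- by apply: (@rank_acyclic _ _ (fun=> 0)) => a b; rewrite /arc !inE andbF.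
- by split=> [y|t s y]; rewrite inE // => /eqP->.
Qed.

Lemma functional_downS U U' : U' \subset U -> functional_down U -> functional_down U'.
Proof. by move=> /subsetP U'U fU t t' s /U'U tU /U'U; exact: fU tU. Qed.

(** A directed cycle in the new [C] uses surviving up-edges only, so it lies in the old [C] together
    with the facet-edges of [x.2]. If it passes [x.2], it goes on through a leading up-edge of [x];
    that edge was enqueued, and the test passed then excludes the cycle. Otherwise the cycle lies in
    the old [C]. *)
Lemma search_step U0 U C x Q st : functional_down U0 -> search_inv U0 (U, C, x :: Q) ->
  foreach_in (inspect R) (leading R U x) (U, C :|: facet_edges R x.2, Q) st ->
  search_inv U0 st /\ (C :|: facet_edges R x.2 \subset st.1.2) /\ {subset Q <= st.2}.
Proof.
move=> fU0 [UU0 U0R [CR sC] acyc [QR lead]] [l lP ins].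
have fU := functional_downS UU0 fU0.
have memlE y : (y \in l) = (y \in leading R U x) by rewrite (perm_mem lP) mem_enum.
have ul : uniq l by rewrite (perm_uniq lP) enum_uniq.
have xR : x \in R by apply: QR; rewrite mem_head.
have lU : {subset l <= U} by move=> y; rewrite memlE !inE => /andP[/andP[]].
have lR : {subset l <= R} by move=> y; rewrite memlE !inE => /andP[/andP[]].
have C1R : C :|: facet_edges R x.2 \subset R.
  by rewrite subUset CR; apply/subsetP => e; rewrite inE => /andP[].
have sC1 : saturated R (C :|: facet_edges R x.2) by exact: saturatedU.
case: st ins => [[U' C'] Q'] /inspect_spec -/(_ fU C1R sC1 ul lU).
set C1 := C :|: _ in C1R sC1 *.
move=> [U'U [Ul QQ Ql] [CC C'R sC' C'U'] L] /=.
have R_d := levelledS RE; have C'_d : levelled d C' by apply/levelledS/(subset_trans C'R).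
have fU' := functional_downS U'U fU.
have C1C t s : (t, s) \in C1 -> s != x.2 -> (t, s) \in C.
  by rewrite !inE => /orP[//|/andP[_ ->]].
split; last by [].
split.
- exact: subset_trans U'U UU0.
- apply/subsetP => y; rewrite inE => /andP[yU' yU0]; case: (boolP (y \in U)) => yU.
    by apply: lR; apply: Ul.
  by apply: (subsetP U0R); rewrite inE yU.
- by [].
- move=> [c c0 cyc].
  have C'_C1 t s : s \in c -> (t, s) \in C' -> (t, s) \in U' ->
      forall t', (t', s) \in C' -> (t', s) \in C1.
    move=> sc tC' tU' t' t'C'; apply: (sC1 t t'); first exact: C'U'.
    exact: (subsetP C'R).
  case: (boolP (x.2 \in c)) => xc.
    have dx : dim x.2 = d by have [] := R_d x.1 x.2; rewrite -?surjective_pairing.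
    have [p pc [pC' pU']] := cycle_prev_up C'_d cyc xc dx.
    have [t tc [tC' tU']] := cycle_next_down C'_d cyc xc dx.
    have [dt _] := C'_d _ _ tC'.
    have [s sc [tsC tsU]] := cycle_next_up C'_d cyc tc dt.
    have sl : (t, s) \in l.
      rewrite memlE !inE /= (subsetP C'R _ tsC) (subsetP U'U _ tsU) (subsetP C'R _ tC') /= andbT.
      by apply: contra tU' => tU; rewrite -(fU _ _ _ (subsetP U'U _ pU') tU).
    case: (L _ sl) => [|[_ [A [B [CA U'B BU]]]]]; first by rewrite tsU.
    case; exists c => //; apply: (cycle_transfer C'_d _ U'B cyc).
      exact: functional_downS BU fU.
    by move=> a b bc aC' aU' a' a'C'; rewrite inE (subsetP CA) // (C'_C1 a b).
  case: acyc; exists c => //; apply: (cycle_transfer C'_d fU U'U cyc) => a b bc aC' aU' a' a'C'.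
  by apply: C1C; [exact: C'_C1 aC' aU' _ a'C'|apply: contraNneq xc => <-].
- split.
    by move=> y /Ql[yQ|/lR//]; apply: QR; rewrite inE yQ orbT.
  move=> t s y tC' tU'; have tC1 := C'U' _ _ tC' tU'; rewrite !inE /= => /andP[/andP[yR yU'] /andP[yU'n ysR]].
  have yl : y \in leading R U (t, s).
    rewrite !inE /= yR ysR (subsetP U'U _ yU') /= andbT.
    by apply: contra yU'n => ysU; rewrite -(fU _ _ _ (subsetP U'U _ tU') ysU).
  case: (eqVneq s x.2) => sx.
    have : y \in l by rewrite memlE; move: yl; rewrite !inE sx.
    by move/L => [|[]]; [rewrite yU'|right].
  case: (lead _ _ _ (C1C _ _ tC1 sx) (subsetP U'U _ tU') yl) => [yC|].
    by left; apply: (subsetP CC); rewrite inE yC.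
  rewrite inE => /predU1P[->|/QQ]; [left|by right].
  by apply: (subsetP CC); rewrite !inE xR eqxx orbT.
Qed.

Lemma search_spec U0 st U' C' : search R st U' C' -> functional_down U0 ->
  search_inv U0 st -> [/\ search_inv U0 (U', C', [::]), st.1.2 \subset C' &
    {subset st.2 <= C'}].
Proof.
move=> s fU0; elim: s => {st U' C'} [U C|U C x Q st U' C' ins _ IH] inv; first by split.
have [inv' [CC QQ]] := search_step fU0 inv ins.
have [inv'' CC' QC'] := IH inv'.
have xR : x \in R by case: inv => _ _ _ _ [+ _]; apply; rewrite mem_head.
have C1C' := subset_trans CC CC'.
split=> //=; first by apply: subset_trans C1C'; exact: subsetUl.
move=> y; rewrite inE => /predU1P[->|/QQ]; last exact: QC'.
by apply: (subsetP C1C'); rewrite !inE xR eqxx orbT.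
Qed.

Lemma inspect_progress l st st' : foreach (inspect R) l st st' ->
  let: (U, C, Q) := st in let: (U', C', Q') := st' in uniq l -> {subset l <= U} ->
  (#|U'| < #|U|) \/ [/\ U' = U, C' = C & Q' = Q ++ l].
Proof.
have mono m u u' : foreach (inspect R) m u u' -> #|u'.1.1| <= #|u.1.1|.
  elim=> {m u u'} // y m u u1 u2 [U C Q _|U C Q _] _ /= IH //.
  by apply: leq_trans IH (subset_leq_card _); exact: subD1set.
elim=> {l st st'} [[[U C] Q]|y l [[U C] Q] [[U1 C1] Q1] [[U2 C2] Q2] ins fe IH].
  by rewrite cats0; right.
move=> /andP[yl ul] lU; have yU : y \in U by apply: lU; rewrite mem_head.
have := mono _ _ _ fe; case: (inspectP ins) fe IH => -[_ [-> -> ->]] _ IH /= m.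
  by left; apply: leq_ltn_trans m _; rewrite [ltnRHS](cardsD1 y U) yU.
have [|lt|[-> -> ->]] := IH ul; first by move=> z zl; apply: lU; rewrite inE zl orbT.
  by left.
by right; rewrite cat_rcons.
Qed.

(* Termination: a step either reverses an edge, or enlarges [C], or replaces [x]
   by at most [#|R|] edges that are lower in the acyclic orientation of [C] or
   lie outside [C]; the weight of an edge of height [h] in [C] is [B ^ h.+1]. *)
Lemma search_exists U0 st : functional_down U0 -> search_inv U0 st ->
  exists U' C', search R st U' C'.
Proof.
move=> fU0; case: st => [[U C] Q].
have [n] := ubnP #|U|; elim: n U C Q => // n IHU U C Q /ltnSE cU.
have [m] := ubnP #|R :\: C|; elim: m U C Q cU => // m IHC U C Q cU /ltnSE cC inv.
have [_ _ _ /acyclic_rank[f f_lt] _] := inv.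
pose B := #|R|.+1.
pose wt y := if facet_edges R y.2 \subset C then B ^ (f y.2).+1 else 1.
have [k] := ubnP (\sum_(y <- Q) wt y); elim: k Q inv => // k IHQ [|x Q] inv /ltnSE cQ.
  by exists U, C; constructor.
have tot y (s : search_state T) : exists s', inspect R y s s'.
  case: s => [[U1 C1] Q1].
  case: (pselect (has_directed_cycle (arc (C1 :|: facet_edges R y.2) U1))) => cyc.
    by eexists; apply: inspect_reverse.
  by eexists; apply: inspect_enqueue.
pose l := enum (leading R U x).
have [st' fe] := foreach_exists l (U, C :|: facet_edges R x.2, Q) tot.
have ins : foreach_in (inspect R) (leading R U x) (U, C :|: facet_edges R x.2, Q) st'.
  by exists l.
have [inv' [CC' _]] := search_step fU0 inv ins.
suff [U' [C' s]] : exists U' C', search R st' U' C'.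
  by exists U', C'; apply: search_dequeue ins s.
move: fe inv' CC' {ins}; case: st' => [[U1 C1] Q1] /inspect_progress /=.
rewrite enum_uniq; case=> // [y||[-> -> ->]].
- by rewrite mem_enum !inE => /andP[/andP[]].
- by move=> lt inv' _; apply: IHU inv'; apply: leq_trans lt cU.
move=> inv' _; case: (boolP (facet_edges R x.2 \subset C)) => xC; last first.
  apply: IHC inv' => //; apply: leq_trans cC; apply: proper_card.
  apply/properP; split; first by apply: setDS; exact: subsetUl.
  have /subsetPn[e] := xC; rewrite inE => /andP[eR ex] eC.
  by exists e; rewrite !inE ?eC ?eR //= ex orbT.
move: inv'; rewrite (setUidPl xC) => inv'; apply: IHQ inv' _.
apply: leq_trans cQ; rewrite big_cons big_cat /= addnC ltn_add2r.
have ge1 j : 0 < B ^ j by rewrite expn_gt0.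
rewrite {2}/wt xC.
apply: (@leq_ltn_trans (\sum_(y <- l) B ^ f x.2)); last first.
  rewrite big_const_seq count_predT iter_addn addn0 mulnC expnS ltn_pmul2r // ltnS.
  rewrite -cardE; apply: subset_leq_card; apply/subsetP => y.
  by rewrite !inE => /andP[/andP[]].
rewrite big_seq [leqRHS]big_seq; apply: leq_sum => y.
rewrite mem_enum !inE => /andP[/andP[yR yU] /andP[yxU yxR]].
rewrite /wt; case: ifP => // yC; apply: leq_pexp2l => //.
apply: (@ltn_trans (f y.1)); apply: f_lt.
  by apply: arc_up; rewrite -surjective_pairing ?(subsetP yC) // !inE yR eqxx.
by apply: arc_down => //; apply: (subsetP xC); rewrite !inE yxR eqxx.
Qed.

End Search.

Variable M0 : {set edge T}.
Hypothesis fM0 : functional_down M0.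
Hypothesis uM0 : functional_up M0.

(* The last clause says that a path cannot leave the output [E :\: R]. *)
Definition loop_inv (R U : {set edge T}) : Prop :=
  [/\ R \subset E /\ saturated E R, U \subset M0,
      ~ has_directed_cycle (arc (E :\: R) U) &
      forall t s t' s', (t, s) \in E :\: R -> (t, s) \in U -> (t', s) \in E ->
        (t', s) \notin U -> (t', s') \in E -> (t', s') \in U -> (t', s') \in E :\: R].

(** By the last clause of [loop_inv], a directed cycle that meets an end of an up-edge of the old
    output (the predicate [P]) meets nothing else and lies in that output. Any other cycle lies in
    [C], which the search keeps acyclic. *)
Lemma loop_step R U x U1 C : loop_inv R U -> x \in R :&: U ->
  search R (U, set0, [:: x]) U1 C -> loop_inv (R :\: C) U1 /\ x \in C.
Proof.
move=> [[RE sR] UM acyc closed]; rewrite inE => /andP[xR xU] srch.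
have fU := functional_downS UM fM0.
have inv0 := search_inv0 U xR.
have [[U1U UR [CR sC] acyc1 [_ lead]] _ xC] := search_spec RE srch fU inv0.
split; last by apply: xC; rewrite mem_head.
have ER t s : (t, s) \in E :\: (R :\: C) = ((t, s) \in E :\: R) || ((t, s) \in C).
  rewrite !inE negb_and negbK; case: (boolP (_ \in C)) => //= tC; last by rewrite orbF.
  by rewrite (subsetP RE) ?orbT // (subsetP CR).
have sER t t' s : (t, s) \in E :\: R -> (t', s) \in E -> (t', s) \in E :\: R.
  rewrite !inE => /andP[tR tE] t'E; rewrite t'E andbT; apply: contra tR => t'R.
  exact: sR t'R tE.
have fU1 := functional_downS U1U fU.
have Uup t s s' : (t, s) \in U1 -> (t, s') \in U1 -> s = s'.
  by move=> tU tU'; apply: (@uM0 t); apply: (subsetP UM); apply: (subsetP U1U).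
have notU t t' s : (t, s) \in U1 -> (t', s) \notin U1 -> (t', s) \notin U.
  by move=> tU1; apply: contra => t'U; rewrite -(fU _ _ _ (subsetP U1U _ tU1) t'U).
split.
- split; first exact: subset_trans (subsetDl _ _) RE.
  move=> t t' s; rewrite !inE => /andP[tC tR] t'E.
  have t'R := sR _ _ _ tR t'E; rewrite t'R andbT.
  by apply: contra tC => t'C; exact: sC t'C tR.
- exact: subset_trans U1U UM.
- move=> [c c0 cyc].
  have ER_d : levelled d (E :\: (R :\: C)) by apply/levelledS/subsetDl.
  pose P (z : simplex T) := [exists w, ((w, z) \in E :\: R) && ((w, z) \in U1)] ||
              [exists w, ((z, w) \in E :\: R) && ((z, w) \in U1)].
  have Pup t s : (t, s) \in E :\: R -> (t, s) \in U1 -> P s.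
    by move=> tE tU; apply/orP; left; apply/existsP; exists t; rewrite tE tU.
  have cl (y z : simplex T) : y \in c -> z \in c -> arc (E :\: (R :\: C)) U1 y z -> P y -> P z.
    move=> yc zc /arcP[[yzE yzU]|[zyE zyU]] /orP[] /existsP[w /andP[wE wU]].
    + have [_ d1] : (dim w).+1 = d /\ dim y = d by apply: Ed; move: wE; rewrite inE => /andP[].
      by have [d2 _] := ER_d _ _ yzE; exact: succ_absurd d1 d2.
    + by rewrite -(Uup _ _ _ wU yzU); apply: (Pup y).
    + have [dz _] := ER_d _ _ zyE.
      have [u uc [zuE zuU]] := cycle_next_up ER_d cyc zc dz.
      have zuER : (z, u) \in E :\: R.
        apply: (closed w y z u) => //; first exact: (subsetP U1U).
        * by move: zyE; rewrite inE => /andP[].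
        * exact: notU wU zyU.
        * by move: zuE; rewrite inE => /andP[].
        * exact: (subsetP U1U).
      by apply/orP; right; apply/existsP; exists u; rewrite zuER zuU.
    + have [d1 _] : (dim y).+1 = d /\ dim w = d by apply: Ed; move: wE; rewrite inE => /andP[].
      by have [_ d2] := ER_d _ _ zyE; exact: succ_absurd d2 d1.
  case: (boolP (has P c)) => [/hasP[z zc Pz]|/hasPn noP].
    have /allP allc := cycle_all cyc cl zc Pz.
    case: acyc; exists c => //; apply: (cycle_transfer ER_d fU U1U cyc) => t s sc tE tU t' t'E.
    case/orP: (allc s sc) => /existsP[w /andP[wE wU]].
      by apply: (sER w) => //; move: t'E; rewrite inE => /andP[].
    have [_ d1] := ER_d _ _ tE.
    have [d2 _] : (dim s).+1 = d /\ dim w = d by apply: Ed; move: wE; rewrite inE => /andP[].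
    exact: succ_absurd d1 d2.
  case: acyc1; exists c => //; apply: (cycle_transfer ER_d fU1 (subxx _) cyc) => t s sc tE tU t' t'E.
  have := noP _ sc; move: tE; rewrite ER => /orP[tER|tC].
    by rewrite (Pup t).
  by move=> _; apply: (sC t) => //; apply: (sR t); [exact: (subsetP CR)|move: t'E; rewrite inE => /andP[]].
- move=> t s t' s' + tU t'E t'U t's'E t's'U.
  rewrite !ER => /orP[tER|tC].
    by rewrite (closed t s t' s' tER (subsetP U1U _ tU) t'E (notU _ _ _ tU t'U) t's'E (subsetP U1U _ t's'U)).
  have t'R : (t', s) \in R by apply: (sR t) => //; exact: (subsetP CR).
  case: (boolP ((t', s') \in R)) => t's'R; last by rewrite inE t's'R t's'E.
  have [|//|] := lead t s (t', s') tC tU; last by rewrite inE.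
    by rewrite !inE /= t's'R t's'U t'R t'U.
  by move=> ->; rewrite orbT.
Qed.

(** The edges left at the end are all down-edges. A directed cycle enters each larger simplex by an
    up-edge, and facet-edges are moved together, so no cycle uses the edges that are left. *)
Lemma frontier_loop_spec R U U2 : frontier_loop R U U2 -> loop_inv R U ->
  U2 \subset M0 /\ ~ has_directed_cycle (arc E U2).
Proof.
elim=> {R U U2} [R U RU0 [[RE sR] UM acyc _]|R U x U1 C U2 xRU s _ IH inv]; last first.
  by apply: IH; have [] := loop_step inv xRU s.
split=> // -[c c0 cyc]; case: acyc; exists c => //.
have RU t s : (t, s) \in R -> (t, s) \in U -> False.
  by move=> tR tU; have := in_set0 (t, s); rewrite -RU0 inE tR tU.
apply: (cycle_transfer Ed (functional_downS UM fM0) (subxx _) cyc) => t s sc tE tU t' t'E.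
rewrite inE t'E andbT; apply/negP => t'R; apply: (RU t s) => //.
exact: sR t'R tE.
Qed.

Lemma frontier_loop_exists R U : loop_inv R U -> exists U', frontier_loop R U U'.
Proof.
have [n] := ubnP #|R|; elim: n R U => // n IH R U /ltnSE cR inv.
case: (set_0Vmem (R :&: U)) => [RU0|[x xRU]]; first by exists U; constructor.
have [[RE _] UM _ _] := inv; move: (xRU); rewrite inE => /andP[xR xU].
have fU := functional_downS UM fM0.
have [U1 [C s]] := search_exists RE fU (search_inv0 U xR).
have [inv' xC] := loop_step inv xRU s.
have [|U' fl] := IH (R :\: C) U1 _ inv'; last by exists U'; apply: frontier_next s fl.
apply: leq_trans cR; apply: proper_card; apply/properP; split; first exact: subsetDl.
by exists x; rewrite // inE xC.
Qed.

Lemma loop_inv0 : loop_inv E M0.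
Proof.
split=> //; first by split=> // t t' s _.
- by apply: (@rank_acyclic _ _ (fun=> 0)) => a b; rewrite setDv /arc !inE andbF.
by move=> t s t' s'; rewrite setDv inE.
Qed.

End Frontier.

(** * Matchings of an interface and step (2) of [intermediate_apx] *)

Section Matchings.
Variable T : finType.
Implicit Types (E M : {set edge T}) (H W K : {set simplex T}).

Lemma matchingP E M :
  reflect (M \subset E /\ forall e f x, e \in M -> f \in M ->
             x \in [set e.1; e.2] -> x \in [set f.1; f.2] -> e = f)
          (matching E M).
Proof.
apply: (iffP andP) => -[ME mP]; split=> //.
  move=> e f x eM fM xe xf; apply/eqP/contraT => ef.
  have := implyP (forall_inP (forall_inP mP e eM) f fM) ef.
  by move=> /disjointFr/(_ xe); rewrite xf.
apply/forall_inP => e eM; apply/forall_inP => f fM; apply/implyP => /eqP ef.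
by rewrite disjoint_subset; apply/subsetP => x xe; apply/negP => /(mP e f x eM fM xe).
Qed.

Lemma regularP M x : reflect (exists2 e, e \in M & x \in [set e.1; e.2]) (x \in regular M).
Proof. exact: bigcupP. Qed.

Lemma regular_lower M t s : (t, s) \in M -> t \in regular M.
Proof. by move=> tsM; apply/regularP; exists (t, s); rewrite // !inE eqxx. Qed.

Lemma regular_upper M t s : (t, s) \in M -> s \in regular M.
Proof. by move=> tsM; apply/regularP; exists (t, s); rewrite // !inE eqxx orbT. Qed.

Lemma matching_sub E M : matching E M -> M \subset E.
Proof. by move=> /matchingP[]. Qed.

Lemma matching_functional_down E M : matching E M -> functional_down M.
Proof.
move=> /matchingP[_ mM] t t' s tM t'M.
by have := mM (t, s) (t', s) s tM t'M; rewrite /= !inE !eqxx !orbT => /(_ isT isT)[].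
Qed.

Lemma matching_functional_up E M : matching E M -> functional_up M.
Proof.
move=> /matchingP[_ mM] t s s' tM t'M.
by have := mM (t, s) (t, s') t tM t'M; rewrite /= !inE !eqxx => /(_ isT isT)[].
Qed.

Lemma levelled_matching d E M : levelled d E -> M \subset E -> functional_down M ->
  functional_up M -> matching E M.
Proof.
move=> Ed ME fd fu; apply/matchingP; split=> // -[t s] [t' s'] x tM t'M /=.
have [dt ds] := Ed _ _ (subsetP ME _ tM); have [dt' ds'] := Ed _ _ (subsetP ME _ t'M).
rewrite !inE => /orP[] /eqP-> /orP[] /eqP xx.
- by move: t'M; rewrite -xx => /(fu _ _ _ tM)->.
- by rewrite xx in dt; exact: succ_absurd ds' dt.
- by rewrite xx in ds; exact: succ_absurd ds dt'.
- by move: t'M; rewrite -xx => /(fd _ _ _ tM)->.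
Qed.

Lemma matchingS E M M' : matching E M -> M' \subset M -> matching E M'.
Proof.
move=> /matchingP[ME mM] M'M; apply/matchingP; split; first exact: subset_trans ME.
by move=> e f x /(subsetP M'M) eM /(subsetP M'M) fM; exact: mM.
Qed.

Lemma hasseP H t s : (t, s) \in hasse H -> [/\ t \in H, s \in H & facet t s].
Proof. by rewrite inE => /and3P[]. Qed.

Lemma facet_dim (t s : simplex T) : facet t s -> dim s = (dim t).+1.
Proof. by move=> /andP[_ /eqP]. Qed.

Lemma interface_levelled H d : levelled d (hasse (interface H d)).
Proof.
move=> t s /hasseP[]; rewrite !inE => /andP[_ dt] /andP[_ ds] /facet_dim dts.
by move: dt ds; rewrite dts => /orP[] /eqP dt /orP[] /eqP ds; split; lia.
Qed.

Lemma maximum_matching_exists E : exists M, maximum_matching E M.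
Proof.
have m0 : matching E set0.
  by apply/matchingP; split; [exact: sub0set|move=> e f x; rewrite inE].
by case: (arg_maxnP (fun M : {set edge T} => #|M|) m0) => M mM maxM; exists M.
Qed.

Lemma frontier_spec d E M : levelled d E -> frontier E M ->
  matching E M /\ ~ has_directed_cycle (arc E M).
Proof.
move=> Ed [M0 [mM0 _] fl].
have [] := frontier_loop_spec Ed (matching_functional_down mM0)
  (matching_functional_up mM0) fl (loop_inv0 _ _).
by move=> MM0 acyc; split=> //; exact: matchingS MM0.
Qed.

Lemma frontier_exists d E : levelled d E -> exists M, frontier E M.
Proof.
move=> Ed; have [M0 maxM0] := maximum_matching_exists E; have [mM0 _] := maxM0.
have [M fl] := frontier_loop_exists Ed (matching_functional_down mM0)
  (matching_functional_up mM0) (loop_inv0 _ _).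
by exists M, M0.
Qed.

Lemma regularS M M' : M \subset M' -> regular M \subset regular M'.
Proof.
move=> /subsetP MM'; apply/subsetP => x /regularP[e eM xe].
by apply/regularP; exists e; [exact: MM'|].
Qed.

Section Extend.
Variables (W : {set simplex T}) (d : nat).
Hypothesis Wd : levelled d (hasse W).

Definition acyclic_matching M :=
  matching (hasse W) M /\ ~ has_directed_cycle (arc (hasse W) M).

(* If [t] and its cofacets are unmatched, no directed cycle passes through the
   new edge: [t] could only be entered from a cofacet, which has no up-edge. *)
Lemma extend_match_spec M t s : t \in W -> extendable W M t ->
  s \in cofacets W t -> acyclic_matching M -> acyclic_matching ((t, s) |: M).
Proof.
move=> tW /andP[tM dis] sW [mM acyc].
have sM : s \notin regular M by rewrite (disjointFr dis sW).
have tsH : (t, s) \in hasse W by move: sW; rewrite !inE /= tW.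
have fd : functional_down ((t, s) |: M).
  move=> a a' b; rewrite !inE => /predU1P[[-> ->]|aM] /predU1P[[-> //]|a'M].
  - by rewrite (regular_upper a'M) in sM.
  - by move=> bs; move: aM; rewrite bs => /regular_upper; rewrite (negbTE sM).
  - exact: matching_functional_down mM _ _ _ aM a'M.
have fu : functional_up ((t, s) |: M).
  move=> a b b'; rewrite !inE => /predU1P[[-> ->]|aM] /predU1P[[]|a'M] //.
  - by rewrite (regular_lower a'M) in tM.
  - by move=> at_; move: aM; rewrite at_ => /regular_lower; rewrite (negbTE tM).
  - exact: matching_functional_up mM _ _ _ aM a'M.
split.
  apply: (levelled_matching Wd) => //.
  by rewrite subUset sub1set tsH matching_sub.
move=> [c c0 cyc]; case: acyc; exists c => //.
have tc : t \notin c.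
  apply/negP => tc; case/arcP: (prev_cycle cyc tc) => -[ptW ptM].
    have [_ dt] := Wd ptW; have [dt' _] := Wd tsH; exact: succ_absurd dt dt'.
  set p := prev c t in ptW ptM.
  have [_ dp] := Wd ptW; have pc : p \in c by rewrite mem_prev.
  have [q _ [_ qM]] := cycle_prev_up Wd cyc pc dp.
  move: qM; rewrite !inE => /predU1P[[_ ps]|qM].
    by move: ptM; rewrite ps !inE eqxx.
  have pcof : p \in cofacets W t.
    by have [_ pW tp] := hasseP ptW; rewrite inE pW.
  by move: (disjointFr dis pcof); rewrite (regular_upper qM).
have cP : {in c &, subrel (arc (hasse W) ((t, s) |: M)) (arc (hasse W) M)}.
  move=> x y xc yc /arcP[[xyW xyM]|[xyW xyM]].
    apply: arc_up => //; move: xyM; rewrite !inE => /predU1P[[xt _]|//].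
    by rewrite -xt xc in tc.
  by apply: arc_down => //; apply: contra xyM; rewrite !inE => ->; rewrite orbT.
by apply: (sub_in_cycle cP) cyc; apply/allP.
Qed.

(** The matching only grows, so the reason for skipping a simplex, namely that it or a cofacet is
    matched or that it has no cofacet, still holds at the end. *)
Lemma extend_spec l M M' : foreach (extend W) l M M' -> {subset l <= W} ->
  acyclic_matching M ->
  [/\ acyclic_matching M', M \subset M' &
     forall t, t \in l -> t \in regular M' \/
       (cofacets W t = set0 \/ ~~ [disjoint cofacets W t & regular M'])].
Proof.
elim=> {l M M'} [M|t l M M1 M2 et _ IH] lW aM; first by split.
have tW : t \in W by apply: lW; rewrite mem_head.
have lW' : {subset l <= W} by move=> x xl; apply: lW; rewrite inE xl orbT.
case: et IH => {M M1} [M s ext sW|M skip] IH in aM *.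
  have [aM2 MM2 H] := IH lW' (extend_match_spec tW ext sW aM).
  split=> //; first by apply: subset_trans MM2; exact: subsetUr.
  move=> x; rewrite inE => /predU1P[->|/H//]; left.
  by apply: (@regular_lower _ t s); apply: (subsetP MM2); rewrite !inE eqxx.
have [aM2 MM2 H] := IH lW' aM; split=> //.
move=> x; rewrite inE => /predU1P[->|/H//].
have RR := subsetP (regularS MM2).
case: skip => [|cof0]; last by right; left.
rewrite negb_and negbK => /orP[tM|dis]; first by left; exact: RR.
right; right; apply: contra dis => dis; apply: disjointWr dis; exact/subsetP.
Qed.

Lemma extend_exists l M : exists M', foreach (extend W) l M M'.
Proof.
apply: foreach_exists => t {}M; case: (boolP (extendable W M t)) => ext; last first.
  by exists M; apply: extend_skip; left.
case: (set_0Vmem (cofacets W t)) => [c0|[s sW]]; first by exists M; apply: extend_skip; right.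
by exists ((t, s) |: M); apply: extend_match.
Qed.

Lemma intermediate_apx_spec M : intermediate_apx W d M ->
  acyclic_matching M /\
  forall t, t \in lower W d -> t \in regular M \/
       (cofacets W t = set0 \/ ~~ [disjoint cofacets W t & regular M]).
Proof.
move=> [M1 fM1 [l lP ex]]; have [|aM _ H] := extend_spec ex _ (frontier_spec Wd fM1).
  by move=> t; rewrite (perm_mem lP) mem_enum inE => /andP[].
by split=> // t tW; apply: H; rewrite (perm_mem lP) mem_enum.
Qed.

Lemma intermediate_apx_exists : exists M, intermediate_apx W d M.
Proof.
have [M1 fM1] := frontier_exists Wd; have [M ex] := extend_exists (enum (lower W d)) M1.
by exists M, M1 => //; exists (enum (lower W d)).
Qed.

End Extend.
End Matchings.

(** * The algorithm on a pseudomanifold *)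

Section Pseudomanifold.
Variables (T : finType) (K : {set simplex T}) (D : nat).
Implicit Types (s t : simplex T) (H W : {set simplex T}) (M N : {set edge T}).

Hypothesis cK : simplicial_complex K.
Hypothesis dimK : forall s, s \in K -> dim s <= D.
Hypothesis two_cofacets : forall s, s \in K -> dim s < D ->
  exists a b, [/\ a != b, a \notin s, b \notin s, a |: s \in K & b |: s \in K].
Hypothesis no_three_cofacets : forall s a b c, s \in K -> #|s| = D ->
  a \notin s -> b \notin s -> c \notin s -> a != b -> a != c -> b != c ->
  a |: s \in K -> b |: s \in K -> c |: s \in K -> False.

Lemma card_simplex s : s \in K -> #|s| = (dim s).+1.
Proof.
move=> sK; rewrite prednK // card_gt0; apply: contraTneq sK => ->.
by case: cK => /negbTE->.
Qed.

Lemma face_in s t : s \in K -> t \subset s -> t != set0 -> t \in K.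
Proof. by case: cK => _; apply. Qed.

Lemma facet_setU1 s a : s \in K -> a \notin s -> facet s (a |: s).
Proof.
move=> sK as_; rewrite /facet subsetUr /= [X in X == _]/dim cardsU1 as_ add1n /=.
by rewrite card_simplex.
Qed.

Lemma facetP s t : s \in K -> t \in K -> facet s t -> exists2 a, a \notin s & t = a |: s.
Proof.
move=> sK tK /andP[st /eqP dt].
have ct : #|t| = #|s|.+1 by rewrite !card_simplex // dt.
have [a] : exists a, a \in t :\: s.
  by apply/set0Pn; rewrite -card_gt0 cardsD (setIidPr st); lia.
rewrite inE => /andP[as_ at_]; exists a => //.
apply/eqP; rewrite eq_sym eqEcard cardsU1 as_ ct leqnn andbT subUset sub1set at_.
exact: st.
Qed.

Lemma facet_sub s t : facet s t -> s \subset t.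
Proof. by case/andP. Qed.

Lemma cofacetsP s t : reflect (t \in K /\ facet s t) (t \in cofacets K s).
Proof. by rewrite inE; exact: andP. Qed.

Lemma cofacets2 s : s \in K -> (dim s).+1 = D ->
  exists A B, A != B /\ cofacets K s = [set A; B].
Proof.
move=> sK ds; have [|a [b [ab as_ bs aK bK]]] := two_cofacets sK; first by rewrite -ds.
exists (a |: s), (b |: s).
have abs : a |: s != b |: s.
  by apply: contra as_ => /eqP/setP/(_ a); rewrite !inE eqxx (negbTE ab) /= => <-.
split=> //; apply/eqP; rewrite eq_sym eqEsubset; apply/andP; split.
  by apply/subsetP => u; rewrite !inE => /orP[]/eqP->; rewrite ?aK ?bK /=; exact: facet_setU1.
apply/subsetP => u /cofacetsP[uK su]; have [c cs uc] := facetP sK uK su; subst u.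
case: (eqVneq a c) => [->|ac]; first by rewrite !inE eqxx.
case: (eqVneq b c) => [->|bc]; first by rewrite !inE eqxx orbT.
by case: (@no_three_cofacets s a b c) => //; rewrite card_simplex.
Qed.

Lemma cofacets_two_ends e u v w : e \in K -> (dim e).+1 = D -> u \in cofacets K e ->
  v \in cofacets K e -> w \in cofacets K e -> u != v -> w = u \/ w = v.
Proof.
move=> eK de; have [A [B [AB ->]]] := cofacets2 eK de; rewrite !inE.
move=> /orP[]/eqP-> /orP[]/eqP-> /orP[]/eqP->; rewrite ?eqxx //; auto.
Qed.

Lemma other_cofacet e u : e \in K -> (dim e).+1 = D -> u \in cofacets K e ->
  exists2 v, v \in cofacets K e & v != u.
Proof.
move=> eK de; have [A [B [AB ->]]] := cofacets2 eK de; rewrite !inE.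
by move=> /orP[]/eqP->; [exists B|exists A]; rewrite // ?inE ?eqxx ?orbT // eq_sym.
Qed.

(** * Uniting the matchings of successive interfaces *)

Section Step.
Variables (d : nat) (H : {set simplex T}) (M M1 : {set edge T}).

(* The state [(H, M)] reached after processing the interfaces 1, ..., k. *)
Definition stage (k : nat) (H : {set simplex T}) (M : {set edge T}) : Prop :=
  [/\ H \subset K /\ (forall s, s \in K -> k < dim s -> s \in H),
      forall s, s \in K -> dim s = k -> (s \in H) = (s \notin regular M),
      matching (hasse K) M /\ (forall t s, (t, s) \in M -> dim s <= k) &
      ~ has_directed_cycle (arc (hasse K) M)].

Hypothesis stageM : stage d H M.
Hypothesis aM1 : acyclic_matching (interface H d.+1) M1.

Let HK : H \subset K. Proof. by case: stageM => [[]]. Qed.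

Let M1_dim t s : (t, s) \in M1 -> dim t = d /\ dim s = d.+1.
Proof.
move=> tsM; have := @interface_levelled _ H d.+1 _ _ (subsetP (matching_sub aM1.1) _ tsM).
by case=> -[-> ->].
Qed.

Let M_dim t s : (t, s) \in M -> dim s = (dim t).+1 /\ dim s <= d.
Proof.
case: stageM => _ _ [mM dM] _ tsM; split; last exact: dM tsM.
by have [_ _ /facet_dim] := hasseP (subsetP (matching_sub mM) _ tsM).
Qed.

Let M1_in t s : (t, s) \in M1 -> [/\ t \in H, s \in H & facet t s].
Proof.
move=> tsM; have [] := hasseP (subsetP (matching_sub aM1.1) _ tsM).
by rewrite !inE => /andP[-> _] /andP[-> _].
Qed.

Lemma regular_dim x : x \in regular M -> dim x <= d.
Proof.
by move=> /regularP[[t s] /M_dim[ds sd]]; rewrite !inE => /orP[]/eqP-> /=; lia.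
Qed.

Lemma regular_stage x : x \in regular M -> dim x = d -> x \notin H.
Proof.
case: stageM => _ H3 [mM _] _ xM dx; rewrite H3 ?xM //.
case/regularP: xM => -[t s] /(subsetP (matching_sub mM))/hasseP[tK sK _].
by rewrite !inE => /orP[]/eqP->.
Qed.

Lemma regular_disjoint x : x \in regular M -> x \in regular M1 -> False.
Proof.
move=> xM; have dx := regular_dim xM.
move=> /regularP[[t s] tsM]; have [dt ds] := M1_dim tsM; have [tH sH _] := M1_in tsM.
rewrite !inE => /orP[]/eqP /= xE; subst x; last by lia.
by move: (regular_stage xM dt); rewrite tH.
Qed.

Lemma matchingU : matching (hasse K) (M :|: M1).
Proof.
case: stageM => _ _ [mM _] _; have /matchingP[MK mMP] := mM.
have /matchingP[M1K mM1P] := aM1.1.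
apply/matchingP; split.
  rewrite subUset MK; apply/subsetP => -[t s] /M1_in[tH sH ts].
  by rewrite inE /= !(subsetP HK) //.
have dis e f x : e \in M -> f \in M1 -> x \in [set e.1; e.2] -> x \in [set f.1; f.2] -> False.
  by move=> eM fM xe xf; apply: (@regular_disjoint x); apply/regularP; [exists e|exists f].
move=> e f x; rewrite !inE -!in_set2 => /orP[eM|eM] /orP[fM|fM] xe xf.
- exact: mMP eM fM xe xf.
- by case: (dis e f x).
- by case: (dis f e x).
- exact: mM1P eM fM xe xf.
Qed.

(* The height of a simplex is lowered by one if it is the larger simplex of a
   pair; it never increases along arcs, so a directed cycle stays within one
   interface. *)
Let upper x := [exists t, (t, x) \in M :|: M1].
Let height x := dim x - upper x.

Let height_noninc x y : arc (hasse K) (M :|: M1) x y -> height y <= height x.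
Proof.
move=> /arcP[[xyK xyM]|[yxK yxM]]; rewrite /height.
  have [_ _ /facet_dim dy] := hasseP xyK.
  have -> : upper y = true by apply/existsP; exists x.
  have -> : upper x = false.
    apply/negbTE/existsPn => t; apply/negP => txM.
    have /matchingP[MK /(_ (t, x) (x, y) x txM xyM)] := matchingU.
    rewrite /= !inE !eqxx orbT => /(_ isT isT)[tx _].
    by have [_ _ /facet_dim] := hasseP (subsetP MK _ txM); rewrite tx => /eqP; rewrite ltn_eqF.
  by rewrite dy subn0 subn1.
have [_ _ /facet_dim dx] := hasseP yxK; rewrite dx.
by case: (upper x); case: (upper y); rewrite ?subn0 ?subn1 //= ?leq_pred // leqW // leq_pred.
Qed.

Let arc_height x y : arc (hasse K) (M :|: M1) x y -> height x = height y ->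
  ((x, y) \in M :|: M1 /\ dim y = (height y).+1) \/
  [/\ (y, x) \in hasse K, (y, x) \notin M :|: M1, ~~ upper y, upper x & dim x = (height y).+1].
Proof.
move=> /arcP[[xyK xyM]|[yxK yxM]] hxy; [left|right].
  have [_ _ /facet_dim dy] := hasseP xyK; split=> //.
  by rewrite /height dy (_ : upper y = true) ?subn1 //; apply/existsP; exists x.
have [_ _ /facet_dim dx] := hasseP yxK; move: hxy; rewrite /height dx.
have uy0 : upper y -> 0 < dim y.
  move=> /existsP[t] /(subsetP (matching_sub matchingU))/hasseP[_ _ /facet_dim].
  by case: (dim y).
case: (boolP (upper y)) => /= uy; case: (boolP (upper x)) => ux /= hxy.
- by have := uy0 uy; lia.
- by lia.
- by split=> //; rewrite subn0.
- by lia.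
Qed.

Lemma acyclicU : ~ has_directed_cycle (arc (hasse K) (M :|: M1)).
Proof.
move=> [[//|x0 p] _ cyc]; set c := x0 :: p in cyc.
have x0c : x0 \in c by rewrite mem_head.
have hc x : x \in c -> height x = height x0.
  have le y z : y \in c -> z \in c -> height z <= height y.
    move=> yc zc; have mono u v : u \in c -> v \in c -> arc (hasse K) (M :|: M1) u v ->
        height u <= height y -> height v <= height y.
      by move=> _ _ /height_noninc; exact: leq_trans.
    have /allP := cycle_all (P := fun z => height z <= height y) cyc mono yc (leqnn _).
    exact.
  by move=> xc; apply/eqP; rewrite eqn_leq !le.
have step x y : x \in c -> y \in c -> arc (hasse K) (M :|: M1) x y ->
    ((x, y) \in M :|: M1 /\ dim y = (height x0).+1) \/
    [/\ (y, x) \in hasse K, (y, x) \notin M :|: M1, ~~ upper y, upper x & dim x = (height x0).+1].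
  by move=> xc yc /arc_height; rewrite !hc // => /(_ erefl).
have upper_dim x : upper x -> dim x <= d.+1.
  by move=> /existsP[t]; rewrite inE => /orP[/M_dim[_ /leqW//]|/M1_dim[_ ->//]].
case: stageM => [[_ H2] H3 [mM _] acyc].
(* All simplices of the cycle have dimension [height x0] or one more. Below [d] only pairs of [M]
   live there, above [d] no pairs at all, and at [d] the cycle lies in the extracted interface. *)
case: (ltngtP (height x0) d) => hd.
- apply: acyc; exists c => //.
  have sub : {in c &, subrel (arc (hasse K) (M :|: M1)) (arc (hasse K) M)}.
    move=> x y xc yc xy; case: (step x y xc yc xy) => [[xyM dy]|[yxK yxM _ _ _]].
      move: xyM; rewrite inE => /orP[xyM|/M1_dim[_ dy']]; last by exfalso; clear -dy dy' hd; lia.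
      by apply: arc_up => //; exact: (subsetP (matching_sub mM)).
    by apply: arc_down => //; apply: contra yxM; rewrite inE => ->.
  by apply: (sub_in_cycle sub) cyc; apply/allP.
- have nc : next c x0 \in c by rewrite mem_next.
  case: (step _ _ x0c nc (next_cycle cyc x0c)) => [[xyM dy]|[_ _ _ /upper_dim ux dx]]; last by clear -ux dx hd; lia.
  have : upper (next c x0) by apply/existsP; exists x0.
  by move=> /upper_dim uy; clear -uy dy hd; lia.
- case: aM1 => mM1; apply; exists c => //.
  have sub : {in c &, subrel (arc (hasse K) (M :|: M1)) (arc (hasse (interface H d.+1)) M1)}.
    move=> x y xc yc xy; case: (step x y xc yc xy) => [[xyM dy]|[yxK yxM uy ux dx]].
      move: xyM; rewrite inE => /orP[/M_dim[_ dy']|xyM]; first by exfalso; clear -dy dy' hd; lia.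
      by apply: arc_up => //; exact: (subsetP (matching_sub mM1)).
    have [yK xK yx] := hasseP yxK; have dy : dim y = d by move: (facet_dim yx); rewrite dx hd => -[].
    apply: arc_down; last by apply: contra yxM; rewrite inE => ->; rewrite orbT.
    rewrite !inE /= yx (H2 x) //; last by rewrite dx hd.
    rewrite dx dy hd !eqxx orbT /= andbT H3 //.
    (* A simplex of dimension [d] that is regular in [M] is the larger one of its pair, so one that
       is not [upper] has not been deleted. *)
    rewrite andbT; apply: contra uy => /regularP[[t s] tsM]; rewrite !inE => /orP[]/eqP /= yE; subst y.
      by have [ds sd] := M_dim tsM; clear -ds sd dy; lia.
    by apply/existsP; exists t; rewrite inE tsM.
  by apply: (sub_in_cycle sub) cyc; apply/allP.
Qed.

Lemma regularU x : (x \in regular (M :|: M1)) = (x \in regular M) || (x \in regular M1).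
Proof.
apply/regularP/orP => [[e]|[]].
- by rewrite inE => /orP[] eM xe; [left|right]; apply/regularP; exists e.
- by move=> /regularP[e eM xe]; exists e => //; rewrite inE eM.
- by move=> /regularP[e eM xe]; exists e => //; rewrite inE eM orbT.
Qed.

Lemma stageS : stage d.+1 (remaining H d.+1 M1) (M :|: M1).
Proof.
case: stageM => [[_ H2] H3 [mM dM] acyc].
have M1reg x : x \in regular M1 -> dim x <= d.+1.
  by move=> /regularP[[t s] /M1_dim[dt ds]]; rewrite !inE => /orP[]/eqP-> /=; rewrite ?dt ?ds.
have notlow x : d < dim x -> x \notin critical_lower (interface H d.+1) d.+1 M1.
  move=> dx; rewrite !inE; apply/negP => /and3P[_ _ /eqP[dx']].
  by rewrite dx' ltnn in dx.
split.
- split; first exact: subset_trans (subsetDl _ _) HK.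
  move=> s sK ds; rewrite inE H2 ?(ltnW ds) // andbT in_setU negb_or notlow ?(ltnW ds) //.
  by rewrite andbT; apply/negP => /M1reg; rewrite leqNgt ds.
- move=> s sK ds; rewrite inE H2 ?ds // andbT in_setU negb_or notlow ?ds // andbT.
  by rewrite regularU; case: (boolP (s \in regular M)) => // /regular_dim; rewrite ds ltnn.
- split; first exact: matchingU.
  by move=> t s; rewrite inE => /orP[/M_dim[_ /leqW//]|/M1_dim[_ ->//]].
- exact: acyclicU.
Qed.

End Step.
Lemma dim0_card s : s \in K -> dim s = 0 -> exists x, s = [set x].
Proof. by move=> sK ds; apply/cards1P; rewrite card_simplex // ds. Qed.

(** * The first interface: depth-first search in the 1-skeleton *)

Section First.
Variable N : {set edge T}.
Let W := interface K 1.
Let V := of_dim W 0.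
Hypothesis dfsN : dfs_optimal V (primal_joins W) N.

Definition flip N : {set edge T} := [set (p.2, p.1) | p in N].

Lemma in_flip t s : ((t, s) \in flip N) = ((s, t) \in N).
Proof.
by apply/imsetP/idP => [[[a b] abN [-> ->]]//|stN]; exists (s, t).
Qed.

Let VP v : v \in V -> v \in K /\ dim v = 0.
Proof. by rewrite !inE => /andP[/andP[vK _] /eqP]. Qed.

Let two_ends e u v w : e \in W -> u \in V -> v \in V -> w \in V ->
  facet u e -> facet v e -> facet w e -> u != v -> w = u \/ w = v.
Proof.
move=> eW /VP[uK /(dim0_card uK)[x ux]] /VP[vK /(dim0_card vK)[y vy]] /VP[wK /(dim0_card wK)[z wz]].
subst u v w => xe ye ze xy.
have eK : e \in K by move: eW; rewrite inE => /andP[].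
have ce : #|e| = 2 by rewrite card_simplex // (facet_dim xe) /dim cards1.
have xyE : [set x; y] = e.
  have xy' : x != y by apply: contra xy => /eqP->.
  by apply/eqP; rewrite eqEcard ce cards2 subUset (facet_sub xe) (facet_sub ye) xy'.
have := facet_sub ze; rewrite sub1set -xyE !inE => /orP[]/eqP->; auto.
Qed.

Let spec := @dfs_optimal_spec T V W (fun e v => facet v e) two_ends N dfsN.

Lemma first_acyclic_matching : acyclic_matching W (flip N).
Proof.
have [N1 N2 [rk N3] _] := spec.
have Wd := @interface_levelled _ K 1.
have NW : flip N \subset hasse W.
  apply/subsetP => -[t s]; rewrite in_flip => /N1[sW tV ts].
  by rewrite inE /= ts sW /= andbT; move: tV; rewrite inE => /andP[].
split.
  apply: (levelled_matching Wd) => // [t t' s|t s s']; rewrite !in_flip => H1 H2.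
    by case: (N2 _ _ _ _ H1 H2 (or_introl erefl)).
  by case: (N2 _ _ _ _ H1 H2 (or_intror erefl)).
pose B := \max_u rk u; have rkB u : rk u <= B by exact: leq_bigmax.
(* A vertex of rank [k] sits at [2k + 1] and the edge paired with it at [2k], still above the other
   end of that edge. Unpaired edges have no incoming arc and get the top value. *)
pose F x := if dim x == 0 then (rk x).*2.+1 else
  if [pick w | (x, w) \in N] is Some w then (rk w).*2 else B.*2.+2.
apply: (@rank_acyclic _ _ F) => x y /arcP[[xyW]|[yxW]]; rewrite in_flip => xyN.
  have [dx dy] := Wd _ _ xyW; rewrite /F dy; case: dx => ->; rewrite eqxx /=.
  case: pickP => [w ywN|/(_ x)]; last by rewrite xyN.
  by case: (N2 _ _ _ _ xyN ywN (or_introl erefl)) => ->.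
have [dy dx] := Wd _ _ yxW; rewrite /F dx; case: dy => dy; rewrite dy eqxx /=.
have [yW xW yx] := hasseP yxW.
case: pickP => [w xwN|_]; last by rewrite !ltnS leq_double.
have yV : y \in V by rewrite inE yW dy.
have yw : y != w by apply: contraNneq xyN => ->.
by have lt := N3 _ _ _ xwN yV yw yx; clear -lt; lia.
Qed.

Lemma first_roots : exists Rt : {set simplex T}, [/\ Rt \subset V,
  separated V W (fun e v => facet v e) Rt & #|V| = #|N| + #|Rt|].
Proof. by have [_ _ _] := spec. Qed.

End First.

(** * The last interface: depth-first search in the dual graph *)

Section Last.
Variables (H : {set simplex T}) (N : {set edge T}).
Hypothesis HK : H \subset K.
Let W := interface H D.
Let V := of_dim W D.
Hypothesis dfsN : dfs_optimal V (dual_joins W) N.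

Let VP v : v \in V -> v \in H /\ dim v = D.
Proof. by rewrite !inE => /andP[/andP[vK _] /eqP]. Qed.

Let two_ends e u v w : e \in W -> u \in V -> v \in V -> w \in V ->
  facet e u -> facet e v -> facet e w -> u != v -> w = u \/ w = v.
Proof.
move=> eW /VP[uH du] /VP[vH _] /VP[wH _] eu ev ew.
have eK : e \in K by apply: (subsetP HK); move: eW; rewrite inE => /andP[].
have cof z : z \in H -> facet e z -> z \in cofacets K e.
  by move=> zH ez; rewrite inE ez (subsetP HK).
by apply: (@cofacets_two_ends e); rewrite ?cof // -(facet_dim eu).
Qed.

Let spec := @dfs_optimal_spec T V W (fun e v => facet e v) two_ends N dfsN.

Lemma last_acyclic_matching : acyclic_matching W N.
Proof.
have [N1 N2 [rk N3] _] := spec.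
have Wd := @interface_levelled _ H D.
have NW : N \subset hasse W.
  apply/subsetP => -[t s] /N1[tW sV ts].
  by rewrite inE /= ts tW /= andbT; move: sV; rewrite inE => /andP[].
split.
  apply: (levelled_matching Wd) => // [t t' s|t s s'] H1 H2.
    by case: (N2 _ _ _ _ H1 H2 (or_intror erefl)).
  by case: (N2 _ _ _ _ H1 H2 (or_introl erefl)).
pose B := \max_u rk u; have rkB u : rk u <= B by exact: leq_bigmax.
(* The primal potential upside down: a wall lies just above the [D]-simplex paired with it and below
   its other cofacet, while unpaired walls are sinks. *)
pose F x := if dim x == D then (B - rk x).*2.+1 else
  if [pick w | (x, w) \in N] is Some w then (B - rk w).*2.+2 else 0.
have neD x : (dim x).+1 = D -> (dim x == D) = false by move=> <-; rewrite ltn_eqF.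
apply: (@rank_acyclic _ _ F) => x y /arcP[[xyW xyN]|[yxW yxN]].
  have [dx dy] := Wd _ _ xyW; rewrite /F dy eqxx neD //.
  case: pickP => [w xwN|/(_ y)]; last by rewrite xyN.
  by case: (N2 _ _ _ _ xyN xwN (or_introl erefl)) => ->.
have [dy dx] := Wd _ _ yxW; rewrite /F dx eqxx neD //.
have [yW xW yx] := hasseP yxW.
case: pickP => [w ywN|//].
have xV : x \in V by rewrite inE xW dx eqxx.
have xw : x != w by apply: contraNneq yxN => ->.
have lt := N3 _ _ _ ywN xV xw yx; have wB := rkB w.
clear -lt wB; lia.
Qed.

Lemma last_roots : exists Rt : {set simplex T}, [/\ Rt \subset V,
  separated V W (fun e v => facet e v) Rt & #|V| = #|N| + #|Rt|].
Proof. by have [_ _ _] := spec. Qed.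

End Last.

(** * Parity in links, and critical simplices of components *)

Lemma sum_nat_of_bool (I : finType) (A : {set I}) (P : pred I) :
  \sum_(i in A) P i = #|[set i in A | P i]|.
Proof.
rewrite -sum1_card [RHS](eq_bigl (fun i => (i \in A) && P i)) => [|i]; last by rewrite !inE.
by rewrite [RHS]big_mkcondr; apply: eq_bigr => i _; case: (P i).
Qed.

(* Handshake in the link of [t], where every vertex has degree two: if the two
   cofacets of [s] were not related, the class of one of them would have an odd
   total degree. *)
Lemma link_parity (R : rel (simplex T)) t s A B : reflexive R ->
  (forall u v, R A u -> R u v -> R A v) ->
  t \in K -> (dim t).+2 = D -> s \in cofacets K t -> A != B -> cofacets K s = [set A; B] ->
  (forall s' u v, s' \in cofacets K t -> s' != s -> u \in cofacets K s' -> v \in cofacets K s' ->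
     R u v) ->
  R A B.
Proof.
move=> reflR transR tK dt st AB cs HR; apply/negPn/negP => nAB.
pose P := [set v in K | [&& dim v == D, t \subset v & R A v]].
have cof_dim s' : s' \in cofacets K t -> s' \in K /\ (dim s').+1 = D.
  by move=> /cofacetsP[s'K /facet_dim ->].
(* In the link of [t], [v] is an edge: its facets above [t] are obtained by adding one of the two
   vertices of [v :\: t]. *)
have deg_v v : v \in P -> \sum_(s' in cofacets K t) facet s' v = 2.
  rewrite inE => /and4P[vK /eqP dv tv _].
  have c2 : #|v :\: t| = 2.
    by rewrite cardsD (setIidPr tv) !card_simplex // dv -dt; clear; lia.
  rewrite sum_nat_of_bool -c2.
  have inj : {in v :\: t &, injective (fun x => x |: t)}.
    move=> x y; rewrite !inE => /andP[xt _] _ /setP/(_ x).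
    by rewrite !inE eqxx (negbTE xt) !orbF => /esym/eqP.
  rewrite -(card_in_imset inj); apply: eq_card => s'; rewrite inE; apply/andP/imsetP => [[]|[x]].
    move=> /cofacetsP[s'K ts'] s'v; have [x xt s'E] := facetP tK s'K ts'.
    exists x => //; rewrite inE xt; apply: (subsetP (facet_sub s'v)).
    by rewrite s'E !inE eqxx.
  rewrite inE => /andP[xt xv] ->.
  have sub : x |: t \subset v by rewrite subUset sub1set xv.
  have xtK : x |: t \in K by apply: (face_in vK) => //; apply/set0Pn; exists x; rewrite !inE eqxx.
  split; first by rewrite !inE xtK facet_setU1.
  rewrite /facet sub /=; apply/eqP; rewrite dv.
  by have := facet_dim (facet_setU1 tK xt); rewrite -dt => ->.
(* Away from [s] the two cofacets are related, so both or neither lie in [P]; of the cofacets of [s]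
   only [A] does. *)
have deg_s s' : s' \in cofacets K t -> odd (\sum_(v in P) facet s' v) = (s' == s).
  move=> s't; have [s'K ds'] := cof_dim _ s't.
  have -> : \sum_(v in P) facet s' v = #|[set v in cofacets K s' | R A v]|.
    rewrite sum_nat_of_bool; apply: eq_card => v; rewrite !inE.
    case: (boolP (v \in K)) => //= vK; case: (boolP (facet s' v)) => /= [s'v|]; last by rewrite andbF.
    rewrite (facet_dim s'v) ds' eqxx /= andbT.
    have ts' := facet_sub (proj2 (cofacetsP _ _ s't)).
    by rewrite (subset_trans ts' (facet_sub s'v)).
  case: (eqVneq s' s) => [->|s's].
    rewrite cs (_ : [set v in _ | _] = [set A]) ?cards1 //.
    apply/setP => v; rewrite !inE; case: (eqVneq v A) => [->|vA] /=; first by rewrite reflR.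
    by case: (eqVneq v B) => [->|//]; rewrite (negbTE nAB).
  have [A' [B' [AB' cs']]] := cofacets2 s'K ds'.
  have A'c : A' \in cofacets K s' by rewrite cs' !inE eqxx.
  have B'c : B' \in cofacets K s' by rewrite cs' !inE eqxx orbT.
  case: (boolP (R A A')) => RA.
    rewrite (_ : [set v in _ | _] = [set A'; B']) ?cards2 ?AB' //.
    apply/setP => v; rewrite cs' !inE; case: (eqVneq v A') => [->|vA] /=; first by rewrite RA.
    case: (eqVneq v B') => [->|//] /=; apply: transR RA _; exact: HR s't s's A'c B'c.
  rewrite (_ : [set v in _ | _] = set0) ?cards0 //.
  apply/setP => v; rewrite cs' !inE; case: (eqVneq v A') => [->|vA] /=; first exact: negbTE.
  case: (eqVneq v B') => [->|//] /=; apply: contraNF RA => RB.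
  by apply: transR RB _; exact: HR s't s's B'c A'c.
have : odd (\sum_(v in P) \sum_(s' in cofacets K t) facet s' v) = false.
  by rewrite (eq_bigr (fun=> 2)) // sum_nat_const oddM andbF.
rewrite exchange_big /= (bigD1 s) //= oddD deg_s // eqxx.
rewrite (_ : odd (\sum_(s' in cofacets K t | s' != s) _) = false) //.
elim/big_rec: _ => // s' m /andP[s't s's] om.
by rewrite oddD deg_s // (negbTE s's) om.
Qed.

Lemma separated_card (V G : {set simplex T}) (inc : rel (simplex T)) (Rt A : {set simplex T}) :
  separated V G inc Rt ->
  (forall r, r \in Rt -> exists2 v, v \in A & connect (adjacent V G inc) r v) ->
  #|Rt| <= #|A|.
Proof.
move=> sep H; pose f r := odflt r [pick v in A | connect (adjacent V G inc) r v].
have fP r : r \in Rt -> f r \in A /\ connect (adjacent V G inc) r (f r).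
  move=> /H[v vA rv]; rewrite /f; case: pickP => [w /andP[]//|/(_ v)].
  by rewrite vA rv.
have symc := sym_connect_sym (@adjacent_sym T V G inc).
have inj : {in Rt &, injective f}.
  move=> r r' rRt r'Rt ff; apply: sep => //.
  by apply: connect_trans (fP r rRt).2 _; rewrite ff symc; exact: (fP r' r'Rt).2.
rewrite -(card_in_imset inj); apply: subset_leq_card; apply/subsetP => _ /imsetP[r /fP[rA _] ->].
exact: rA.
Qed.

(* Following up-edges from a vertex never leaves its component and stops, by
   acyclicity, at a critical vertex. *)
Lemma critical_vertex Ms r : morse_matching K Ms -> r \in of_dim (interface K 1) 0 ->
  exists2 v, v \in [set v in K | (dim v == 0) && (v \notin regular Ms)] &
    connect (adjacent (of_dim (interface K 1) 0) (interface K 1) (fun e v => facet v e)) r v.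
Proof.
set V := of_dim _ _; set adj := adjacent _ _ _.
move=> [mM /acyclic_rank[f flt]] rV.
have Pr : (fun v => (v \in V) && connect adj r v) r by rewrite /= rV connect0.
case: (@arg_minnP _ r (fun v => (v \in V) && connect adj r v) f Pr) => v /andP[vV rv] vmin; exists v => //.
have [vK dv] : v \in K /\ dim v = 0 by move: vV; rewrite !inE => /andP[/andP[-> _] /eqP].
rewrite inE vK dv eqxx /=; apply/negP => /regularP[[t s] tsM]; rewrite !inE.
have tsK := subsetP (matching_sub mM) _ tsM; have [tK sK ts] := hasseP tsK.
case/orP => /eqP /= vE; subst v; last by rewrite (facet_dim ts) in dv.
have [a at_ sE] := facetP tK sK ts.
have as_ : a \in s by rewrite sE !inE eqxx.
have aK : [set a] \in K.
  by apply: (face_in sK); rewrite ?sub1set //; apply/set0Pn; exists a; rewrite inE.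
have das : facet [set a] s by rewrite /facet sub1set as_ /= (facet_dim ts) dv /dim cards1.
have ta : t != [set a] by apply: contra at_ => /eqP->; rewrite inE.
have ltf : f [set a] < f t.
  apply: (@ltn_trans (f s)); apply: flt; last exact: arc_up.
  apply: arc_down; first by rewrite inE aK sK das.
  by apply: contra ta => /(matching_functional_down mM tsM)->.
have aV : [set a] \in V by rewrite !inE aK /dim cards1.
have := vmin [set a]; rewrite leqNgt ltf => /(_ _)/negP; apply=> //.
rewrite aV; apply: connect_trans rv (connect1 _).
rewrite /adj /adjacent vV aV; apply/existsP; exists s.
by rewrite /inc_joins ta ts das !inE sK (facet_dim ts) dv.
Qed.

(** * The dual graph that remains for the last interface *)

Section Dual.
Variables (k : nat) (H : {set simplex T}) (M : {set edge T}).
Hypothesis Dk : k.+1 = D.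
Hypothesis stM : stage k H M.

Let W := interface H D.
Let V := of_dim W D.
Local Notation adj := (adjacent V W (fun e v => facet e v)).

Lemma dualP v : (v \in V) = (v \in K) && (dim v == D).
Proof.
case: stM => [[HK H2] _ _ _]; rewrite !inE; case: (eqVneq (dim v) D) => [dv|]; rewrite ?andbF ?andbT //=.
apply/idP/idP => [|vK]; first exact: (subsetP HK).
by apply: H2 => //; rewrite dv -Dk.
Qed.

(* If the wall [s] between [A] and [B] was deleted with its partner [t], one can
   go around [t]; the walls met there precede [s] in the acyclic orientation. *)
Lemma dual_connected s A B : s \in K -> (dim s).+1 = D -> A \in cofacets K s ->
  B \in cofacets K s -> connect adj A B.
Proof.
case: stM => [[HK H2] H3 [mM dM] /acyclic_rank[f flt]].
pose mx := \max_u f u; have fmx u : f u <= mx by exact: leq_bigmax.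
have [n] := ubnP (mx - f s); elim: n s A B => // n IH s A B /ltnSE fs sK ds As Bs.
case: (eqVneq A B) => [->|AB]; first exact: connect0.
have [AK sA] := cofacetsP _ _ As; have [BK sB] := cofacetsP _ _ Bs.
have dA : dim A = D by rewrite (facet_dim sA).
have dB : dim B = D by rewrite (facet_dim sB).
have dsk : dim s = k by apply: succn_inj; rewrite ds.
case: (boolP (s \in H)) => sH.
  apply: connect1; rewrite /adjacent !dualP AK BK dA dB eqxx /=.
  by apply/existsP; exists s; rewrite /inc_joins AB sA sB !inE sH ds eqxx orbT.
rewrite H3 // negbK in sH; case/regularP: sH => -[t s'] tsM; rewrite !inE /=.
have tsK := subsetP (matching_sub mM) _ tsM; have [tK s'K ts] := hasseP tsK.
have dt := facet_dim ts.
case/orP => /eqP sE; first by have := dM _ _ tsM; rewrite dt -sE dsk ltnn.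
subst s'.
have st : s \in cofacets K t by rewrite inE sK.
have [A0 [B0 [AB0 cs]]] := cofacets2 sK ds.
have csAB : cofacets K s = [set A; B].
  apply/eqP; rewrite eq_sym eqEcard cs !cards2 AB AB0 leqnn andbT -cs.
  by apply/subsetP => u; rewrite !inE => /orP[]/eqP->; [rewrite AK|rewrite BK].
apply: (@link_parity (connect adj) t s) => //.
- by move=> u v; exact: connect_trans.
- by rewrite -dt.
move=> s2 u v s2t s2s us vs; have [s2K ts2] := cofacetsP _ _ s2t.
(* The arcs [s2 -> t -> s] make the recursion climb in [f], which [mx] bounds. *)
have lt2 : f s < f s2.
  apply: (@ltn_trans (f t)); apply: flt; first exact: arc_up.
  apply: arc_down; first by rewrite inE /= tK s2K.
  by apply: contra s2s => /(matching_functional_up mM tsM)->.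
apply: (IH s2) => //; last by rewrite (facet_dim ts2) -dt.
by apply: leq_trans fs; apply: ltn_sub2l => //; apply: leq_trans lt2 _.
Qed.

(** Here arcs are followed backwards: from a regular [D]-simplex through its partner [t] to the
    other cofacet of [t], which has larger rank. So a simplex of largest rank in the component is
    critical. The wall [t] may have been deleted, hence the appeal to [dual_connected]. *)
Lemma critical_top Ms r : morse_matching K Ms -> r \in V ->
  exists2 v, v \in [set v in K | (dim v == D) && (v \notin regular Ms)] & connect adj r v.
Proof.
move=> [mM /acyclic_rank[f flt]] rV.
pose mx := \max_u f u; have fmx u : f u <= mx by exact: leq_bigmax.
have Pr : (fun v => (v \in V) && connect adj r v) r by rewrite /= rV connect0.
case: (@arg_maxnP _ r (fun v => (v \in V) && connect adj r v) f Pr) => v /andP[vV rv] vmax; exists v => //.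
have [vK dv] : v \in K /\ dim v = D by move: vV; rewrite dualP => /andP[-> /eqP].
rewrite inE vK dv eqxx /=; apply/negP => /regularP[[t s] tsM]; rewrite !inE.
have tsK := subsetP (matching_sub mM) _ tsM; have [tK sK ts] := hasseP tsK.
have dt := facet_dim ts.
case/orP => /eqP /= vE; subst v; first by have := dimK sK; rewrite dt dv ltnn.
have dtD : (dim t).+1 = D by rewrite -dt.
have sc : s \in cofacets K t by rewrite inE sK.
have [B Bc Bs] := other_cofacet tK dtD sc.
have [BK tB] := cofacetsP _ _ Bc.
have ltf : f s < f B.
  apply: (@ltn_trans (f t)); apply: flt; first exact: arc_up.
  apply: arc_down; first by rewrite inE /= tK BK.
  by apply: contra Bs => /(matching_functional_up mM tsM)->.
have BV : B \in V by rewrite dualP BK (facet_dim tB) dtD eqxx.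
have := vmax B; rewrite /= leqNgt ltf => /(_ _)/negP; apply=> //.
by rewrite BV; apply: connect_trans rv (dual_connected tK dtD sc Bc).
Qed.

(** Cross two different walls of [r]. The neighbours reached differ, because a [D]-simplex
    containing both walls is [r] itself. *)
Lemma dual_component3 r : 0 < k -> r \in V -> 2 < #|[set v in V | connect adj r v]|.
Proof.
move=> k0; rewrite dualP => /andP[rK /eqP dr].
have cr : #|r| = k.+2 by rewrite card_simplex // dr -Dk.
have [x [y [xr yr xy]]] : exists x y, [/\ x \in r, y \in r & x != y].
  by apply/card_gt1P; rewrite cr.
have wall z : z \in r -> [/\ r :\ z \in K, facet (r :\ z) r & (dim (r :\ z)).+1 = D].
  move=> zr; have crz : #|r :\ z| = k.+1 by move: cr; rewrite (cardsD1 z) zr => -[].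
  have rzK : r :\ z \in K.
    by apply: (face_in rK); rewrite ?subsetDl // -card_gt0 crz.
  split=> //; first by rewrite /facet subsetDl /dim crz cr /=.
  by rewrite /dim crz.
have nb z : z \in r -> exists v, [/\ v \in cofacets K (r :\ z), v != r & connect adj r v].
  move=> zr; have [wK wr dw] := wall z zr.
  have rc : r \in cofacets K (r :\ z) by rewrite inE rK.
  by have [v vc vr] := other_cofacet wK dw rc; exists v; rewrite (dual_connected wK dw rc vc).
have [v [vc vr rv]] := nb x xr; have [w [wc wr rw]] := nb y yr.
have [vK xv] := cofacetsP _ _ vc; have [wK yw] := cofacetsP _ _ wc.
have dvD : dim v = D by rewrite (facet_dim xv); have [] := wall x xr.
have dwD : dim w = D by rewrite (facet_dim yw); have [] := wall y yr.
have vw : v != w.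
  apply: contra vr => /eqP vw; rewrite eq_sym eqEcard !card_simplex // dvD dr leqnn andbT.
  apply/subsetP => z zr; case: (eqVneq z x) => [->|zx].
    by rewrite vw; apply: (subsetP (facet_sub yw)); rewrite !inE xy.
  by apply: (subsetP (facet_sub xv)); rewrite !inE zx.
have sub : [set r; v; w] \subset [set v in V | connect adj r v].
  apply/subsetP => u ur; rewrite inE dualP; move: ur.
  rewrite !inE => /orP[/orP[]|] /eqP->.
  - by rewrite rK dr eqxx connect0.
  - by rewrite vK dvD eqxx.
  - by rewrite wK dwD eqxx.
apply: leq_trans (subset_leq_card sub); rewrite -setUA cardsU1 cards2 vw !inE negb_or.
by rewrite ![r == _]eq_sym vr wr.
Qed.

Lemma dual_roots3 (Rt : {set simplex T}) : 0 < k -> Rt \subset V -> separated V W (fun e v => facet e v) Rt ->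
  3 * #|Rt| <= #|V|.
Proof.
move=> k0 /subsetP RtV sep; rewrite mulnC -sum_nat_const.
apply: (@leq_trans (\sum_(r in Rt) \sum_(v in V) connect adj r v)).
  by apply: leq_sum => r rRt; rewrite sum_nat_of_bool; apply: dual_component3 => //; exact: RtV.
rewrite exchange_big /= -sum1_card; apply: leq_sum => v vV; rewrite sum_nat_of_bool.
have symc := sym_connect_sym (@adjacent_sym T V W (fun e v => facet e v)).
apply/card_le1_eqP => r r'; rewrite !inE => /andP[rRt rv] /andP[r'Rt r'v].
by apply: sep => //; apply: connect_trans r'v _; rewrite symc.
Qed.

End Dual.

(** * Charging simplices to the matched pairs *)

Lemma facets_card s : s \in K -> #|[set t in K | facet t s]| <= (dim s).+1.
Proof.
move=> sK; rewrite -card_simplex //; apply: leq_trans (leq_imset_card (fun x => s :\ x) s).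
apply: subset_leq_card; apply/subsetP => t; rewrite inE => /andP[tK ts].
have [a at_ sE] := facetP tK sK ts; apply/imsetP; exists a; first by rewrite sE !inE eqxx.
by rewrite sE setU1K.
Qed.

Lemma walls_card : 2 * #|[set s in K | (dim s).+1 == D]| <= D.+1 * #|[set s in K | dim s == D]|.
Proof.
rewrite mulnC -sum_nat_const [leqRHS]mulnC -sum_nat_const.
apply: (@leq_trans (\sum_(s in [set s in K | (dim s).+1 == D])
                      \sum_(v in [set s in K | dim s == D]) facet s v)).
  apply: leq_sum => s; rewrite inE => /andP[sK /eqP ds]; rewrite sum_nat_of_bool.
  have [A [B [AB cs]]] := cofacets2 sK ds.
  have -> : 2 = #|cofacets K s| by rewrite cs cards2 AB.
  apply: subset_leq_card; apply/subsetP => v /cofacetsP[vK sv].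
  by rewrite !inE vK sv (facet_dim sv) ds eqxx.
rewrite exchange_big /=; apply: leq_sum => v; rewrite inE => /andP[vK /eqP dv].
rewrite sum_nat_of_bool -dv; apply: leq_trans (facets_card vK); apply: subset_leq_card.
by apply/subsetP => s; rewrite !inE => /andP[/andP[-> _] ->].
Qed.

Definition covered d M := forall t, t \in K -> 0 < dim t -> dim t < d -> t \notin regular M ->
  exists t' s, facet t s /\ (t', s) \in M.

(** All cofacets of a [d]-simplex are still present when its interface is processed, and a simplex
    of dimension [d + 1] matched there is the larger one of its pair. *)
Lemma coveredS d H M M1 : d.+1 < D -> stage d H M -> covered d M ->
  intermediate_apx (interface H d.+1) d.+1 M1 -> covered d.+1 (M :|: M1).
Proof.
move=> dD stM cov ia t tK t0; rewrite ltnS leq_eqVlt => /predU1P[td|td].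
  have [aM1 H1] := intermediate_apx_spec (@interface_levelled _ H d.+1) ia.
  rewrite regularU negb_or => /andP[tM tM1].
  have [[HK H2] H3 _ _] := stM.
  have tH : t \in H by rewrite H3.
  have tW : t \in interface H d.+1 by rewrite inE tH td eqxx orbT.
  have /H1 : t \in lower (interface H d.+1) d.+1 by rewrite inE tW td eqxx.
  rewrite (negbTE tM1) => -[//|[c0|]].
    have [|a [b [_ at_ _ aK _]]] := two_cofacets tK; first by rewrite td ltnW.
    have ft := facet_setU1 tK at_; have da := facet_dim ft.
    have : a |: t \in cofacets (interface H d.+1) t.
      by rewrite !inE ft H2 ?da ?td ?eqxx.
    by rewrite c0 inE.
  rewrite -setI_eq0 => /set0Pn[s]; rewrite inE => /andP[sc sM1].
  move: sc; rewrite inE => /andP[sW ts].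
  case/regularP: sM1 => -[t' s'] tsM1; rewrite !inE /= => /orP[]/eqP sE; subst s.
    have [d1 _] := @interface_levelled _ H _ _ _ (subsetP (matching_sub aM1.1) _ tsM1).
    by have := facet_dim ts; rewrite td => d2; exact: succ_absurd d2 d1.
  by exists t', s'; rewrite inE tsM1 orbT.
move=> tM; have [|t' [s [ts sM]]] := cov t tK t0 td.
  by apply: contra tM => tM; rewrite regularU tM.
by exists t', s; rewrite inE sM.
Qed.

Lemma middle_loop m d st st' : foreach (process_interface D) (iota d.+1 m) st st' ->
  0 < d -> d + m < D -> stage d st.1 st.2 -> covered d st.2 ->
  [/\ stage (d + m) st'.1 st'.2, covered (d + m) st'.2 & st.2 \subset st'.2].
Proof.
elim: m d st => [|m IH] d st /= fe d0 dm sst cst.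
  by inversion fe; subst; rewrite addn0.
inversion fe as [|? ? ? st1 ? pr fe']; subst.
have dD : d.+1 < D by apply: leq_ltn_trans dm; rewrite addnS ltnS leq_addr.
have : stage d.+1 st1.1 st1.2 /\ covered d.+1 st1.2 /\ st.2 \subset st1.2.
  inversion pr as [H0 M0 N0 M1 d1|H0 M0 M1 dD' ia|H0 M0 N0 dD']; subst => /=.
  - by case: d1 d0 => ->.
  - have [aM1 _] := intermediate_apx_spec (@interface_levelled _ H0 d.+1) ia.
    split; first exact: stageS sst aM1.
    by split; [exact: coveredS dD sst cst ia|exact: subsetUl].
  - by rewrite ltnn in dD.
move=> [sst1 [cst1 sub]]; rewrite -addSnnS in dm *.
have [sst' cst' sub'] := IH _ _ fe' isT dm sst1 cst1.
by split=> //; exact: subset_trans sub sub'.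
Qed.

Lemma stage0 : stage 0 K set0.
Proof.
split=> //.
- move=> s sK _; rewrite sK; apply/esym/negP => /regularP[e].
  by rewrite inE.
- split; last by move=> t s; rewrite inE.
  by apply/matchingP; split; [exact: sub0set|move=> e f x; rewrite inE].
- apply: (@rank_acyclic T _ (@dim T)) => x y; rewrite /arc !inE andbF /= => /and3P[_ _ /facet_dim->].
  exact: ltnSn.
Qed.

Lemma regular_card M : matching (hasse K) M -> #|regular M| = 2 * #|M|.
Proof.
move=> mM; have /matchingP[MK mMP] := mM.
have -> : regular M = [set e.1 | e in M] :|: [set e.2 | e in M].
  apply/setP => x; rewrite in_setU; apply/regularP/orP => [[e eM]|[]].
  - by rewrite !inE => /orP[]/eqP->; [left|right]; apply/imsetP; exists e.
  - by move=> /imsetP[e eM ->]; exists e; rewrite // !inE eqxx.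
  - by move=> /imsetP[e eM ->]; exists e; rewrite // !inE eqxx orbT.
rewrite cardsU (_ : _ :&: _ = set0).
  rewrite cards0 subn0 !card_in_imset ?mul2n ?addnn // => e f eM fM ef.
    by apply: (mMP e f e.2) => //; rewrite !inE ?ef eqxx orbT.
  by apply: (mMP e f e.1) => //; rewrite !inE ?ef eqxx.
apply/setP => x; rewrite !inE; apply/negP => /andP[/imsetP[[t s] eM xe] /imsetP[[t' s'] fM xf]].
have [ef1 ef2] : (t, s) = (t', s').
  by apply: (mMP _ _ x) => //; rewrite !inE; [rewrite xe eqxx|rewrite xf eqxx orbT].
have [_ _ /facet_dim] := hasseP (subsetP MK _ eM).
by move: xe; rewrite xf /= -ef2 => -> /eqP; rewrite ltn_eqF.
Qed.

Definition uppers M := [set e.2 | e in M].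

(** An intermediate simplex that is not matched from below is matched upwards or critical; either
    way it has a cofacet matched from below. This cofacet has dimension at most [D - 1], hence at
    most [D] facets. *)
Lemma middle_card M : 2 < D -> morse_matching K M -> covered D.-1 M ->
  #|[set t in K | 0 < dim t < D.-1]| <=
    #|[set s in uppers M | 0 < dim s < D.-1]| + D * #|[set s in uppers M | 1 < dim s < D]|.
Proof.
move=> D3 [mM _] cov; set up := uppers M; rewrite mulnC -sum_nat_const.
set A := [set t in K | _]; set B := [set s in up | _]; set C := [set s in up | _].
have upK s : s \in up -> s \in K.
  by move=> /imsetP[[t s'] /(subsetP (matching_sub mM))/hasseP[_ sK _] ->].
apply: (@leq_trans (#|B| + \sum_(s in C) \sum_(t in A) facet t s)); last first.
  rewrite leq_add2l; apply: leq_sum => s; rewrite inE => /andP[/upK sK /andP[_ sD]].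
  rewrite sum_nat_of_bool; apply: leq_trans sD; apply: leq_trans (facets_card sK).
  apply: subset_leq_card; apply/subsetP => t; rewrite !inE.
  by move=> /andP[/andP[-> _] ->].
rewrite exchange_big /= -sum1_card (bigID (mem up)) /=; apply: leq_add.
  rewrite sum1_card; apply: subset_leq_card; apply/subsetP => t.
  rewrite unfold_in => /andP[/= tA tup]; move: tA; rewrite !inE => /andP[_ ->].
  by rewrite andbT; exact: tup.
rewrite [leqRHS](bigID (mem up)) /=; apply: leq_trans (leq_addl _ _).
apply: leq_sum => t /andP[]; rewrite inE => /andP[tK /andP[t0 tD]] tup.
have [t' [s [ts sM]]] : exists t' s, facet t s /\ (t', s) \in M.
  case: (boolP (t \in regular M)) => tM; last exact: cov.
  case/regularP: tM => -[t1 s1] tsM; rewrite !inE /= => /orP[]/eqP tE; subst.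
    have [_ _ ?] := hasseP (subsetP (matching_sub mM) _ tsM).
    by exists t1, s1.
  by case/negP: tup; apply/imsetP; exists (t1, s1).
have sup : s \in up by apply/imsetP; exists (t', s).
rewrite (bigD1 s) /= ?ts ?leq_addr // inE sup (facet_dim ts) ltnS t0 /=.
by rewrite -ltn_predRL.
Qed.

Lemma process_interface_exists d (st : algo_state T) : 0 < d <= D -> exists st', process_interface D d st st'.
Proof.
case: st => H M /andP[d0 dD].
move: dD; rewrite leq_eqVlt => /predU1P[dE|dD].
  have [N dN] := @dfs_optimal_exists T (of_dim (interface H d) D) (interface H d) (fun e v => facet e v).
  by eexists; apply: process_last dE dN.
move: d0; rewrite leq_eqVlt => /predU1P[dE|d1].
  have [N dN] := @dfs_optimal_exists T (of_dim (interface H d) 0) (interface H d) (fun e v => facet v e).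
  by eexists; apply: process_first (esym dE) dN erefl.
have [M1 iM1] := @intermediate_apx_exists T _ d (@interface_levelled _ H d).
by eexists; apply: process_middle iM1; rewrite d1.
Qed.

Lemma interface_algorithm_exists : exists M, interface_algorithm D K M.
Proof.
suff H m d (st : algo_state T) : 0 < d -> d + m <= D.+1 -> exists st', foreach (process_interface D) (iota d m) st st'.
  by have [[H0 M] fe] := H D 1 (K, set0) isT (leqnn _); exists M, H0.
elim: m d st => [|m IH] d st d0 dm /=; first by exists st; constructor.
have [|st1 pr] := @process_interface_exists d st.
  by rewrite d0 /= -ltnS; apply: leq_trans dm; rewrite addnS ltnS leq_addr.
have [//||st' fe] := IH d.+1 st1; first by rewrite addSnnS.
by exists st'; apply: foreach_cons pr fe.
Qed.

(** The charge on a pair whose larger simplex has dimension [n]: the vertex paired by the first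
    search, the larger simplex itself if intermediate, its at most [D] facets, and for [n = D] the
    top simplex with its share of [D] walls. *)
Lemma weight_bound n : 2 < D ->
  (n == 1) + (0 < n < D.-1) + D * (1 < n < D) + D.+1 * (n == D) <= D.+1.
Proof.
move=> D3; have [nD|nD|->] := ltngtP n D.
- rewrite muln0 addn0 andbT; have [n1|n1|->] := ltngtP n 1.
  + by case: n n1 nD => // _ _; rewrite muln0.
  + by rewrite muln1 add0n -[D.+1]addn1 addnC leq_add2l leq_b1.
  + by rewrite muln0 addn0 (leq_trans (leq_add (leqnn 1) (leq_b1 _))) // ltnW // ltnW.
- have -> : (n == 1) = false by rewrite gtn_eqF // (ltn_trans _ nD) // ltnW.
  by rewrite [n < D.-1]ltnNge (leq_trans (leq_pred D) (ltnW nD)) !andbF !muln0.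
- rewrite (gtn_eqF (ltnW D3)) andbF muln0 muln1 [D < D.-1]ltnNge leq_pred andbF.
  by rewrite leqnn.
Qed.

Lemma count_bound M1 M N (Ms : {set edge T}) (R0 RD : {set simplex T}) : 2 < D ->
  morse_matching K M -> covered D.-1 M -> morse_matching K Ms ->
  (forall t s, (t, s) \in M1 -> (t, s) \in M /\ dim s = 1) ->
  (forall t s, (t, s) \in N -> (t, s) \in M /\ dim s = D) ->
  #|[set s in K | dim s == 0]| = #|M1| + #|R0| ->
  #|[set s in K | dim s == D]| = #|N| + #|RD| ->
  3 * #|RD| <= #|[set s in K | dim s == D]| ->
  #|R0| <= #|[set s in K | (dim s == 0) && (s \notin regular Ms)]| ->
  #|RD| <= #|[set s in K | (dim s == D) && (s \notin regular Ms)]| ->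
  2 * #|regular Ms| <= D.+1 * #|regular M|.
Proof.
move=> D3 mM cov mMs M1M NM c0 cD c3 r0 rD.
have D0 : 0 < D by apply: leq_trans D3.
have [mtM _] := mM; have /matchingP[MK _] := mtM.
rewrite (regular_card mtM) mulnCA leq_pmul2l //.
pose K0 := [set s in K | dim s == 0]; pose KD := [set s in K | dim s == D].
pose KW := [set s in K | (dim s).+1 == D]; pose Km := [set s in K | 0 < dim s < D.-1].
pose C0 := [set s in K | (dim s == 0) && (s \notin regular Ms)].
pose CD := [set s in K | (dim s == D) && (s \notin regular Ms)].
have part : #|K| <= #|K0| + #|Km| + #|KW| + #|KD|.
  have sub : K \subset K0 :|: Km :|: KW :|: KD.
    apply/subsetP => s sK; rewrite !inE sK /=; have := dimK sK.
    by clear; move: (dim s) => n; lia.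
  apply: leq_trans (subset_leq_card sub) _.
  do 2 (apply: leq_trans (leq_card_setU _ _) _; rewrite leq_add2r).
  exact: leq_card_setU.
have crit : #|regular Ms| + #|C0| + #|CD| <= #|K|.
  have dis1 : [disjoint regular Ms & C0].
    by apply/pred0Pn => -[s /= /andP[sR]]; rewrite inE sR /= andbF andbF.
  have dis2 : [disjoint regular Ms :|: C0 & CD].
    apply/pred0Pn => -[s /= /andP[]]; rewrite !inE => sR /and3P[_ /eqP ds sR'].
    by move: sR; rewrite (negbTE sR') ds (gtn_eqF D0) andbF.
  have -> : #|regular Ms| + #|C0| = #|regular Ms :|: C0|.
    by apply/esym/eqP; rewrite (leq_card_setU _ _).
  have -> : #|regular Ms :|: C0| + #|CD| = #|regular Ms :|: C0 :|: CD|.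
    by apply/esym/eqP; rewrite (leq_card_setU _ _).
  apply: subset_leq_card; rewrite !subUset; apply/andP; split; last first.
    by apply/subsetP => s; rewrite inE => /andP[].
  apply/andP; split; last by apply/subsetP => s; rewrite inE => /andP[].
  case: mMs => /matching_sub/subsetP MsK _.
  apply/subsetP => s /regularP[[a b] /MsK/hasseP[aK bK _]].
  by rewrite !inE => /orP[]/eqP->.
have mid := middle_card D3 mM cov.
have walls := walls_card; rewrite -/KW -/KD in walls; rewrite -/Km in mid.
rewrite -/K0 in c0; rewrite -/KD in cD c3; rewrite -/C0 in r0; rewrite -/CD in rD.
have up_inj : {in M &, injective (fun e : edge T => e.2)}.
  move=> [t s] [t' s'] tM t'M /= ss; subst s'.
  by rewrite (matching_functional_down mtM tM t'M).
have cup : #|uppers M| = #|M| by rewrite card_in_imset.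
have cU (F : {set edge T}) n : (forall t s, (t, s) \in F -> (t, s) \in M /\ dim s = n) ->
    #|F| <= #|[set s in uppers M | dim s == n]|.
  move=> FM; have FinM e : e \in F -> e \in M by case: e => t s /FM[].
  rewrite -(card_in_imset (f := fun e : edge T => e.2)); last first.
    by move=> e f /FinM eM /FinM fM; exact: up_inj.
  apply: subset_leq_card; apply/subsetP => _ /imsetP[[t s] /FM[tM ds] ->].
  by rewrite inE /= ds eqxx andbT; apply/imsetP; exists (t, s).
have ca := cU _ _ M1M; have cb := cU _ _ NM.
have weights : #|[set s in uppers M | dim s == 1]| + #|[set s in uppers M | 0 < dim s < D.-1]|
    + D * #|[set s in uppers M | 1 < dim s < D]| + D.+1 * #|[set s in uppers M | dim s == D]|
    <= D.+1 * #|M|.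
  rewrite -!sum_nat_of_bool !big_distrr -!big_split /= -cup mulnC -sum_nat_const.
  by apply: leq_sum => s _; exact: weight_bound.
rewrite cD in part c3 walls; rewrite c0 in part.
(* From [3 * #|RD| <= #|N| + #|RD|] follows [2 * #|RD| <= #|N|], so [4 * #|KW| <= 3 * D.+1 * #|N|].
   The claim then needs [3 * D.+1 <= 4 * D], which is [3 <= D]. *)
have wallN : #|KW| <= D * #|N|.
  by clear -D3 c3 walls; move: #|KW| #|N| #|RD| c3 walls => w a b c3 w2; nia.
apply: leq_trans weights.
apply: (@leq_trans (#|M1| + #|Km| + #|KW| + #|N|)).
  clear -part crit r0 rD; move: part crit r0 rD.
  by move: #|K| #|M1| #|R0| #|Km| #|KW| #|N| #|RD| #|regular Ms| #|C0| #|CD| => *; lia.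
have bN : D.+1 * #|N| <= D.+1 * #|[set s in uppers M | dim s == D]| by rewrite leq_pmul2l.
move: ca wallN mid bN; move: (D.+1 * #|[set s in uppers M | dim s == D]|) => x.
move: #|[set s in uppers M | dim s == 1]| #|[set s in uppers M | 0 < dim s < D.-1]| => y z.
move: (D * #|[set s in uppers M | 1 < dim s < D]|) #|M1| #|Km| #|KW| #|N| => u a b c e.
by clear; rewrite mulSn => *; lia.
Qed.

Theorem interface_algorithm_spec M : 2 < D -> interface_algorithm D K M ->
  morse_matching K M /\
  forall Ms, morse_matching K Ms -> 2 * #|regular Ms| <= D.+1 * #|regular M|.
Proof.
move=> D3 [H fe]; have D0 : 0 < D by apply: leq_trans D3.
have iotaE : iota 1 D = [:: 1] ++ (iota 2 (D - 2) ++ [:: D]).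
  have {1}-> : D = 1 + ((D - 2) + 1) by lia.
  rewrite iotaD iotaD /= (_ : (1 + 1 + (D - 2)) = D) //; lia.
rewrite iotaE in fe; have [st1 fe1 fe23] := foreach_cat fe.
have [st2 fe2 fe3] := foreach_cat fe23.
have {fe1} pr1 : process_interface D 1 (K, set0) st1.
  by inversion fe1 as [|? ? ? st1' ? pr1 nil1]; subst; inversion nil1; subst.
have {fe3} pr3 : process_interface D D st2 (H, M).
  by inversion fe3 as [|? ? ? st3' ? pr3 nil3]; subst; inversion nil3; subst.
have [N1 dN1 st1E] : exists2 N1, dfs_optimal (of_dim (interface K 1) 0) (primal_joins (interface K 1)) N1
    & st1 = (remaining K 1 (flip N1), set0 :|: flip N1).
  inversion pr1 as [H0 M0 N1 M1 d1 dN1|H0 M0 M1 d1|H0 M0 N1 D1]; subst; first by exists N1.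
    by [].
  by [].
subst st1; have aN1 := first_acyclic_matching dN1.
have sN1 := stageS stage0 aN1.
have cov1 : covered 1 (set0 :|: flip N1) by move=> t _ t0; rewrite ltnS leqNgt t0.
have dm : 1 + (D - 2) < D by clear -D3; lia.
have [] := middle_loop fe2 isT dm sN1 cov1; case: st2 pr3 {fe2} => [H2 M2] pr3 /=.
have -> : 1 + (D - 2) = D.-1 by clear -D3; lia.
move=> sN2 cov2 sub2; have Dk : D.-1.+1 = D by rewrite prednK.
have [N dN ME] : exists2 N, dfs_optimal (of_dim (interface H2 D) D) (dual_joins (interface H2 D)) N
    & M = M2 :|: N.
  inversion pr3 as [H0 M0 N0 M1 D1|H0 M0 M1 Dlt|H0 M0 N0 _ dN]; subst.
  - by [].
  - by rewrite ltnn andbF in Dlt.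
  - by exists N0.
have [[H2K _] _ _ _] := sN2.
have aN := last_acyclic_matching H2K dN.
have sN : stage D.-1.+1 (remaining H2 D.-1.+1 N) (M2 :|: N).
  by apply: stageS sN2 _; rewrite Dk.
have [_ _ [mM _] acyc] := sN; rewrite -ME in mM acyc.
split=> // Ms mMs; have [R0 [R0V sep0 c0]] := first_roots dN1.
have [RD [RDV sepD cD]] := last_roots H2K dN.
have dualE := dualP Dk sN2.
have VD : of_dim (interface H2 D) D = [set s in K | dim s == D].
  by apply/setP => s; rewrite dualE inE.
have V0 : of_dim (interface K 1) 0 = [set s in K | dim s == 0].
  by apply/setP => s; rewrite !inE eqSS; case: (dim s == 0); rewrite ?orbT ?andbT ?andbF.
have c3 := dual_roots3 Dk sN2 _ RDV sepD.
apply: (count_bound D3 (M1 := flip N1) (N := N) (R0 := R0) (RD := RD)) => //.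
- move=> t tK t0 td; rewrite ME regularU negb_or => /andP[tM2 _].
  by have [t' [s [ts sM]]] := cov2 t tK t0 td tM2; exists t', s; rewrite inE sM.
- move=> t s ts; split; first by rewrite ME inE (subsetP sub2) // in_setU ts orbT.
  by have [] := @interface_levelled _ K 1 _ _ (subsetP (matching_sub aN1.1) _ ts).
- move=> t s ts; split; first by rewrite ME inE ts orbT.
  by have [] := @interface_levelled _ H2 D _ _ (subsetP (matching_sub aN.1) _ ts).
- rewrite -V0 c0 card_in_imset // => -[a b] [a' b'] _ _ /= [-> ->].
  by [].
- by rewrite -VD.
- by rewrite -VD; apply: c3; clear -D3; lia.
- by apply: (separated_card sep0) => r /(subsetP R0V) rV; exact: critical_vertex mMs rV.
- by apply: (separated_card sepD) => r /(subsetP RDV) rV; exact: critical_top Dk sN2 _ _ mMs rV.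
Qed.

End Pseudomanifold.

(** * Invariance of domain *)

Section CupProduct.
Local Open Scope ring_scope.
Import Order.TTheory GRing.Theory Num.Theory.

Variable n : nat.
Local Notation point := ('I_n -> nat).
Implicit Types (S : {set 'I_n}) (v : point) (s : seq 'I_n).

Definition ext (h : point -> 'F_2) := forall v w, v =1 w -> h v = h w.

Variable a : 'I_n -> point -> 'F_2.
Hypothesis a_ext : forall i, ext (a i).

Definition upd v (j : 'I_n) (k : nat) : point := fun i => if i == j then k else v i.
Definition step v j : point := upd v j (v j).+1.

(* The cup product of the coboundaries of the 0-cochains [a i],
   [i] in [s], evaluated on the
   cube spanned at [v] by the directions in [S]. *)
Fixpoint cup s S v : 'F_2 :=
  if s is i :: s' then
    \sum_(j in S) (a i v + a i (step v j)) * cup s' (S :\ j) (step v j)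
  else 1.

Lemma step_ext v w j : v =1 w -> step v j =1 step w j.
Proof. by move=> vw i; rewrite /step /upd vw; case: eqP => // _; rewrite vw. Qed.

Lemma cup_ext s S : ext (cup s S).
Proof.
elim: s S => //= i s IH S v w vw.
apply: eq_bigr => j _; congr (_ * _); last by apply/IH/step_ext.
by congr (_ + _); apply: a_ext => //; apply: step_ext.
Qed.

Lemma step_swap v j k : j != k -> step (step v k) j =1 step (step v j) k.
Proof.
move=> jk i; rewrite /step /upd (negbTE jk) (eq_sym k) (negbTE jk).
by case: (eqVneq i j) => [->|//]; rewrite (negbTE jk).
Qed.

Lemma addF2 (x : 'F_2) : x + x = 0.
Proof. by apply: addrr_pchar2; rewrite pchar_Fp. Qed.

Lemma mulrn_oddF2 (x : 'F_2) m : odd m -> x *+ m = x.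
Proof.
move=> om; rewrite -[m]odd_double_half om add1n mulrS -mul2n mulrnA.
by rewrite mulr2n addF2 mul0rn addr0.
Qed.

Lemma sym_sum0 S (F : 'I_n -> 'I_n -> 'F_2) :
  (forall j k, j \in S -> k \in S -> j != k -> F j k = F k j) ->
  \sum_(j in S) \sum_(k in S :\ j) F j k = 0.
Proof.
move=> symF.
have ->: \sum_(j in S) \sum_(k in S :\ j) F j k =
  \sum_(j in S) \sum_(k in S | (j < k)%N) F j k
  + \sum_(j in S) \sum_(k in S | (k < j)%N) F j k.
  rewrite -big_split; apply: eq_bigr => j jS /=.
  rewrite (bigID (fun k : 'I_n => (j < k)%N)) /=; congr (_ + _); apply: eq_bigl => k.
    rewrite !inE; case: (eqVneq k j) => [->|] /=; last by [].
    by rewrite ltnn andbF.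
  rewrite !inE -leqNgt; case: (eqVneq k j) => [->|kj] /=; first by rewrite ltnn andbF.
  by rewrite ltn_neqAle (inj_eq val_inj) kj.
rewrite [X in _ + X](exchange_big_dep (mem S)) /=; last by move=> ? ? _ /andP[].
rewrite -big_split big1 //= => j jS.
rewrite jS /= -big_split big1 //= => k /andP[kS jk].
by rewrite (symF j k) ?addF2 //; apply: contraTneq jk => ->; rewrite ltnn.
Qed.

Lemma exchange_D1 S (F : 'I_n -> 'I_n -> 'F_2) :
  \sum_(j in S) \sum_(k in S :\ j) F j k = \sum_(k in S) \sum_(j in S :\ k) F j k.
Proof.
rewrite (exchange_big_dep (mem S)) /=; last by move=> j k jS; rewrite !inE => /andP[].
apply: eq_bigr => k kS; apply: eq_bigl => j.
by rewrite !inE kS andbT andbC eq_sym.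
Qed.

Lemma setD1C S j k : S :\ j :\ k = S :\ k :\ j.
Proof. by apply/setP => i; rewrite !inE; do 3 case: (_ == _) => //=. Qed.

(** The cup product is a cocycle: on a cube with one direction too many, the faces at [v] and the
    opposite faces have the same sum. In the induction, terms symmetric in two directions cancel in
    pairs mod 2. *)
Lemma cup_closed s S v : #|S| = (size s).+1 ->
  \sum_(j in S) cup s (S :\ j) v = \sum_(j in S) cup s (S :\ j) (step v j).
Proof.
elim: s S v => [|i s IH] S v cS; first by [].
have IHk k : k \in S -> \sum_(j in S :\ k) cup s (S :\ k :\ j) (step v k) =
    \sum_(j in S :\ k) cup s (S :\ k :\ j) (step (step v k) j).
  by move=> kS; apply: IH => //; move: cS; rewrite (cardsD1 k) kS /= => -[].
pose G k j := cup s (S :\ k :\ j) (step (step v k) j).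
have Gsym k j : k != j -> G k j = G j k.
  move=> kj; rewrite /G setD1C; apply: cup_ext.
  by apply: step_swap; rewrite eq_sym.
transitivity (\sum_(k in S) \sum_(j in S :\ k) a i (step v k) * G k j).
  rewrite /= exchange_D1.
  transitivity (\sum_(k in S) \sum_(j in S :\ k) (a i v + a i (step v k)) * G k j).
    apply: eq_bigr => k kS; rewrite -mulr_sumr -IHk // mulr_sumr.
    by apply: eq_bigr => j _; rewrite setD1C.
  have ->: \sum_(k in S) \sum_(j in S :\ k) (a i v + a i (step v k)) * G k j =
     \sum_(k in S) \sum_(j in S :\ k) a i v * G k j
     + \sum_(k in S) \sum_(j in S :\ k) a i (step v k) * G k j.
    rewrite -big_split; apply: eq_bigr => k _; rewrite -big_split.
    by apply: eq_bigr => j _; rewrite mulrDl.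
  by rewrite sym_sum0 ?add0r // => j k _ _ jk; rewrite Gsym.
rewrite /=.
have ->: \sum_(j in S) \sum_(k in S :\ j) (a i (step v j) + a i (step (step v j) k)) *
    cup s (S :\ j :\ k) (step (step v j) k) =
   \sum_(j in S) \sum_(k in S :\ j) a i (step v j) * G j k
   + \sum_(j in S) \sum_(k in S :\ j) a i (step (step v j) k) * G j k.
  rewrite -big_split; apply: eq_bigr => k _; rewrite -big_split.
  by apply: eq_bigr => j _; rewrite mulrDl.
rewrite [X in _ + X]sym_sum0 ?addr0 // => j k _ _ jk.
rewrite Gsym //; congr (_ * _); apply: a_ext.
by apply: step_swap; rewrite eq_sym.
Qed.

(** As [cup s] is closed, [cup (i :: s)] is the coboundary of the product of [a i] and [cup s]. This
    form is what telescopes to the boundary of the box. *)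
Lemma cup_cons s S v i : #|S| = (size s).+1 ->
  cup (i :: s) S v =
  \sum_(j in S) (a i v * cup s (S :\ j) v + a i (step v j) * cup s (S :\ j) (step v j)).
Proof.
move=> cS; rewrite big_split -mulr_sumr cup_closed ?mulr_sumr -?big_split //=.
by apply: eq_bigr => j _; rewrite mulrDl.
Qed.

(** The cochain [a l] is constant on the face [w j = k], so its coboundary, one of the factors,
    vanishes there. *)
Lemma cup_face0 s S v l j k x : l \in s -> j \notin S -> v j = k ->
  (forall w, w j = k -> a l w = x) -> cup s S v = 0.
Proof.
move=> + + + aj; elim: s S v => //= b s IH S v; rewrite inE => + jS vj.
case/predU1P => [<-|as_].
  apply: big1 => i iS.
  rewrite !aj ?addF2 ?mul0r // /step /upd; case: eqP => // ji.
  by rewrite ji iS in jS.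
apply: big1 => i iS; rewrite (IH _ _ as_) ?mulr0 //.
  by rewrite !inE negb_and jS orbT.
by rewrite /step /upd; case: eqP => // ji; rewrite ji iS in jS.
Qed.

Variable p' : nat.
Local Notation p := p'.+1.
Hypothesis oddp : odd p.

Local Notation box := {ffun 'I_n -> 'I_p}.

(** Coordinates outside [S] are put on the far face. A sum over all [u] thus counts each cube in the
    directions [S] as often as there are choices outside [S], a power of [p]; this is odd by [oddp],
    so mod 2 each cube counts once and one index type serves every [S]. *)
Definition corner S (u : box) : point := fun j => if j \in S then u j : nat else p.

Definition fupd (u : box) j (k : 'I_p) : box := [ffun i => if i == j then k else u i].

(** On the right every box is hit [p] times, an odd number. *)
Lemma sum_fibre (f : box -> 'F_2) j :
  \sum_u f u = \sum_u \sum_(k < p) f (fupd u j k).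
Proof.
have H (c : 'I_p) : \sum_u f u = \sum_u f (fupd u j (u j + c)).
  apply: (reindex (fun u => fupd u j (u j + c))).
  exists (fun u => fupd u j (u j - c)) => u _; apply/ffunP => i; rewrite !ffunE eqxx;
  by case: eqP => // ->; rewrite ?addrK ?subrK.
transitivity (\sum_(c < p) \sum_u f (fupd u j (u j + c))).
  rewrite [RHS](eq_bigr (fun _ => \sum_u f u)); last by move=> c _; rewrite -H.
  by rewrite sumr_const card_ord mulrn_oddF2.
rewrite exchange_big; apply: eq_bigr => u _ /=.
rewrite [RHS](reindex (fun c => u j + c)) //.
by exists (fun c => c - u j) => c _; rewrite ?addKr ?subrKC // addrC ?addKr // addrC subrK.
Qed.

Lemma telescope2 (g : nat -> 'F_2) m : \sum_(k < m) (g k + g k.+1) = g 0%N + g m.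
Proof.
elim: m => [|m IH]; first by rewrite big_ord0 addF2.
by rewrite big_ord_recr /= IH addrA -[g 0%N + g m + g m]addrA addF2 addr0.
Qed.

Lemma sum_box_face S j (h : point -> 'F_2) : ext h -> j \in S ->
  \sum_u (h (corner S u) + h (step (corner S u) j)) =
  \sum_u (h (upd (corner S u) j 0) + h (upd (corner S u) j p)).
Proof.
move=> eh jS; rewrite (sum_fibre _ j); apply: eq_bigr => u _.
rewrite -(telescope2 (fun k => h (upd (corner S u) j k))).
by apply: eq_bigr => k _; congr (_ + _); apply: eh => i;
  rewrite /step /upd /corner !ffunE; have [ij|/negbTE ij] := eqVneq i j; rewrite ?ij ?jS ?eqxx.
Qed.

Hypothesis a0 : forall j v, v j = 0%N -> a j v = 0.
Hypothesis a1 : forall j v, v j = p -> a j v = 1.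

(** After telescoping only the far face in direction [j] contributes: there [a j] is 1 and the sum
    for [s] remains, while [a j] is 0 on the near face. On the faces in another direction [i] the
    cochain [a i] is constant and [cup s] vanishes. *)
Lemma cup_box s : uniq s ->
  \sum_u cup s [set j in s] (corner [set j in s] u) = 1.
Proof.
elim: s => [_|j s IH /= /andP[js us]].
  by rewrite /= sumr_const card_ffun !card_ord mulrn_oddF2 // oddX oddp orbT.
set S := [set j0 in j :: s].
have cS : #|S| = (size s).+1.
  by have /card_uniqP cs : uniq (j :: s); rewrite /= ?js // cardsE cs.
rewrite (eq_bigr _ (fun u _ => cup_cons _ _ cS)) exchange_big /=.
pose h i v := a j v * cup s (S :\ i) v.
have eh i : ext (h i).
  by move=> v w vw; rewrite /h (a_ext j vw) (cup_ext _ _ vw).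
rewrite (eq_bigr (fun i => \sum_u (h i (upd (corner S u) i 0) + h i (upd (corner S u) i p)))); last first.
  by move=> i iS; rewrite -sum_box_face.
have jS : j \in S by rewrite inE mem_head.
rewrite (bigD1 j) //= [X in _ + X]big1 ?addr0 => [|i /andP[iS ij]].
  rewrite -[RHS](IH us); apply: eq_bigr => u _.
  rewrite /h a0 ?a1 ?mul0r ?mul1r ?add0r /upd ?eqxx //.
  have ->: S :\ j = [set j0 in s].
    by apply/setP => i; rewrite !inE; case: eqP => // ->; rewrite (negbTE js).
  apply: cup_ext => i; rewrite /corner !inE.
  by case: eqP => // ->; rewrite (negbTE js).
have iss : i \in s by move: iS; rewrite !inE (negbTE ij).
apply: big1 => u _; rewrite /h.
rewrite (@cup_face0 _ _ _ i i 0%N 0 iss) ?mulr0 ?add0r; first last.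
- exact: a0.
- by rewrite /upd eqxx.
- by rewrite !inE eqxx.
rewrite (@cup_face0 _ _ _ i i p 1 iss) ?mulr0 //.
- by rewrite !inE eqxx.
- by rewrite /upd eqxx.
- exact: a1.
Qed.

Lemma cup_neq0 s S v : cup s S v != 0 ->
  forall i, i \in s -> exists w1 w2 : point,
  [/\ forall j, (v j <= w1 j <= v j + (j \in S))%N, 
      forall j, (v j <= w2 j <= v j + (j \in S))%N & a i w1 != a i w2].
Proof.
elim: s S v => // k s IH S v /= nz i.
have [j jS nzj] : exists2 j, j \in S & (a k v + a k (step v j)) *
    cup s (S :\ j) (step v j) != 0.
  apply/exists_inP; apply: contraNT nz => /exists_inPn H.
  by apply/eqP/big1 => j jS; apply/eqP; move: (H j jS); rewrite negbK.
have stepP l : (v l <= step v j l <= v l + (l \in S))%N.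
  rewrite /step /upd; case: eqP => [->|_]; first by rewrite jS addn1 leqnSn leqnn.
  by rewrite leqnn leq_addr.
rewrite inE; case/predU1P => [->|si].
  exists v, (step v j); split=> // [l|]; first by rewrite leqnn leq_addr.
  by apply: contraNneq nzj => ->; rewrite addF2 mul0r.
have [|w1 [w2 [H1 H2 H]]] := IH (S :\ j) (step v j) _ i si.
  by apply: contraNneq nzj => ->; rewrite mulr0.
have bnd w : (forall l, step v j l <= w l <= step v j l + (l \in S :\ j))%N ->
    forall l, (v l <= w l <= v l + (l \in S))%N.
  move=> Hw l; have /andP[A B] := Hw l; rewrite (leq_trans _ A); last by case/andP: (stepP l).
  rewrite (leq_trans B) // /step /upd !inE.
  by case: (eqVneq l j) => [->|//]; rewrite jS addn0 addn1.
by exists w1, w2; split; [exact: bnd|exact: bnd|].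
Qed.

(** A sum equal to 1 has a nonzero term, and on such a small cube every label must take both
    values. *)
Lemma discrete_poincare_miranda : exists u : box, forall i, exists w1 w2 : point,
  [/\ forall j, (u j <= w1 j <= (u j).+1)%N, 
      forall j, (u j <= w2 j <= (u j).+1)%N & a i w1 != a i w2].
Proof.
have := cup_box (enum_uniq 'I_n); rewrite (_ : [set j in _] = setT); last first.
  by apply/setP => i; rewrite !inE mem_enum.
move=> sum1.
have [u nz] : exists u, cup (enum 'I_n) setT (corner setT u) != 0.
  apply/existsP; apply: contra_eqT sum1 => /existsPn H.
  by rewrite big1 ?(eq_sym 0) ?oner_eq0 // => u _; apply/eqP; move: (H u); rewrite negbK.
exists u => i; have [|w1 [w2 [H1 H2 H]]] := cup_neq0 nz (i := i); first by rewrite mem_enum.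
exists w1, w2; split=> // j; [have := H1 j|have := H2 j]; by rewrite /corner !inE addn1.
Qed.

End CupProduct.

From mathcomp Require Import classical_sets reals topology normedtype.
Import Defs.
Import Order.TTheory GRing.Theory Num.Theory.
Import numFieldNormedType.Exports.
Local Open Scope classical_set_scope.
Local Open Scope ring_scope.

Section InvarianceOfDomain.

Variable R : realType.

Local Notation "x $ i" := (x ord0 i) (at level 2, format "x $ i").

Section Norm.
Variable n : nat.
Implicit Types x y : 'rV[R]_n.

Lemma rV_norm_le x (e : R) : 0 <= e -> (forall i, `|x$i| <= e) -> `|x| <= e.
Proof.
by move=> e0 H; rewrite /Num.norm /= mx_normrE; apply/bigmax_leP; split=> // -[i j] _; rewrite ord1.
Qed.

Lemma rV_coord_le x i : `|x$i| <= `|x|.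
Proof.
rewrite [leRHS]/Num.norm /= mx_normrE.
exact: (le_bigmax _ (fun ij : 'I_1 * 'I_n => `|x ij.1 ij.2|) (ord0, i)).
Qed.

Lemma rV_norm_lt x (e : R) : 0 < e -> (forall i, `|x$i| < e) -> `|x| < e.
Proof.
by move=> e0 H; rewrite /Num.norm /= mx_normrE; apply/bigmax_ltP; split=> // -[i j] _; rewrite ord1.
Qed.

End Norm.

(** * The Poincare-Miranda theorem on the cube *)

Definition gridpt (e : R) N k : R := - e + 2 * e * k%:R / N.+1%:R.

Lemma gridpt_in e N k : 0 <= e -> (k <= N.+1)%N -> `|gridpt e N k| <= e.
Proof.
move=> e0 kN; rewrite /gridpt ler_norml -mulrA.
have N0 : 0 < N.+1%:R :> R by rewrite ltr0n.
have h1 : k%:R / N.+1%:R <= 1 :> R by rewrite ler_pdivrMr // mul1r ler_nat.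
have h0 : 0 <= k%:R / N.+1%:R :> R by rewrite divr_ge0.
move: (k%:R / N.+1%:R) h0 h1 => t h0 h1; apply/andP; split; nra.
Qed.

Lemma gridpt_near e N (t : R) : 0 < e -> `|t| <= e ->
  exists k : 'I_N.+2, `|t - gridpt e N k| <= 2 * e / N.+1%:R.
Proof.
move=> e0; rewrite ler_norml => /andP[t1 t2].
have N0 : 0 < N.+1%:R :> R by rewrite ltr0n.
have s0 : 0 <= (t + e) * N.+1%:R / (2 * e).
  by rewrite divr_ge0 ?mulr_ge0 //; lra.
have := truncn_itv s0; set k := Num.truncn _ => /andP[k1 k2].
have kN : (k < N.+2)%N.
  rewrite -(ltr_nat R); apply: le_lt_trans k1 _.
  rewrite ltr_pdivrMr ?mulr_gt0 // -natr1 mulrDl.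
  by apply: (@le_lt_trans _ _ (2 * e * N.+1%:R)); nra.
exists (Ordinal kN); rewrite /gridpt /=.
have e2 : 0 < 2 * e by rewrite mulr_gt0.
move: k1 k2; rewrite ler_pdivlMr // ltr_pdivrMr // -natr1 => k1 k2.
have -> : t - (- e + 2 * e * k%:R / N.+1%:R) =
    ((t + e) * N.+1%:R - k%:R * (2 * e)) / N.+1%:R.
  by field; rewrite addrC natr1 gt_eqF.
rewrite normrM [`|N.+1%:R^-1|]gtr0_norm ?invr_gt0 // ler_pM2r ?invr_gt0 //.
rewrite ler_norml; apply/andP; split; lra.
Qed.

(** An approximate form without passage to a limit: [d] and [k] are one instance of uniform
    continuity. A zero up to [k] is enough when [u] is known to stay at least [k] away from 0. *)
Lemma poincare_miranda n (u : 'rV[R]_n -> 'rV[R]_n) (k d : R) : 0 < d ->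
  (forall x y : 'rV[R]_n, `|x| <= 1 -> `|y| <= 1 -> `|x - y| < d ->
     forall i, `|(u x)$i - (u y)$i| < k) ->
  (forall (x : 'rV[R]_n) i, `|x| <= 1 -> x$i = 1 -> 0 <= (u x)$i) ->
  (forall (x : 'rV[R]_n) i, `|x| <= 1 -> x$i = -1 -> (u x)$i <= 0) ->
  exists2 x, `|x| <= 1 & forall i, `|(u x)$i| < k.
Proof.
move=> d0 uk u1 um1.
(* Even, so that [p'.+1] is odd, and large enough to bring the mesh [2 / p'.+1] below [d]. *)
pose p' := (2 * Num.truncn (2 / d))%N.
have p0 : 0 < p'.+1%:R :> R by rewrite ltr0n.
have oddp : odd p'.+1 by rewrite /= oddM.
have pR : 2 / p'.+1%:R < d.
  rewrite ltr_pdivrMr // mulrC -ltr_pdivrMr //.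
  apply: lt_le_trans (truncnS_gt _) _; rewrite ler_nat ltnS /p'.
  by rewrite mul2n -addnn leq_addr.
pose pt (v : 'I_n -> nat) : 'rV[R]_n := \row_i gridpt 1 p' (v i).
have pt_in v : (forall j, (v j <= p'.+1)%N) -> `|pt v| <= 1.
  by move=> vp; apply: rV_norm_le => // i; rewrite mxE gridpt_in.
have pt_ext v w : v =1 w -> pt v = pt w by move=> vw; apply/rowP => i; rewrite !mxE vw.
have pt_near v w : (forall j, (v j <= w j <= (v j).+1)%N) -> `|pt v - pt w| < d.
  move=> vw; apply: rV_norm_lt => // i; rewrite !mxE /gridpt; apply: le_lt_trans pR.
  have -> : - 1 + 2 * 1 * (v i)%:R / p'.+1%:R - (- 1 + 2 * 1 * (w i)%:R / p'.+1%:R) =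
     ((v i)%:R - (w i)%:R) * (2 / p'.+1%:R) :> R by ring.
  rewrite normrM [`|2 / _|]ger0_norm ?divr_ge0 // -[leRHS]mul1r ler_wpM2r ?divr_ge0 //.
  have /andP[v1 v2] := vw i; move: v1 v2; rewrite -!(ler_nat R) -natr1 => v1 v2.
  by rewrite ler_norml; apply/andP; split; lra.
(* The label is the sign of a component, with prescribed values on the two faces: a component that
   vanishes on the near face would otherwise get the wrong label. *)
pose a (i : 'I_n) (v : 'I_n -> nat) : 'F_2 :=
  ((v i != 0) && ((v i == p'.+1) || (0 <= (u (pt v))$i)))%:R.
have [i v w vw|i v v0|i v vp|x xP] := @discrete_poincare_miranda n a _ p' oddp.
- by rewrite /a (pt_ext _ _ vw) vw.
- by rewrite /a v0.
- by rewrite /a vp eqxx.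
pose v j := x j : nat.
have xin : `|pt v| <= 1 by apply: pt_in => j; apply/ltnW/ltn_ord.
exists (pt v) => // i; have [w1 [w2 [w1P w2P aw]]] := xP i.
wlog : w1 w2 w1P w2P aw / a i w1 = 0 /\ a i w2 = 1.
  move=> H; have := H w1 w2 w1P w2P aw; have := H w2 w1 w2P w1P; rewrite eq_sym => /(_ aw).
  move: aw; rewrite /a; do 2 case: (_ && _); rewrite ?eqxx //= => _ H1 H2;
  by [exact: H1|exact: H2].
have win w : (forall j, (x j <= w j <= (x j).+1)%N) -> `|pt w| <= 1.
  by move=> wP; apply: pt_in => j; case/andP: (wP j) => _ /leq_trans; apply.
move=> [aw1 aw2].
have u1le : (u (pt w1))$i <= 0.
  move: aw1; rewrite /a; case: eqP => [w0 _|_] /=.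
    by apply: um1; rewrite ?win // mxE w0 /gridpt mulr0 mul0r addr0.
  by case: (_ == _) => //=; case: leP => //= /ltW.
have u2ge : 0 <= (u (pt w2))$i.
  move: aw2; rewrite /a; case: eqP => //= _.
  case: eqP => [wp _|_] /=; last by case: leP.
  by apply: u1; rewrite ?win // mxE wp /gridpt; field; rewrite addrC natr1 gt_eqF.
have := uk _ _ xin (win _ w1P) (pt_near _ _ w1P) i.
have := uk _ _ xin (win _ w2P) (pt_near _ _ w2P) i.
by rewrite !ltr_norml => /andP[? ?] /andP[? ?]; apply/andP; split; lra.
Qed.

(** Wherever [g x >= e], [f] is bounded below by a positive number near [x]; compactness makes the
    bound uniform. Uniform continuity of a map, that of its inverse and the distance to an omitted
    point are all of this form. *)
Lemma compact_modulus (X : topologicalType) (K : set X) (f g : X -> R) :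
  compact K -> {within K, continuous f} -> {within K, continuous g} ->
  (forall z, K z -> f z <= 0 -> g z <= 0) ->
  forall e : R, 0 < e -> exists2 d : R, 0 < d & forall z, K z -> f z < d -> g z < e.
Proof.
move=> cK cf cg fg e e0.
have H : forall x, K x -> \forall x' \near x & i \near 0^'+, K x' -> f x' < i -> g x' < e.
  move=> x Kx; have [gx|gx] := ltP (g x) e.
    exists ([set z | K z -> g z < e], setT); last by move=> [z i] /= [+ _] Kz _; apply.
    split; last exact: filterT.
    have /subspace_continuousP/(_ x Kx)/(_ [set y | y < e]) := cg.
    by apply; exact: lt_nbhsl.
  have fx : 0 < f x by rewrite ltNge; apply/negP => /(fg _ Kx); rewrite leNgt (lt_le_trans e0 gx).
  exists ([set z | K z -> f x / 2 < f z], [set i | i < f x / 2]).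
    split; last by apply: nbhs_right_lt; rewrite divr_gt0.
    have /subspace_continuousP/(_ x Kx)/(_ [set y | f x / 2 < y]) := cf.
    by apply; apply: lt_nbhsr; rewrite ltr_pdivrMr ?ltr0n // mulr_natr mulr2n ltrDl.
  by move=> [z i] /= [Hz Hi] Kz fzi; have := Hz Kz; lra.
have {}H := (compact_near_coveringP K).1 cK R 0^'+ (fun d z => K z -> f z < d -> g z < e) (at_right_proper_filter 0) H.
have [d [d0 Hd]] := filter_ex (filterI (nbhs_right_gt (0 : R)) H).
by exists d => // z Kz; exact: Hd.
Qed.

(** * Uniform estimates for an injective map of the cube *)

Section Cube.
Variable n : nat.
Local Notation V := 'rV[R]_n.
Local Notation B := [set x : V | `|x| <= 1].

Lemma cube_compact : compact B.
Proof.
apply: bounded_closed_compact.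
  by exists 1; split=> // M M1 x /= /le_trans; apply; exact: ltW.
have -> : B = (fun x : V => `|x|) @^-1` [set y | y <= 1] by [].
apply: preimage_closed; last exact: closed_le.
by move=> x _; apply: norm_continuous.
Qed.

Variable f : V -> V.
Hypothesis f_cont : {within B, continuous f}.
Hypothesis f_inj : forall x y, `|x| <= 1 -> `|y| <= 1 -> f x = f y -> x = y.

Local Notation BB := (B `*` B).

Let compactBB : compact BB.
Proof. by apply: compact_setX; exact: cube_compact. Qed.

Let dist_cont (h : V -> V) : {within B, continuous h} ->
  {within BB, continuous (fun z => `|h z.1 - h z.2|)}.
Proof.
move=> /subspace_continuousP ch; apply/subspace_continuousP => -[x y] [/= Bx By].
apply: cvg_norm; apply: cvgB.
- apply: cvg_trans (ch x Bx); rewrite [X in X `=>` _]fmap_comp; apply: cvg_app.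
  move=> A wA; have : nbhs (x, y) (fst @^-1` (fun z => B z -> A z)).
    exists ((fun z => B z -> A z), setT); first by split; [exact: wA|exact: filterT].
    by move=> [a b] [].
  by apply: filterS => -[a b] /= H [] /H.
- apply: cvg_trans (ch y By); rewrite [X in X `=>` _]fmap_comp; apply: cvg_app.
  move=> A wA; have : nbhs (x, y) (snd @^-1` (fun z => B z -> A z)).
    exists (setT, (fun z => B z -> A z)); first by split; [exact: filterT|exact: wA].
    by move=> [a b] [].
  by apply: filterS => -[a b] /= H [] _ /H.
Qed.

Let id_cont : {within B, continuous (@id V)}.
Proof. by apply: continuous_subspaceT => x; exact: cvg_id. Qed.

Lemma cube_uniform (e : R) : 0 < e -> exists2 d : R, 0 < d &
  forall x y, `|x| <= 1 -> `|y| <= 1 -> `|x - y| < d -> `|f x - f y| < e.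
Proof.
move=> e0; have [|d d0 H] := compact_modulus compactBB (dist_cont id_cont) (dist_cont f_cont) _ e0.
  by move=> [x y] _ /=; rewrite normr_le0 subr_eq0 => /eqP->; rewrite subrr normr0.
by exists d => // x y Bx By xy; apply: (H (x, y)).
Qed.

Lemma cube_inverse_uniform (e : R) : 0 < e -> exists2 d : R, 0 < d &
  forall x y, `|x| <= 1 -> `|y| <= 1 -> `|f x - f y| < d -> `|x - y| < e.
Proof.
move=> e0; have [|d d0 H] := compact_modulus compactBB (dist_cont f_cont) (dist_cont id_cont) _ e0.
  move=> [x y] [/= Bx By]; rewrite normr_le0 subr_eq0 => /eqP/(f_inj Bx By)->.
  by rewrite subrr normr0.
by exists d => // x y Bx By xy; apply: (H (x, y)).
Qed.

Lemma cube_avoid c : (forall x, `|x| <= 1 -> f x <> c) ->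
  exists2 d : R, 0 < d & forall x, `|x| <= 1 -> d <= `|f x - c|.
Proof.
move=> fc; have cf : {within B, continuous (fun x => `|f x - c|)}.
  apply/subspace_continuousP => x Bx; apply: cvg_norm; apply: cvgB; last exact: cvg_cst.
  by move/subspace_continuousP: f_cont; apply.
have c1 : {within B, continuous (fun=> 1 : R)}.
  by apply/subspace_continuousP => x Bx; exact: cvg_cst.
have [|d d0 H] := compact_modulus cube_compact cf c1 _ ltr01.
  by move=> x Bx; rewrite normr_le0 subr_eq0 => /eqP/(fc _ Bx).
by exists d => // x Bx; rewrite leNgt; apply/negP => /(H x Bx); rewrite ltxx.
Qed.

End Cube.

Lemma finite_min (I : finType) (i0 : I) (F : I -> R) :
  exists2 i, True & forall j, F i <= F j.
Proof.
by case: (Order.TotalTheory.arg_minP F (P := xpredT) (i0 := i0)) => // i _ H; exists i => // j; apply: H.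
Qed.

(** * Lipschitz maps: an approximate inverse, and the image of a sphere *)

Section Cube.
Variable n : nat.
Local Notation V := 'rV[R]_n.
Local Notation B := [set x : V | `|x| <= 1].

Variable f : V -> V.
Hypothesis f_cont : {within B, continuous f}.
Hypothesis f_inj : forall x y, `|x| <= 1 -> `|y| <= 1 -> f x = f y -> x = y.

Lemma cube_net (e : R) : 0 < e -> exists (I : finType) (h0 : I) (pt : I -> V),
  (forall h, `|pt h| <= 1) /\ (forall x : V, `|x| <= 1 -> exists h, `|x - pt h| < e).
Proof.
move=> e0; pose N := Num.truncn (2 / e); exists {ffun 'I_n -> 'I_N.+2}, [ffun=> ord0], (fun h : {ffun 'I_n -> 'I_N.+2} => \row_i gridpt 1 N (h i)).
have NR : 2 * 1 / N.+1%:R < e.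
  rewrite mulr1 ltr_pdivrMr ?ltr0n // mulrC -ltr_pdivrMr //; exact: truncnS_gt.
split=> [h|x x1]; first by apply: rV_norm_le => // i; rewrite mxE gridpt_in // -ltnS ltn_ord.
have H i : exists k : 'I_N.+2, `|x$i - gridpt 1 N k| <= 2 * 1 / N.+1%:R.
  by apply: gridpt_near => //; apply: le_trans x1; exact: rV_coord_le.
have [h hP] := choice H.
exists [ffun i => h i]; apply: rV_norm_lt => // i; rewrite !mxE ffunE.
exact: le_lt_trans (hP i) NR.
Qed.

(** McShane's extension formula over a finite net, coordinate by coordinate: a minimum of functions
    that are [L]-Lipschitz in [y]. It replaces both the extension of the inverse beyond the image
    and its smoothing. With [L = 2 / r], a net point whose image is at distance [r] or more adds at
    least 2, the side of the cube, and cannot undercut [x]; the others are within [e / 2] of [x]. *)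
Lemma lipschitz_inverse (e : R) : 0 < e -> exists2 L : R, 0 < L &
  exists P : V -> V, (forall y y' i, `|(P y)$i - (P y')$i| <= L * `|y - y'|) /\
    forall x, `|x| <= 1 -> forall i, `|(P (f x))$i - x$i| <= e.
Proof.
move=> e0; have e2 : 0 < e / 2 by rewrite divr_gt0.
have [r r0 rP] := cube_inverse_uniform f_cont f_inj e2.
pose L := 2 / r; have L0 : 0 < L by rewrite divr_gt0.
pose t := Num.min r (e / 2 / L).
have t0 : 0 < t by rewrite lt_min r0 divr_gt0.
have tr : t <= r by rewrite ge_min lexx.
have tL : L * t <= e / 2 by rewrite mulrC -ler_pdivlMr // ge_min lexx orbT.
have [d d0 dP] := cube_uniform f_cont t0.
have [I [h0 [pt [pt1 ptd]]]] := cube_net d0.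
pose F y i h := (pt h)$i + L * `|y - f (pt h)|.
have H y i : exists h, forall h', F y i h <= F y i h'.
  by have [h _ hP] := finite_min h0 (F y i); exists h.
have {H}/choice[P PP] : forall y, exists P : V, forall i,
    (exists h, P$i = F y i h) /\ forall h, P$i <= F y i h.
  move=> y; have [h hP] := choice (H y); exists (\row_i F y i (h i)) => i.
  by rewrite mxE; split; [exists (h i)|exact: hP].
exists L => //; exists P; split.
  have H y y' i : (P y)$i <= (P y')$i + L * `|y - y'|.
    have [[h ->] _] := PP y' i; have [_ /(_ h) /le_trans] := PP y i; apply.
    rewrite /F -addrA lerD2l -mulrDr ler_pM2l //.
    have {1}-> : y - f (pt h) = (y' - f (pt h)) + (y - y') by rewrite [RHS]addrC addrA subrK.
    exact: ler_normD.
  move=> y y' i; rewrite ler_norml; have := H y y' i; have := H y' y i.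
  by rewrite [`|y' - y|]distrC => ? ?; apply/andP; split; lra.
move=> x x1 i; have [[h Ph] Pmin] := PP (f x) i.
have [h' /(dP _ _ x1 (pt1 h')) fxh'] := ptd x x1.
have xh' : `|x - pt h'| < e / 2 by apply: rP => //; apply: lt_le_trans tr.
have := le_lt_trans (rV_coord_le _ i) xh'; rewrite !mxE ltr_norml => /andP[? ?].
have := Pmin h'; rewrite /F => up.
have Lf : L * `|f x - f (pt h')| <= e / 2.
  by apply: le_trans tL; rewrite ler_pM2l // ltW.
suff lo : x$i - e / 2 <= (P (f x))$i by rewrite ler_norml; apply/andP; split; lra.
rewrite Ph /F; have [close|far] := ltP `|f x - f (pt h)| r.
  have := le_lt_trans (rV_coord_le _ i) (rP _ _ x1 (pt1 h) close).
  have : 0 <= L * `|f x - f (pt h)| by rewrite mulr_ge0 // ltW.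
  by rewrite !mxE ltr_norml => ? /andP[? ?]; lra.
have : 2 <= L * `|f x - f (pt h)|.
  by rewrite -(ler_pM2l L0) in far; apply: le_trans far; rewrite /L divfK ?gt_eqF.
have := le_trans (rV_coord_le _ i) x1; have := le_trans (rV_coord_le _ i) (pt1 h).
by rewrite !ler_norml => /andP[? ?] /andP[? ?] ?; lra.
Qed.

End Cube.

(* A Lipschitz image of a sphere, which has dimension [n - 1], misses a point
   of every cube: a grid of mesh [1/M] has [O(M ^ (n - 1))] points on the sphere
   but [M ^ n] points in the cube. *)
Lemma lipschitz_sphere_avoid n (w : 'rV[R]_n -> 'rV[R]_n) (L e d : R) :
  0 < L -> 0 < e -> 0 < d ->
  (forall y y' i, `|(w y)$i - (w y')$i| <= L * `|y - y'|) ->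
  exists2 c : 'rV[R]_n, (forall i, `|c$i| <= d) &
    exists2 k : R, 0 < k & forall y, `|y| = e -> exists i, k <= `|(w y)$i - c$i|.
Proof.
move=> L0 e0 d0 wL; case: n w wL => [|m] w wL.
  exists 0; first by case.
  by exists 1 => // y ye; exfalso; move: e0; rewrite -ye (thinmx0 y) normr0 ltxx.
(* The grid of the cube has spacing [2 * d / M.+1]. The choice of [q] keeps the error from the grid
   of the sphere below a quarter of it, and [k] is another quarter, so different points of the cube
   need different points of the sphere. [M] is such that the sphere has at most [M * M.+1 ^ m] of
   them. *)
pose q := (Num.truncn (4 * L * e / d)).+1.
have qP : 4 * L * e / d < q%:R by exact: truncnS_gt.
pose M := (2 * m.+1 * q.+1 ^ m)%N.
pose N' := (q * M.+1).-1.
have NE : N'.+1 = (q * M.+1)%N by rewrite prednK // muln_gt0.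
pose k : R := d / M.+1%:R / 2.
have M0 : 0 < M.+1%:R :> R by rewrite ltr0n.
have k0 : 0 < k by rewrite !divr_gt0.
pose c (h : {ffun 'I_m.+1 -> 'I_M.+1}) : 'rV[R]_m.+1 := \row_i gridpt d M (h i).
have c_le h i : `|(c h)$i| <= d by rewrite mxE gridpt_in ?(ltW d0) //; apply: ltnW.
have [[h hP]|bad] :=
  pselect (exists h, forall y, `|y| = e -> exists i, k <= `|(w y)$i - (c h)$i|).
  by exists (c h) => //; exists k.
exfalso.
(* In the maximum norm the sphere is the surface of a cube: a direction, a sign, and a grid point in
   the other [m] coordinates. *)
pose s (ibg : 'I_m.+1 * bool * {ffun 'I_m -> 'I_N'.+2}) : 'rV[R]_m.+1 :=
  \row_j if unlift ibg.1.1 j is Some j' then gridpt e N' (ibg.2 j')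
         else (-1) ^+ ibg.1.2 * e.
have sP (y : 'rV[R]_m.+1) : `|y| = e -> exists g, `|y - s g| <= 2 * e / N'.+1%:R.
  move=> ye; have [i yi] : exists i, `|y$i| = e.
    apply/not_existsP => H; have : `|y| < e; last by rewrite ye ltxx.
    apply: rV_norm_lt => // i; rewrite lt_neqAle -[X in _ <= X]ye rV_coord_le andbT.
    exact/eqP/H.
  have H j : exists k : 'I_N'.+2, `|y$(lift i j) - gridpt e N' k| <= 2 * e / N'.+1%:R.
    by apply: gridpt_near => //; rewrite -ye; exact: rV_coord_le.
  have [g gP] := choice H.
  exists (i, y$i < 0, [ffun j => g j]); apply: rV_norm_le.
    by rewrite !divr_ge0 ?mulr_ge0 // ltW.
  move=> j; rewrite !mxE /=; case: unliftP => [j' ->|->]; first by rewrite ffunE.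
  by rewrite -yi -numEsign subrr normr0 divr_ge0 // mulr_ge0.
have badP h : exists g, forall i, `|(w (s g))$i - (c h)$i| < k + L * (2 * e / N'.+1%:R).
  have [y [ye yc]] : exists y, `|y| = e /\ forall i, `|(w y)$i - (c h)$i| < k.
    apply/not_existsP => H; apply: bad; exists h => y ye.
    apply/not_existsP => H'; apply: (H y); split=> // i.
    by rewrite ltNge; apply/negP; exact: H'.
  have [g gP] := sP y ye; exists g => i.
  have -> : (w (s g))$i - (c h)$i = ((w y)$i - (c h)$i) - ((w y)$i - (w (s g))$i) by ring.
  apply: le_lt_trans (ler_normB _ _) _; apply: ltr_leD (yc i) _.
  by apply: le_trans (wL _ _ _) _; rewrite ler_pM2l.
have [g gP] := choice badP.
have near : 2 * (k + L * (2 * e / N'.+1%:R)) <= 2 * d / M.+1%:R.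
  have -> : 2 * (k + L * (2 * e / N'.+1%:R)) = d / M.+1%:R + (4 * L * e / q%:R) / M.+1%:R.
    rewrite /k NE natrM; field.
    by rewrite !(addrC 1) !natr1 !gt_eqF // ltr0n.
  rewrite -mulrDl ler_pM2r ?invr_gt0 //.
  have : 4 * L * e / q%:R <= d by move: qP; rewrite ltr_pdivrMr // => qP; rewrite ler_pdivrMr ?ltr0n // [leRHS]mulrC ltW.
  lra.
have g_inj : injective g.
  move=> h h' gh; apply/ffunP => i; apply/eqP/contraT => hh'.
  have := gP h i; have := gP h' i; rewrite gh !mxE => H1 H2.
  have : `|gridpt d M (h i) - gridpt d M (h' i)| < 2 * d / M.+1%:R.
    move: (k + L * _) near H1 H2 => K near H1 H2; apply: lt_le_trans near; move: H1 H2. 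
    move: (gridpt d M (h i)) (gridpt d M (h' i)) (_$i) => a b t.
    by rewrite !ltr_norml => /andP[? ?] /andP[? ?]; apply/andP; split; lra.
  have -> : gridpt d M (h i) - gridpt d M (h' i) =
      (2 * d / M.+1%:R) * ((h i)%:R - (h' i)%:R) by rewrite /gridpt; ring.
  rewrite normrM gtr0_norm ?divr_gt0 ?mulr_gt0 // gtr_pMr ?divr_gt0 ?mulr_gt0 //.
  move: hh'; rewrite -(inj_eq val_inj) /= neq_ltn => /orP[] lt_hh';
    rewrite -(ler_nat R) -natr1 in lt_hh'.
    by rewrite ltr_norml => /andP[? ?]; lra.
  by rewrite ltr_norml => /andP[? ?]; lra.
have := leq_card _ g_inj.
rewrite !card_prod !card_ffun !card_ord card_bool leqNgt => /negP; apply.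
have N1 : (N'.+2 <= q.+1 * M.+1)%N by rewrite NE mulSn addSn ltnS leq_addl.
apply: (@leq_ltn_trans (m.+1 * 2 * (q.+1 ^ m * M.+1 ^ m))).
  by rewrite leq_pmul2l // -expnMn; case: (m) => // m'; rewrite leq_exp2r.
by rewrite mulnA expnS ltn_pmul2r ?expn_gt0 // ltnS /M (mulnC m.+1).
Qed.

(** * Radial projection, clamping and Kulpa's argument *)

Lemma radial_lipschitz n (e m : R) (y z : 'rV[R]_n) : 0 < e -> 0 < m ->
  m <= `|y| -> m <= `|z| ->
  `|(e / `|y|) *: y - (e / `|z|) *: z| <= 2 * e / m * `|y - z|.
Proof.
move=> e0 m0 my mz.
have y0 : 0 < `|y| by apply: lt_le_trans my.
have z0 : 0 < `|z| by apply: lt_le_trans mz.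
have -> : (e / `|y|) *: y - (e / `|z|) *: z =
    (e / `|z|) *: ((`|z| - `|y|) / `|y| *: y + (y - z)).
  rewrite scalerDr scalerA scalerBr addrA -scalerDl; congr (_ *: _ - _).
  by field; rewrite !gt_eqF.
rewrite normrZ gtr0_norm ?divr_gt0 //.
have le2 : `|(`|z| - `|y|) / `|y| *: y + (y - z)| <= 2 * `|y - z|.
  apply: le_trans (ler_normD _ _) _; rewrite mulr_natl mulr2n lerD2r.
  rewrite normrZ normrM normfV normr_id divfK ?gt_eqF // distrC.
  exact: ler_dist_dist.
have -> : 2 * e / m * `|y - z| = (e / m) * (2 * `|y - z|) by ring.
apply: ler_pM => //; first by rewrite divr_ge0 ?ltW.
by rewrite ler_pM2l // lef_pV2 // posrE.
Qed.

Definition clamp (r t : R) := Num.max (- r) (Num.min r t).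

Lemma clamp_lipschitz r s t : `|clamp r s - clamp r t| <= `|s - t|.
Proof.
have max_lip (a b c : R) : `|Num.max a b - Num.max a c| <= `|b - c|.
  have bc : b - c <= `|b - c| by exact: ler_norm.
  have cb : c - b <= `|b - c| by rewrite distrC ler_norm.
  by case: (leP a b) => ?; case: (leP a c) => ?; rewrite ler_norml; apply/andP; split; lra.
apply: le_trans (max_lip _ _ _) _.
have bc : s - t <= `|s - t| by exact: ler_norm.
have cb : t - s <= `|s - t| by rewrite distrC ler_norm.
by case: (leP r s) => ?; case: (leP r t) => ?; rewrite ler_norml; apply/andP; split; lra.
Qed.

Lemma clamp_le r t : 0 <= r -> `|clamp r t| <= r.
Proof.
move=> r0; rewrite ler_norml /clamp le_max lexx /= ge_max ge_min lexx andbT.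
by rewrite (le_trans _ r0) // oppr_le0.
Qed.

Lemma clamp_id r t : `|t| <= r -> clamp r t = t.
Proof. by rewrite ler_norml => /andP[rt tr]; rewrite /clamp min_r // max_r. Qed.

(* Kulpa's argument.  If [f 0] were not interior to the image, one could move it
   slightly off the image to [c].  Then [u] below, an approximation of the
   identity obtained from an approximate inverse of [f], has no zero, which
   contradicts the Poincare-Miranda theorem. *)
Theorem invariance_of_domain n (f : 'rV[R]_n -> 'rV[R]_n) :
  {within [set x | `|x| <= 1], continuous f} ->
  (forall x y, `|x| <= 1 -> `|y| <= 1 -> f x = f y -> x = y) ->
  exists2 e : R, 0 < e &
    forall c, `|c - f 0| < e -> exists2 x, `|x| <= 1 & f x = c.
Proof.
move=> f_cont f_inj.
have tenth : 0 < 10^-1 :> R by rewrite invr_gt0.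
have in0 : `|0 : 'rV[R]_n| <= 1 by rewrite normr0.
have [r1 r10 r1P] := cube_inverse_uniform f_cont f_inj tenth.
(* If [c] is within [e] of [f 0], an image within [e] of [c] is within [r1] of [f 0], so its
   preimage is shorter than [1/10]. *)
pose e := r1 / 2; have e0 : 0 < e by rewrite divr_gt0.
exists e => // c cf0; apply: contrapT => cN.
have {cN} cN x : `|x| <= 1 -> f x <> c by move=> x1 fx; apply: cN; exists x.
have [mu mu0 muP] := cube_avoid f_cont cN.
pose g (x : 'rV[R]_n) : 'rV[R]_n := f x - c.
have gB x y : g x - g y = f x - f y by rewrite /g opprB addrA subrK.
have small x : `|x| <= 1 -> `|g x| <= e -> `|x| < 10^-1.
  move=> x1 gx; rewrite -[x]subr0; apply: r1P => //.
  have -> : f x - f 0 = g x + (c - f 0) by rewrite /g addrA subrK.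
  apply: le_lt_trans (ler_normD _ _) _; rewrite (splitr r1).
  exact: ler_ltD.
have [d1 d10 d1P] : exists2 d1 : R, 0 < d1 & forall x, `|x| <= 1 -> `|x| < d1 -> `|g x| < e.
  have [|d1 d10 d1P] := cube_uniform f_cont (e := e - `|c - f 0|); first by rewrite subr_gt0.
  exists d1 => // x x1 xd1; have := d1P x 0 x1 in0; rewrite subr0 => /(_ xd1) fx.
  have -> : g x = (f x - f 0) - (c - f 0) by rewrite opprB addrA subrK.
  by apply: le_lt_trans (ler_normB _ _) _; rewrite -ltrBrDr.
(* Where [g] has norm at least [e], some coordinate of [x] is at least [4 * d]. The error of [Q] and
   the shift by [s] cost [d] each and leave [2 * d]. *)
pose d := Num.min (d1 / 4) 10^-1.
have d0 : 0 < d by rewrite lt_min divr_gt0.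
have d_tenth : d <= 10^-1 by rewrite ge_min lexx orbT.
have dd1 : 4 * d <= d1 by rewrite mulrC -ler_pdivlMr // ge_min lexx.
have big x : `|x| <= 1 -> e <= `|g x| -> exists i, 4 * d <= `|x$i|.
  move=> x1 gx; apply/not_existsP => H.
  have xd1 : `|x| < d1.
    apply: rV_norm_lt => // i; apply: lt_le_trans dd1.
    by rewrite ltNge; apply/negP/H.
  by have := d1P x x1 xd1; rewrite ltNge gx.
have [L L0 [P [PL Pf]]] := lipschitz_inverse f_cont f_inj d0.
pose Q (y : 'rV[R]_n) := P (y + c).
have QL y y' i : `|(Q y)$i - (Q y')$i| <= L * `|y - y'|.
  by apply: le_trans (PL _ _ _) _; rewrite opprD addrACA subrr addr0.
have Qg x : `|x| <= 1 -> forall i, `|(Q (g x))$i - x$i| <= d.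
  by move=> x1 i; rewrite /Q /g subrK Pf.
(* The clamp keeps [w] bounded on the whole sphere, including points off the image of [g]. It does
   not change [Q] where [g] has norm at most [e]: there [x] is below [1/10] and [Q] errs by at most
   [1/10]. *)
pose w (y : 'rV[R]_n) : 'rV[R]_n := \row_i clamp 5^-1 (Q y)$i.
have wL y y' i : `|(w y)$i - (w y')$i| <= L * `|y - y'|.
  by rewrite !mxE; apply: le_trans (clamp_lipschitz _ _ _) (QL _ _ _).
have w_le y i : `|(w y)$i| <= 5^-1 by rewrite mxE clamp_le // invr_ge0.
have wg x : `|x| <= 1 -> `|g x| <= e -> w (g x) = Q (g x).
  move=> x1 gx; apply/rowP => i; rewrite mxE clamp_id //.
  have := Qg x x1 i; have := le_lt_trans (rV_coord_le x i) (small x x1 gx).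
  rewrite ltr_norml !ler_norml => /andP[? ?] /andP[? ?]; apply/andP; split; lra.
have [s s_le [k k0 sk]] := lipschitz_sphere_avoid L0 e0 d0 wL.
pose phi (y : 'rV[R]_n) : 'rV[R]_n := (e / `|y|) *: y.
(* Outside the ball the approximate inverse is bounded away from [s]. Inside, it is replaced by
   values of [w] on the sphere, whose image misses [s]. On the sphere the two agree by [wg]. *)
pose u (x : 'rV[R]_n) := if e <= `|g x| then Q (g x) - s else w (phi (g x)) - s.
have u_near x i : `|x| <= 1 -> `|(u x)$i - x$i| <= 1.
  move=> x1; have := s_le i; rewrite /u; case: ifPn => [_|gx].
    have := Qg x x1 i; rewrite !mxE !ler_norml => /andP[? ?] /andP[? ?].
    by apply/andP; split; lra.
  have gxe : `|g x| <= e by apply: ltW; rewrite ltNge.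
  have := w_le (phi (g x)) i; have := le_lt_trans (rV_coord_le x i) (small x x1 gxe).
  rewrite !mxE ltr_norml !ler_norml => /andP[? ?] /andP[? ?] /andP[? ?].
  by apply/andP; split; lra.
have u_far x : `|x| <= 1 -> exists i, Num.min k (2 * d) <= `|(u x)$i|.
  move=> x1; rewrite /u; case: ifPn => [gx|gx].
    have [i xi] := big x x1 gx; exists i; rewrite ge_min; apply/orP; right.
    have := Qg x x1 i; have := s_le i; rewrite !mxE !ler_norml => /andP[? ?] /andP[? ?].
    move: xi; rewrite ler_normr => /orP[] ?.
      by apply: le_trans (ler_norm _); lra.
    by rewrite -normrN; apply: le_trans (ler_norm _); lra.
  have gx0 : 0 < `|g x| by apply: lt_le_trans mu0 (muP x x1).
  have [|i ki] := sk (phi (g x)); last by exists i; rewrite !mxE ge_min in ki *; rewrite ki.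
  by rewrite /phi normrZ gtr0_norm ?divr_gt0 // divfK // gt_eqF.
(* The summand [2 * L] pays for passing from one formula to the other; the second one pays for the
   radial projection, which is Lipschitz because [g] stays at distance [mu] from 0. *)
pose K := L * (2 + 2 * e / mu).
have K0 : 0 < K by rewrite mulr_gt0 // addr_gt0 // divr_gt0 // mulr_gt0.
have u_lip x y i : `|x| <= 1 -> `|y| <= 1 -> `|(u x)$i - (u y)$i| <= K * `|f x - f y|.
  wlog gxy : x y / `|g y| <= `|g x|.
    by move=> H x1 y1; case: (leP `|g y| `|g x|) => [/H|/ltW/H]; [apply|
      rewrite distrC [`|f x - f y|]distrC; apply].
  move=> x1 y1; rewrite -gB /K mulrDr mulrDl.
  have t1 : 0 <= L * (2 * e / mu) * `|g x - g y| by rewrite mulr_ge0 // mulr_ge0 ?(ltW L0) // ltW // divr_gt0 // mulr_gt0.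
  have t2 : 0 <= L * `|g x - g y| by rewrite mulr_ge0 // ltW.
  have subs (a b a' : 'rV[R]_n) : (a - a')$i - (b - a')$i = a$i - b$i by rewrite !mxE; ring.
  rewrite /u; case: ifPn => [gx|gx]; last rewrite ifN.
  - case: ifPn => [gy|gy]; rewrite subs.
      by have := QL (g x) (g y) i; lra.
    have gye : `|g y| <= e by apply: ltW; rewrite ltNge.
    have gy0 : 0 < `|g y| by apply: lt_le_trans mu0 (muP y y1).
    have -> : (Q (g x))$i - (w (phi (g y)))$i =
      ((Q (g x))$i - (Q (g y))$i) - ((w (phi (g y)))$i - (w (g y))$i).
      by rewrite wg //; ring.
    apply: le_trans (ler_normB _ _) _.
    (* The sphere separates [g y] from [g x], so pushing [g y] out to it costs no more than their
       distance. *)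
    have : `|phi (g y) - g y| <= `|g x - g y|.
      have -> : phi (g y) - g y = (e / `|g y| - 1) *: g y by rewrite scalerBl scale1r.
      rewrite normrZ ger0_norm; last by rewrite subr_ge0 ler_pdivlMr // mul1r.
      rewrite mulrBl mul1r divfK ?gt_eqF //; apply: le_trans (ler_dist_dist _ _).
      by apply: le_trans (ler_norm _); rewrite lerD2r.
    rewrite -(ler_pM2l L0) => ?; have := QL (g x) (g y) i; have := wL (phi (g y)) (g y) i.
    lra.
  - rewrite subs; apply: le_trans (wL _ _ _) _.
    have := radial_lipschitz e0 mu0 (muP x x1) (muP y y1).
    by rewrite -(ler_pM2l L0) mulrA => ?; rewrite /phi; lra.
  - by rewrite -ltNge; apply: le_lt_trans gxy _; rewrite ltNge.
have k'0 : 0 < Num.min k (2 * d) by rewrite lt_min k0 mulr_gt0.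
have [t t0 tP] := cube_uniform f_cont (divr_gt0 k'0 K0).
have [|||x x1 xP] := @poincare_miranda n u (Num.min k (2 * d)) t t0.
- move=> x y x1 y1 xy i; apply: le_lt_trans (u_lip x y i x1 y1) _.
  by rewrite mulrC -ltr_pdivlMr // tP.
- by move=> x i x1 xi; have := u_near x i x1; rewrite xi ler_norml => /andP[? ?]; lra.
- by move=> x i x1 xi; have := u_near x i x1; rewrite xi ler_norml => /andP[? ?]; lra.
by have [i] := u_far x x1; rewrite leNgt xP.
Qed.

End InvarianceOfDomain.

(** * Cofacets in a triangulated manifold *)

Section Stars.

Variable R : realType.

Local Notation "x $ i" := (x ord0 i) (at level 2, format "x $ i").

Lemma row_cvg (S : topologicalType) (F : set_system S) (FF : Filter F) m
    (f : S -> 'rV[R]_m) (l : 'rV[R]_m) :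
  (forall i, (fun y => (f y)$i) @ F --> l$i) -> f @ F --> l.
Proof.
move=> H; apply/cvgrPdist_lt => e e0.
have {}H : \forall y \near F, forall i : 'I_m, `|l$i - (f y)$i| < e.
  by apply: filter_forall => i; have /cvgrPdist_lt := H i; apply.
by apply: filterS H => y H; apply: rV_norm_lt => // i; rewrite !mxE.
Qed.

Lemma nbhs_cball m (x : 'rV[R]_m) (A : set 'rV[R]_m) : nbhs x A ->
  exists2 r : R, 0 < r & forall y, `|y - x| <= r -> A y.
Proof.
move=> /nbhs_ballP[e /= e0 eA]; exists (e / 2); first by rewrite divr_gt0.
move=> y yx; apply: eA; rewrite -ball_normE /= distrC; apply: le_lt_trans yx _.
by rewrite ltr_pdivrMr ?ltr0n // mulr_natr mulr2n ltrDl.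
Qed.

Lemma affine_continuous n (r : R) (p : 'rV[R]_n) :
  continuous (fun y : 'rV[R]_n => r *: y + p).
Proof.
move=> x; have FF := @nbhs_filter 'rV[R]_n x.
apply: row_cvg => i; under eq_fun do rewrite !mxE; rewrite !mxE.
apply: cvgD; last exact: cvg_cst.
by apply: cvgMl_tmp; exact: coord_continuous.
Qed.

Lemma invariance_of_domain_at n (f : 'rV[R]_n -> 'rV[R]_n) p r : 0 < r ->
  {within [set x | `|x - p| <= r], continuous f} ->
  (forall x y, `|x - p| <= r -> `|y - p| <= r -> f x = f y -> x = y) ->
  exists2 e : R, 0 < e &
    forall c, `|c - f p| < e -> exists2 x, `|x - p| <= r & f x = c.
Proof.
move=> r0 fc fi; pose s (x : 'rV[R]_n) : 'rV[R]_n := r *: x + p.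
have sP x : `|x| <= 1 -> `|s x - p| <= r.
  by move=> x1; rewrite addrK normrZ gtr0_norm // -[leRHS]mulr1 ler_pM2l.
have [||e e0 eP] := @invariance_of_domain R n (f \o s).
- apply/subspace_continuousP => x /= x1.
  have /subspace_continuousP/(_ _ (sP x x1)) fsx := fc.
  apply: cvg_trans fsx; rewrite [X in X `=>` _]fmap_comp; apply: cvg_app => A wA.
  have sc := @affine_continuous n r p x.
  have {}sc : nbhs x [set y | `|s y - p| <= r -> A (s y)] by exact: (sc _ wA).
  have FF := @nbhs_filter 'rV[R]_n x.
  by apply: filterS sc => y /= Ay y1; apply/Ay/sP.
- move=> x y x1 y1 /(fi _ _ (sP x x1) (sP y y1)) /addIr /(congr1 (fun z => r^-1 *: z)).
  by rewrite !scalerA mulVf ?gt_eqF // !scale1r.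
exists e => // c ce; have [|x x1 xc] := eP c; first by rewrite /= /s scaler0 add0r.
by exists (s x); rewrite ?sP.
Qed.

Variable T : finType.
Local Notation X := 'rV[R]_#|T|.
Local Notation coord := (@Defs.coord R T).

Lemma coord_inj (x y : X) : (forall v, coord x v = coord y v) -> x = y.
Proof.
by move=> H; apply/rowP => j; have := H (enum_val j); rewrite /Defs.coord enum_valK.
Qed.

(** The coordinates other than [s] parametrize the hyperplane of coordinate sum 1; [s] takes what is
    left. *)
Definition fill (s : T) (w : T -> R) : X :=
  \row_j (if enum_val j == s then 1 - \sum_(v | v != s) w v else w (enum_val j)).

Lemma coord_fill s w v :
  coord (fill s w) v = if v == s then 1 - \sum_(v | v != s) w v else w v.
Proof. by rewrite /Defs.coord mxE enum_rankK. Qed.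

Lemma sum_fill s w : \sum_v coord (fill s w) v = 1.
Proof.
rewrite (bigD1 s) //= coord_fill eqxx [X in _ + X](eq_bigr w) ?subrK //.
by move=> v vs; rewrite coord_fill (negbTE vs).
Qed.

Lemma fill_coord s x : \sum_v coord x v = 1 -> fill s (coord x) = x.
Proof.
move=> x1; apply: coord_inj => v; rewrite coord_fill; case: eqP => // ->.
by rewrite -x1 (bigD1 s) //= addrK.
Qed.

Lemma eq_fill s w w' : (forall v, v != s -> w v = w' v) -> fill s w = fill s w'.
Proof.
move=> ww'; apply: coord_inj => v; rewrite !coord_fill.
by case: eqP => [_|/eqP/ww'//]; congr (1 - _); apply: eq_bigr.
Qed.

Lemma fill_cvg (S : topologicalType) (F : set_system S) (FF : Filter F) s
    (w : S -> T -> R) l :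
  (forall v, w ^~ v @ F --> l v) -> (fun y => fill s (w y)) @ F --> fill s l.
Proof.
move=> wl; apply: row_cvg => j.
under eq_fun do rewrite mxE; rewrite mxE; case: ifP => _; last exact: wl.
apply: cvgB; first exact: cvg_cst.
by apply: cvg_big => [|v _]; [exact: add_continuous|exact: wl].
Qed.

Variable K : {set {set T}}.
Hypothesis cK : simplicial_complex K.

Local Notation XK := (@realization R T K).

Definition barycenter (S : {set T}) : X :=
  \row_j (if enum_val j \in S then #|S|%:R^-1 else 0).

Lemma coord_barycenter S v :
  coord (barycenter S) v = if v \in S then #|S|%:R^-1 else 0.
Proof. by rewrite /Defs.coord mxE enum_rankK. Qed.

Lemma simplex_neq0 S : S \in K -> S != finset.set0.
Proof. by case: cK => K0 _ SK; apply: contraNneq K0 => <-. Qed.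

Lemma barycenter_in S : S \in K -> XK (barycenter S).
Proof.
move=> SK; have S0 : (0 < #|S|)%N by rewrite card_gt0 simplex_neq0.
split=> [v||].
- by rewrite coord_barycenter; case: ifP => // _; rewrite invr_ge0.
- under eq_bigr do rewrite coord_barycenter.
  by rewrite -big_mkcond /= sumr_const -[_ *+ _]mulr_natr mulVf // pnatr_eq0 -lt0n.
rewrite (_ : finset _ = S) //; apply/finset.setP => v; rewrite inE coord_barycenter.
by case: ifP => _; rewrite ?eqxx // invr_eq0 pnatr_eq0 -lt0n S0.
Qed.

Lemma barycenter_nbhs S :
  nbhs (barycenter S) [set p | forall v, v \in S -> 0 < coord p v].
Proof.
have FF := @nbhs_filter X (barycenter S).
have H v : nbhs (barycenter S) [set p | v \in S -> 0 < coord p v].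
  case: (boolP (v \in S)) => vS; last by apply: filterS filterT => p _ /=.
  have c0 : 0 < coord (barycenter S) v.
    by rewrite coord_barycenter vS invr_gt0 ltr0n; apply/card_gt0P; exists v.
  have cc : (fun p : X => p$(enum_rank v)) @ barycenter S --> (barycenter S)$(enum_rank v).
    exact: coord_continuous.
  have : nbhs (barycenter S) [set p | 0 < coord p v].
    by apply: (cc [set y | 0 < y]); exact: lt_nbhsr.
  by apply: (@filterS _ (nbhs (barycenter S)) FF) => p p0 _.
exact: (filter_forall FF H).
Qed.

(* If all simplices around [S] lie in [a |: S], a chart at the barycenter of [S]
   would map an open subset of R^D into a half-space, its center to the boundary. *)
Lemma half_space_star D (S : {set T}) (a : T) : locally_euclidean D XK ->
  S \in K -> (dim S < D)%N ->
  (forall S', S' \in K -> S \subset S' -> S' \subset a |: S) -> False.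
Proof.
case: D => // D leX SK dimS aS.
have [U [V [oU Ub oV [h [g [hc gc hP gP]]]]]] := leX _ (barycenter_in SK).
set b := barycenter S in Ub.
have XUb : (XK `&` U) b by split=> //; exact: barycenter_in.
have [Vb ghb] := hP _ XUb.
have [s sS] := set0Pn _ (simplex_neq0 SK).
pose e := s :: enum (S :\ s).
have mem_e v : (v \in e) = (v \in S).
  by rewrite inE mem_enum !inE; case: eqP => // ->.
have size_e : (size e <= D.+1)%N.
  by rewrite /= -cardE ltnS; move: dimS; rewrite /dim (cardsD1 s) sS.
(* The coordinate at [s] is determined by the others. Those of [S :\ s] come first, padded with
   zeros, and the last place is kept for [a]: it is nonnegative on the complex and 0 at the
   barycenter. *)
pose psi (p : X) : 'rV[R]_D.+1 :=
  \row_i if i == ord_max then (if a \in S then 0 else coord p a)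
         else if (i.+1 < size e)%N then coord p (nth s e i.+1) else 0.
have psi_cont p : psi @ nbhs p --> psi p.
  have FF := @nbhs_filter X p.
  apply: row_cvg => i; under eq_fun do rewrite mxE; rewrite mxE.
  by case: ifP => _; case: ifP => _; try exact: cvg_cst; exact: coord_continuous.
have psi_inj p q : XK p -> XK q -> (forall v, v \in S -> 0 < coord p v) ->
    (forall v, v \in S -> 0 < coord q v) -> psi p = psi q -> p = q.
  move=> Xp Xq p0 q0 pq.
  have supp r : XK r -> (forall v, v \in S -> 0 < coord r v) ->
      forall v, v \notin a |: S -> coord r v = 0.
    move=> [_ _ rK] r0 v; apply: contraNeq => rv.
    apply: (fintype.subsetP (aS _ rK _)); last by rewrite inE.
    by apply/fintype.subsetP => w wS; rewrite inE gt_eqF // r0.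
  have [_ p1 _] := Xp; have [_ q1 _] := Xq.
  rewrite -(fill_coord s p1) -(fill_coord s q1); apply: eq_fill => v vs.
  case: (boolP (v \in S)) => vS.
    have ve : v \in e by rewrite mem_e.
    have [k ke vk] : exists2 k, (k.+1 < size e)%N & v = nth s e k.+1.
      move: ve; rewrite inE (negbTE vs) /= => ve; exists (index v (enum (S :\ s))).
        by rewrite /= ltnS index_mem.
      by rewrite /= nth_index.
    have kD : (k < D)%N by rewrite -ltnS; exact: leq_trans ke size_e.
    have := congr1 (fun z : 'rV[R]_D.+1 => z$(widen_ord (leqnSn D) (Ordinal kD))) pq.
    rewrite !mxE /= ke vk; case: eqP => // /(congr1 val) /= kD'.
    by rewrite kD' ltnn in kD.
  case: (eqVneq v a) => [va|va]; last by rewrite !supp // !inE negb_or va.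
  have := congr1 (fun z : 'rV[R]_D.+1 => z$ord_max) pq.
  by rewrite !mxE eqxx -va (negbTE vS).
have Vnear : nbhs (h b) V by apply: open_nbhs_nbhs.
have /nbhs_cball[r r0 rP] : nbhs (h b) [set y | V y /\ forall v, v \in S -> 0 < coord (g y) v].
  have FF := @nbhs_filter _ (h b).
  have : nbhs (g (h b)) [set p : X | forall v, v \in S -> 0 < coord p v].
    by rewrite ghb; exact: barycenter_nbhs.
  have /subspace_continuousP/(_ _ Vb) gb := gc => /gb H.
  by apply: filterS2 Vnear H => y /= Vy /(_ Vy).
have [||d d0 dP] := @invariance_of_domain_at D.+1 (psi \o g) (h b) r r0.
- apply/subspace_continuousP => y /= yr; have [Vy _] := rP y yr.
  have /subspace_continuousP/(_ _ Vy) gy := gc.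
  have psig := cvg_comp _ _ gy (psi_cont (g y)).
  apply: cvg_trans psig; apply: cvg_app => A /= wA.
  have FF := @nbhs_filter _ y.
  have {}wA : nbhs y [set z | V z -> A z] by exact: wA.
  exact: (@filterS _ (nbhs y) FF _ _ (fun z Az zr => Az (rP z zr).1) wA).
- move=> y z /rP[Vy y0] /rP[Vz z0] /= /psi_inj -/(_ (gP y Vy).1.1 (gP z Vz).1.1 y0 z0) gyz.
  by rewrite -(gP y Vy).2 -(gP z Vz).2 gyz.
(* A point of the ball with negative last coordinate, outside the half-space. *)
have [|y /rP[Vy _] /= yc] := dP (psi b - (d / 2) *: delta_mx ord0 ord_max).
  rewrite /= ghb addrC addKr normrN normrZ gtr0_norm ?divr_gt0 //.
  apply: (@le_lt_trans _ _ (d / 2)); last by rewrite ltr_pdivrMr ?ltr0n // mulr_natr mulr2n ltrDl.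
  rewrite -[leRHS]mulr1 ler_pM2l ?divr_gt0 //; apply: rV_norm_le => // i.
  by rewrite mxE; case: (_ && _); rewrite ?normr0 ?normr1.
have := congr1 (fun z : 'rV[R]_D.+1 => z$ord_max) yc.
have [[[gy0 _ _] _] _] := gP y Vy.
rewrite !mxE !eqxx mulr1 /=; case: ifP => aS'.
  by apply/eqP; rewrite eq_sym sub0r oppr_eq0 gt_eqF // divr_gt0.
rewrite coord_barycenter aS' => ya; have := gy0 a; rewrite ya sub0r oppr_ge0 leNgt.
by rewrite divr_gt0.
Qed.

(* Two sheets [a |: S] and [b |: S] already fill a neighbourhood of the
   barycenter of [S], leaving no room for the third one. *)
Lemma three_sheets D (S : {set T}) (a b c : T) : locally_euclidean D XK ->
  #|S| = D -> S \in K -> a \notin S -> b \notin S -> c \notin S ->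
  a != b -> a != c -> b != c -> a |: S \in K -> b |: S \in K -> c |: S \in K -> False.
Proof.
case: D => [|D] leX cS SK aS bS cS' ab ac bc aK bK cK'.
  by move: (simplex_neq0 SK); rewrite -card_gt0 cS.
have [U [V [oU Ux oV [h [g [hc gc hP gP]]]]]] := leX _ (barycenter_in SK).
set x := barycenter S in Ux.
have XUx : (XK `&` U) x by split=> //; exact: barycenter_in.
have [s sS] := set0Pn _ (simplex_neq0 SK).
pose e := enum (S :\ s).
have size_e : size e = D.
  by rewrite -cardE; move: cS; rewrite (cardsD1 s) sS /= => -[].
pose y0 : 'rV[R]_D.+1 := 0.
pose ix v : 'I_D.+1 := inord (index v e).
(* The last coordinate is folded: positive values become weight on [a] and negative ones weight on
   [b], so [phi] runs through both sheets. The other coordinates move the weights on [S :\ s], and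
   [fill] balances at [s]. *)
pose w (y : 'rV[R]_D.+1) v : R :=
  if v == a then `|y$ord_max| + y$ord_max else if v == b then `|y$ord_max| - y$ord_max
  else if v \in S then coord x v + y$(ix v) else 0.
pose phi y := fill s (w y).
have ba : (b == a) = false by rewrite eq_sym (negbTE ab).
have ca : (c == a) = false by rewrite eq_sym (negbTE ac).
have cb : (c == b) = false by rewrite eq_sym (negbTE bc).
have sne v : v \notin S -> v != s by apply: contraNneq => ->.
have x0 v : v \notin S -> coord x v = 0 by rewrite coord_barycenter => /negbTE->.
have [_ x1 _] := XUx.1.
have phi_y0 : phi y0 = x.
  rewrite -(fill_coord s x1); apply: eq_fill => v vs; rewrite /w !mxE.
  case: eqP => [->|_]; first by rewrite normr0 addr0 x0.
  case: eqP => [->|_]; first by rewrite normr0 subr0 x0.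
  by case: ifPn => [_|/x0->//]; rewrite addr0.
have phi_cont y : phi @ nbhs y --> phi y.
  have FF := @nbhs_filter _ y; apply: fill_cvg => v; rewrite /w.
  have yc i : (fun y : 'rV[R]_D.+1 => y$i) @ nbhs y --> y$i by exact: coord_continuous.
  case: ifP => _; first by apply: cvgD; [apply: cvg_norm|]; exact: yc.
  case: ifP => _; first by apply: cvgB; [apply: cvg_norm|]; exact: yc.
  case: ifP => _; last exact: cvg_cst.
  by apply: cvgD; [exact: cvg_cst|exact: yc].
have near_x : nbhs x [set p | U p /\ forall v, v \in S -> 0 < coord p v].
  have FF := @nbhs_filter _ x.
  by apply: filterI; [exact: open_nbhs_nbhs|exact: barycenter_nbhs].
have /nbhs_cball[r r0 rP] : nbhs y0 [set y | U (phi y) /\ forall v, v \in S -> 0 < coord (phi y) v].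
  by move: near_x; rewrite -{1}phi_y0 => /(phi_cont y0).
have phiE y v : v != s -> coord (phi y) v = w y v by move=> /negbTE vs; rewrite coord_fill vs.
have phi_in y : `|y - y0| <= r -> (XK `&` U) (phi y).
  move=> /rP[Uy Sy]; split=> //; split; last 1 first.
  - set A := finset _; suff [->|[->|->]] : A = S \/ A = a |: S \/ A = b |: S by [].
    have At v : v \in S -> v \in A by move=> /Sy ?; rewrite inE gt_eqF.
    have Af v : v \notin S -> v != a -> v != b -> (v \in A) = false.
      by move=> vS /negbTE va /negbTE vb; rewrite inE phiE ?sne // /w va vb (negbTE vS) eqxx.
    have Aa : (a \in A) = (`|y$ord_max| + y$ord_max != 0) by rewrite inE phiE ?sne // /w eqxx.
    have Ab : (b \in A) = (`|y$ord_max| - y$ord_max != 0).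
      by rewrite inE phiE ?sne // /w ba eqxx.
    case: (ltrgt0P y$ord_max) Aa Ab => [t0|t0|->].
    + rewrite subrr eqxx gt_eqF ?addr_gt0 //= => Aa Ab; right; left; apply/finset.setP => v.
      rewrite in_setU1; case: (eqVneq v a) => [->//|va]; case: (boolP (v \in S)) => vS /=; first exact: At.
      by case: (eqVneq v b) => [->//|vb]; rewrite Af.
    + rewrite addNr eqxx gt_eqF ?subr_gt0 ?(lt_trans t0) ?oppr_gt0 //= => Aa Ab; right; right; apply/finset.setP => v.
      rewrite in_setU1; case: (eqVneq v b) => [->//|vb]; case: (boolP (v \in S)) => vS /=; first exact: At.
      by case: (eqVneq v a) => [->//|va]; rewrite Af.
    + rewrite subrr addr0 eqxx => Aa Ab; left; apply/finset.setP => v.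
      case: (boolP (v \in S)) => vS /=; first exact: At.
      by case: (eqVneq v a) => [->//|va]; case: (eqVneq v b) => [->//|vb]; rewrite Af.
  - move=> v; case: (boolP (v \in S)) => [/Sy/ltW//|vS]; rewrite phiE ?sne // /w (negbTE vS).
    case: ifP => _; first by rewrite -lerBlDr sub0r -normrN ler_norm.
    by case: ifP => _ //; rewrite subr_ge0 ler_norm.
  - exact: sum_fill.
have phi_inj y z : phi y = phi z -> y = z.
  move=> yz; have yzv v : v != s -> w y v = w z v by move=> vs; rewrite -!phiE // yz.
  have tt : y$ord_max = z$ord_max.
    have := yzv a (sne _ aS); have := yzv b (sne _ bS).
    by rewrite /w eqxx ba eqxx; lra.
  apply/rowP => i; case: (eqVneq i ord_max) => [->//|iD].
  have {}iD : (i < size e)%N.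
    by rewrite size_e ltn_neqAle -ltnS ltn_ord andbT -[D]/(val (@ord_max D)) (inj_eq val_inj).
  have : nth s e i \in e by exact: mem_nth.
  rewrite mem_enum !inE => /andP[vs vS].
  have := yzv _ vs; rewrite /w vS.
  have -> : (nth s e i == a) = false by apply: contraNF aS => /eqP<-.
  have -> : (nth s e i == b) = false by apply: contraNF bS => /eqP<-.
  by rewrite /ix index_uniq ?enum_uniq // inord_val => /addrI.
have [||d d0 dP] := @invariance_of_domain_at D.+1 (h \o phi) y0 r r0.
- apply/subspace_continuousP => y /= yr.
  have /subspace_continuousP/(_ _ (phi_in y yr)) hy := hc.
  apply: cvg_trans hy; rewrite [X in X `=>` _]fmap_comp; apply: cvg_app => A wA.
  have {}wA : nbhs y [set z | (XK `&` U) (phi z) -> A (phi z)] by exact: (phi_cont y _ wA).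
  have FF := @nbhs_filter _ y.
  exact: (@filterS _ (nbhs y) FF _ _ (fun z Az zr => Az (phi_in z zr)) wA).
- move=> y z /phi_in/hP[_ gy] /phi_in/hP[_ gz] /= hyz; apply: phi_inj.
  by rewrite -gy -gz hyz.
(* A path into the third sheet. Close to the barycenter its chart image must be attained by
   [h \o phi], although [phi] gives [c] no weight. *)
pose wz (t : R) v : R := if v == c then t else if v \in S then coord x v else 0.
pose z t := fill s (wz t).
have z0 : z 0 = x.
  rewrite -(fill_coord s x1); apply: eq_fill => v vs; rewrite /wz.
  case: eqP => [->|_]; first by rewrite x0.
  by case: ifPn => // /x0.
have z_cont : z @ nbhs (0 : R) --> x.
  rewrite -z0; have FF := @nbhs_filter _ (0 : R); apply: fill_cvg => v; rewrite /wz.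
  by case: (v == c); [exact: cvg_id|exact: cvg_cst].
have zE t v : v != s -> coord (z t) v = wz t v by move=> /negbTE vs; rewrite coord_fill vs.
have hx_near : nbhs x [set p | (XK `&` U) p -> `|h p - h x| < d].
  have /subspace_continuousP/(_ _ XUx) hx := hc.
  have : nbhs (h x) [set q | `|q - h x| < d].
    by apply/nbhs_ballP; exists d => // q; rewrite -ball_normE /= distrC.
  by move=> /hx.
have [t t0 [[Uz Sz] hz]] : exists2 t : R, 0 < t &
    (U (z t) /\ forall v, v \in S -> 0 < coord (z t) v) /\ ((XK `&` U) (z t) -> `|h (z t) - h x| < d).
  have FF := @nbhs_filter _ x.
  have near_z : nbhs (0 : R) (z @^-1` _) := z_cont _ (filterI near_x hx_near).
  have [q /= q0 qP] := (nbhs_ballP _ _).1 (near_z FF).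
  exists (q / 2); first by rewrite divr_gt0.
  apply: (qP (q / 2)); rewrite -ball_normE /= sub0r normrN gtr0_norm ?divr_gt0 //.
  by rewrite ltr_pdivrMr ?ltr0n // mulr_natr mulr2n ltrDl.
have XUz : (XK `&` U) (z t).
  split=> //; split; last 1 first.
  - rewrite (_ : finset _ = c |: S) //; apply/finset.setP => v; rewrite !inE.
    case: (boolP (v \in S)) => [/Sz z_gt0|vS]; first by rewrite gt_eqF // orbT.
    rewrite zE ?sne // /wz (negbTE vS) orbF; case: (v == c); last by rewrite eqxx.
    by rewrite gt_eqF.
  - move=> v; case: (boolP (v \in S)) => [/Sz/ltW//|vS]; rewrite zE ?sne // /wz (negbTE vS).
    by case: ifP => // _; exact: ltW.
  - exact: sum_fill.
have [|y yr /= hy] := dP (h (z t)); first by rewrite /= phi_y0; exact: hz.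
have zy : phi y = z t by rewrite -(hP _ (phi_in y yr)).2 -(hP _ XUz).2 hy.
have := congr1 (coord ^~ c) zy; rewrite phiE ?zE ?sne // /w /wz eqxx.
rewrite ca cb (negbTE cS') => /eqP.
by rewrite eq_sym gt_eqF.
Qed.

End Stars.

Lemma manifold_two_cofacets (R : realType) (T : finType) D (K : {set {set T}}) (S : {set T}) :
  simplicial_manifold R D K -> S \in K -> (dim S < D)%N ->
  exists a b, [/\ a != b, a \notin S, b \notin S, a |: S \in K & b |: S \in K].
Proof.
move=> [cK _ leK] SK dimS; pose A := [set v in ~: S | v |: S \in K]%SET.
have [/card_gt1P[a [b [aA bA ab]]]|A1] := ltnP 1 #|A|.
  by exists a, b; move: aA bA; rewrite !inE => /andP[? ?] /andP[? ?].
exfalso; have [s sS] := set0Pn _ (simplex_neq0 cK SK).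
have [a Aa] : exists a, A \subset [set a]%SET.
  (* Without any cofacet a vertex of [S] serves as [a], and then [a |: S] is just [S]. *)
  have [->|[a aA]] := finset.set_0Vmem A; first by exists s; exact: finset.sub0set.
  by exists a; apply/fintype.subsetP => v vA; rewrite inE; apply/eqP; apply: (card_le1_eqP A1).
apply: (half_space_star cK (a := a) leK SK dimS) => S' S'K /fintype.subsetP SS'.
apply/fintype.subsetP => v vS'; rewrite !inE.
case: (boolP (v \in S)) => vS; first by rewrite orbT.
have : v \in A.
  rewrite !inE vS /=; case: cK => _ /(_ _ (v |: S) S'K); apply.
    by apply/fintype.subsetP => w; rewrite !inE => /predU1P[->//|/SS'].
  by apply/set0Pn; exists v; rewrite !inE eqxx.
by move/(fintype.subsetP Aa); rewrite inE => ->.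
Qed.

Theorem theorem4p6 (R : realType) (T : finType) (D : nat) (K : {set {set T}})
    (hD : (3 <= D)%N) (hK : simplicial_manifold R D K) :
  (exists M : {set edge T}, interface_algorithm D K M) /\
  (forall M : {set edge T}, interface_algorithm D K M ->
     morse_matching K M /\
     2 / (D.+1)%:R * (OPT K)%:R <= (#|regular M|)%:R :> rat).
Proof.
have [cK dK leK] := hK.
have dimK s : s \in K -> (dim s <= D)%N.
  by move=> sK; rewrite -dK /complex_dim; apply: (leq_bigmax_cond (F := @dim T)).
have two s : s \in K -> (dim s < D)%N ->
    exists a b, [/\ a != b, a \notin s, b \notin s, a |: s \in K & b |: s \in K].
  exact: manifold_two_cofacets hK.
have three s a b c : s \in K -> #|s| = D ->
    a \notin s -> b \notin s -> c \notin s -> a != b -> a != c -> b != c ->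
    a |: s \in K -> b |: s \in K -> c |: s \in K -> False.
  by move=> sK cs; exact: (three_sheets cK leK cs sK).
split; first exact: interface_algorithm_exists.
move=> M algM; have [mM opt] := interface_algorithm_spec cK dimK two three hD algM.
split=> //; have {}opt : (2 * OPT K <= D.+1 * #|regular M|)%N.
  have [->|[Ms mMs ->]] : OPT K = 0%N \/ exists2 Ms, morse_matching K Ms & OPT K = #|regular Ms|.
  - rewrite /OPT; elim/big_ind: _ => [|x y|Ms /asboolP mMs]; [by left| |by right; exists Ms].
    by move=> hx hy; case: (leqP x y).
  - by rewrite muln0.
  - exact: opt.
have D0 : 0 < D.+1%:R :> rat by rewrite ltr0n.
by rewrite mulrAC ler_pdivrMr // -!natrM ler_nat [leqRHS]mulnC.
Qed.
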